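(* For every graph $G$, the topological cycles in the space DTOP of $G$ induce a matroid; that is, the set of edge sets of topological cycles (homeomorphic images of the unit circle $S^1$) in DTOP is the set of circuits of a matroid with ground set $E(G)$.
   Context: Graphs may be infinite. A ray is a one-way infinite path; two rays of $G$ are equivalent if for every finite vertex set $S$ they have tails in the same component of $G-S$; the equivalence classes are the (vertex-)ends of $G$, forming the set $\Omega(G)$. For a finite vertex set $S$ and an end $\omega$, $C(S,\omega)$ is the component of $G-S$ containing tails of the rays of $\omega$ ($\omega$ lives in $C(S,\omega)$). A vertex $v$ dominates an end $\omega$ if there are infinitely many paths from $v$ to some ray of $\omega$ that pairwise meet only in $v$; an end is dominated if some vertex dominates it, undominated otherwise. The space $|G|$ (VTOP) has as points the vertices of $G$, the ends of $G$, and for each edge $e$ a set $e\times(0,1)$ of interior points (edges being copies of $[0,1]$ whose endpoints are identified with the endvertices). A basis of its topology consists of the sets that are open in the 1-complex (simplicial) topology of $G$, together with the sets $C_{\vec\epsilon}(S,\omega)$, where $S$ is a finite vertex set, $\omega$ an end, and $\vec\epsilon$ a function from the set of edges with exactly one endvertex in $C(S,\omega)$ to $(0,1)$: $C_{\vec\epsilon}(S,\omega)$ consists of all vertices of $C(S,\omega)$, all ends living in $C(S,\omega)$, all interior points of edges with both endvertices in $C(S,\omega)$, and, for each edge $f$ with exactly one endvertex $t(f)$ in $C(S,\omega)$, the points of $f\times(0,1)$ at distance less than $\vec\epsilon(f)$ from $t(f)$. DTOP is the subspace of $|G|$ obtained by deleting all dominated ends. The edge set of a topological cycle is the set of edges having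 an interior point on it. Matroids are (possibly infinite) matroids in the sense of Bruhn, Diestel, Kriesell, Pendavingh and Wollan. *)

(* Defs.v *)
From HB Require Import structures.
From mathcomp Require Import all_boot all_order all_algebra.
From mathcomp Require Import all_classical all_reals all_analysis.

Set Implicit Arguments.
Unset Strict Implicit.
Unset Printing Implicit Defensive.

Import Order.TTheory GRing.Theory Num.Theory.
Import numFieldNormedType.Exports.

Local Open Scope classical_set_scope.
Local Open Scope ring_scope.

(* Infinite matroids, by the independence axioms (I1), (I2), (I3), (IM) of    *)
(* Bruhn, Diestel, Kriesell, Pendavingh and Wollan.                           *)

Section MaximalMinimal.
Context {E : Type}.
Implicit Types (F : set (set E)) (A B : set E).

Definition maximal_in F A := F A /\ forall B, F B -> A `<=` B -> B = A.
Definition minimal_in F A := F A /\ forall B, F B -> B `<=` A -> B = A.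

End MaximalMinimal.

Record matroid (E : Type) := Matroid {
  indep : set (set E);
  indep0 : indep set0;
  indepS : forall I J, indep J -> I `<=` J -> indep I;
  indep_aug : forall I J,
    indep I -> ~ maximal_in indep I -> maximal_in indep J ->
    exists x, [/\ J x, ~ I x & indep (x |` I)];
  indep_max : forall I X, indep I -> I `<=` X ->
    exists B, maximal_in [set J | [/\ indep J, I `<=` J & J `<=` X]] B }.

Definition circuits (E : Type) (M : matroid E) : set (set E) :=
  [set C | minimal_in (~` indep M) C].

(* Vertex and edge sets are arbitrary types; loops and parallel edges are     *)
(* allowed. The order of the two endvertices of an edge carries no meaning:   *)
(* it only fixes which endvertex corresponds to 0 and which one to 1 when the *)
(* edge is regarded as a copy of [0, 1].                                      *)
Record graph := Graph {
  vertex : Type;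
  edge : Type;
  src : edge -> vertex;
  tgt : edge -> vertex }.

HB.instance Definition _ (G : graph) := gen_eqMixin (vertex G).
HB.instance Definition _ (G : graph) := gen_choiceMixin (vertex G).

Section Ends.
Context {G : graph}.
Implicit Types (S C : set (vertex G)) (u v x y : vertex G).

Definition adjacent x y :=
  exists e : edge G, (src e = x /\ tgt e = y) \/ (src e = y /\ tgt e = x).

Definition is_walk x (p : seq (vertex G)) :=
  path (fun u v => `[< adjacent u v >]) x p.

Definition is_path x (p : seq (vertex G)) := is_walk x p && uniq (x :: p).

Definition connected_avoiding S x y :=
  exists p, [/\ is_walk x p, last x p = y & forall z, z \in x :: p -> ~ S z].

Definition is_component S C :=
  exists2 x, ~ S x & C = [set y | connected_avoiding S x y].

(* Parallel edges are irrelevant for ends, so that rays (and the paths        *)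
(* witnessing domination) are given by their sequences of vertices.           *)
Record ray := Ray {
  ray_vertex :> nat -> vertex G;
  ray_inj : injective ray_vertex;
  ray_adj : forall n, adjacent (ray_vertex n) (ray_vertex n.+1) }.

Definition tail_in C (r : ray) := exists n, forall m, (n <= m)%N -> C (r m).

Definition ray_equiv (r r' : ray) :=
  forall S, finite_set S ->
    exists C, [/\ is_component S C, tail_in C r & tail_in C r'].

Record gend := GEnd {
  end_rays : set ray;
  end_class : exists r, end_rays = [set r' | ray_equiv r r'] }.

(* C(S, w), as a vertex set *)
Definition end_comp S (w : gend) : set (vertex G) :=
  [set x | exists C, [/\ is_component S C, forall r, end_rays w r -> tail_in C r & C x]].

Definition dominates v (w : gend) :=
  exists2 r, end_rays w r &
  exists2 P : set (seq (vertex G)), infinite_set P &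
    (forall p, P p -> is_path v p /\ range r (last v p)) /\
    (forall p q, P p -> P q -> p <> q ->
       forall x, x \in v :: p -> x \in v :: q -> x = v).

Definition dominated (w : gend) := exists v, dominates v w.

Lemma adjacentC x y : adjacent x y -> adjacent y x.
Proof. by move=> [e [[]|[]]] *; exists e; [right|left]. Qed.

Lemma connected_refl S x : ~ S x -> connected_avoiding S x x.
Proof. by move=> Sx; exists [::]; split=> // z; rewrite inE => /eqP ->. Qed.

Lemma connected_trans S y x z : connected_avoiding S x y ->
  connected_avoiding S y z -> connected_avoiding S x z.
Proof.
move=> [p [wp <- Sp]] [q [wq <- Sq]]; exists (p ++ q); split.
- by rewrite /is_walk cat_path; apply/andP.
- by rewrite last_cat.
- move=> u; rewrite -cat_cons mem_cat => /orP[/Sp//|uq].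
  by apply: Sq; rewrite inE uq orbT.
Qed.

Lemma connected_sym S x y :
  connected_avoiding S x y -> connected_avoiding S y x.
Proof.
move=> [p [wp <- Sp]]; exists (rev (belast x p)); split.
- rewrite /is_walk rev_path; apply: sub_path wp => u v /asboolP uv.
  by apply/asboolP; exact: adjacentC.
- by case: p {wp Sp} => //= a p; rewrite rev_cons last_rcons.
- move=> z; rewrite -rev_rcons mem_rev -lastI; exact: Sp.
Qed.

Lemma connected_sub S T x y : S `<=` T ->
  connected_avoiding T x y -> connected_avoiding S x y.
Proof. by move=> ST [p [? ? Tp]]; exists p; split=> // z /Tp + /ST. Qed.

Lemma component_eq S C D x :
  is_component S C -> is_component S D -> C x -> D x -> C = D.
Proof.
move=> [c _ ->] [d _ ->] /= cx dx; apply/seteqP; split=> y /= h.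
  exact: connected_trans (connected_trans dx (connected_sym cx)) h.
exact: connected_trans (connected_trans cx (connected_sym dx)) h.
Qed.

Lemma ray_tail_component S (r : ray) : finite_set S ->
  exists2 C, is_component S C & tail_in C r.
Proof.
move=> Sfin.
have [n nP] : exists n, forall m, (n <= m)%N -> ~ S (r m).
  have /finite_seqP[X XE] : finite_set (r @^-1` S).
    by apply: finite_preimage => // ? ? _ _; exact: ray_inj.
  exists (\max_(i <- X) i).+1 => m + Srm.
  have mX : m \in X by have : [set` X] m by rewrite -XE.
  by rewrite ltnNge leq_bigmax_seq.
exists [set y | connected_avoiding S (r n) y]; first by exists (r n); [exact: nP|].
exists n => m /subnK <-; elim: (m - n)%N => [|k IH] /=.
  by apply: connected_refl; exact: nP.
apply: connected_trans IH _; exists [:: r (k.+1 + n)%N]; split=> //=.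
  by rewrite /is_walk /= andbT; apply/asboolP; exact: ray_adj.
by move=> z; rewrite !inE => /orP[] /eqP ->; apply: nP; exact: leq_addl.
Qed.

Lemma tail_in_meet C D (r : ray) : tail_in C r -> tail_in D r ->
  exists2 x, C x & D x.
Proof.
move=> [n Cn] [m Dm]; exists (r (maxn n m)).
  by apply: Cn; exact: leq_maxl.
by apply: Dm; exact: leq_maxr.
Qed.

Lemma ray_equiv_refl (r : ray) : ray_equiv r r.
Proof. by move=> S /(ray_tail_component r)[C cC rC]; exists C. Qed.

Lemma end_compP S (w : gend) : finite_set S ->
  is_component S (end_comp S w) /\ forall r, end_rays w r -> tail_in (end_comp S w) r.
Proof.
move=> Sfin; have [r wE] := end_class w.
have wr : end_rays w r by rewrite wE; exact: ray_equiv_refl.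
have [C cC rC] := ray_tail_component r Sfin.
have CP r' : end_rays w r' -> tail_in C r'.
  rewrite wE => /(_ _ Sfin)[D [cD rD r'D]].
  have [x Cx Dx] := tail_in_meet rC rD.
  by rewrite (component_eq cC cD Cx Dx).
suff -> : end_comp S w = C by [].
apply/seteqP; split=> [x [D [cD wD Dx]]|x Cx]; last by exists C.
have [y Cy Dy] := tail_in_meet rC (wD _ wr).
by rewrite (component_eq cC cD Cy Dy).
Qed.

Lemma end_comp_sub S T (w : gend) : S `<=` T ->
  end_comp T w `<=` end_comp S w.
Proof.
move=> ST x [_ [[d Td ->] wD dx]]; exists [set y | connected_avoiding S d y].
split; first by exists d => // /ST.
- move=> r /wD[n nP]; exists n => m /nP; exact: connected_sub.
- exact: connected_sub dx.
Qed.

Lemma end_comp_eq S T (w w' : gend) : finite_set T -> S `<=` T ->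
  end_comp T w = end_comp T w' -> end_comp S w = end_comp S w'.
Proof.
move=> Tfin ST ww'; have Sfin := sub_finite_set ST Tfin.
have [[x Tx xE] _] := end_compP w Tfin.
have xT : end_comp T w x by rewrite xE; exact: connected_refl.
have [cw _] := end_compP w Sfin; have [cw' _] := end_compP w' Sfin.
apply: (component_eq cw cw' (x := x)); apply: end_comp_sub ST _ _ => //.
by rewrite -ww'.
Qed.

End Ends.
Arguments ray : clear implicits.
Arguments gend : clear implicits.

Section VTOP.
Context {R : realType} {G : graph}.

Definition oint := {t : R | 0 < t < 1}.

(* The point set of |G|. *)
Inductive vtop :=
  | VPoint of vertex G
  | EPoint of edge G & oint
  | OPoint of gend G.

HB.instance Definition _ := gen_eqMixin vtop.
HB.instance Definition _ := gen_choiceMixin vtop.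

(* The canonical map from the copy of [0, 1] belonging to e. *)
Definition edge_map (e : edge G) (t : R) : vtop :=
  if insub t is Some s then EPoint e s
  else VPoint (if t <= 0 then src e else tgt e).

(* The 1-complex of G is the quotient of the disjoint union of the vertex set *)
(* and of the copies of [0, 1] given by the edges.                            *)
Definition complex_open (U : set vtop) :=
  (forall w, ~ U (OPoint w)) /\
  forall e, open (edge_map e @^-1` U : set (subspace `[0, 1]%classic)).

(* Only the values of eps at edges with exactly one endvertex in C(S, w)      *)
(* matter.                                                                    *)
Definition end_nbhd (S : set (vertex G)) (w : gend G) (eps : edge G -> oint) :
    set vtop :=
  let C := end_comp S w in
  [set z | match z with
  | VPoint v => C v
  | EPoint e t =>
      [\/ C (src e) /\ C (tgt e),
          [/\ C (src e), ~ C (tgt e) & val t < val (eps e)]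
        | [/\ ~ C (src e), C (tgt e) & 1 - val t < val (eps e)]]
  | OPoint w' => end_comp S w' = C
  end].

Definition vtop_basis : set (set vtop) :=
  [set U | complex_open U \/
    exists S w eps, finite_set S /\ U = end_nbhd S w eps].

Definition complex_points : set vtop :=
  [set z | if z is OPoint _ then False else True].

Lemma edge_map0 e : edge_map e 0 = VPoint (src e).
Proof. by rewrite /edge_map insubF ?lexx // ltxx. Qed.

Lemma edge_map1 e : edge_map e 1 = VPoint (tgt e).
Proof. by rewrite /edge_map insubF ?ler10 // ltxx andbF. Qed.

Lemma edge_mapP e (t : R) : `[0, 1]%classic t ->
  [\/ t = 0, t = 1 | exists2 s : oint, val s = t & edge_map e t = EPoint e s].
Proof.
rewrite /= in_itv /= !le_eqVlt => /andP[/orP[/eqP <-|t0]]; first by constructor 1.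
move=> /orP[/eqP ->|t1]; first by constructor 2.
constructor 3; rewrite /edge_map; case: insubP => [s _ sE|]; first by exists s.
by rewrite t0 t1.
Qed.

Lemma complex_open_points : complex_open complex_points.
Proof.
split=> [w []|e]; rewrite (_ : _ @^-1` _ = setT); first exact: openT.
by apply/seteqP; split=> // t _ /=; rewrite /edge_map; case: insub.
Qed.

Lemma complex_openI U V : complex_open U -> complex_open V ->
  complex_open (U `&` V).
Proof.
move=> [Uw Ue] [Vw Ve]; split=> [w [/Uw]//|e].
by rewrite preimage_setI; apply: openI.
Qed.

Lemma complex_open_end_nbhd S w eps :
  complex_open (end_nbhd S w eps `&` complex_points).
Proof.
split=> [w' [_]//|e]; apply/open_subspaceP.
have H (s : oint) : 0 < val s < 1 by exact: (valP s).
have /andP[e0 e1] := H (eps e).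
set C := end_comp S w.
have [Cs|Cs] := pselect (C (src e)); have [Ct|Ct] := pselect (C (tgt e)).
- exists setT; first exact: openT.
  apply/seteqP; split=> t [h It]; split=> //.
  have [->|->|[s _]] := edge_mapP e It; rewrite /= ?edge_map0 ?edge_map1 //.
  by move=> -> ; split=> //; constructor 1.
- exists [set t | t < val (eps e)]; first exact: open_lt.
  apply/seteqP; split=> t [h It]; split=> //; move: h;
  have [->|->|[s <-]] := edge_mapP e It; rewrite /= ?edge_map0 ?edge_map1 //.
  + by move=> /(lt_trans e1); rewrite ltxx.
  + by move=> -> h; split=> //; constructor 2.
  + by case=> /Ct.
  + by move=> -> [[[]|[]|[]]].
- exists [set t | 1 - val (eps e) < t]; first exact: open_gt.
  apply/seteqP; split=> t [h It]; split=> //; move: h;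
  have [->|->|[s <-]] := edge_mapP e It; rewrite /= ?edge_map0 ?edge_map1 //.
  + by rewrite subr_lt0 => /(lt_trans e1); rewrite ltxx.
  + by rewrite ltrBlDr -ltrBlDl => -> h; split=> //; constructor 3.
  + by case=> /Cs.
  + by rewrite ltrBlDr ltrDl.
  + by move=> -> [[[]|[]|[_ _]]] //; rewrite ltrBlDr -ltrBlDl.
- exists set0; first exact: open0.
  apply/seteqP; split=> t [h It]; split=> //; move: h.
  have [->|->|[s <-]] := edge_mapP e It; rewrite /= ?edge_map0 ?edge_map1 //.
  + by case.
  + by case.
  + by move=> -> [[[]|[]|[]]].
Qed.

Lemma vtop_basis_complex U : vtop_basis U ->
  complex_open (U `&` complex_points).
Proof.
move=> [oU|[S [w [eps [_ ->]]]]]; last exact: complex_open_end_nbhd.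
by apply: complex_openI => //; exact: complex_open_points.
Qed.

Lemma end_nbhd_sub S T w w' (eps eps' : edge G -> oint) :
  finite_set T -> S `<=` T -> end_comp S w' = end_comp S w ->
  (forall e, val (eps' e) <= val (eps e)) ->
  end_nbhd T w' eps' `<=` end_nbhd S w eps.
Proof.
move=> Tfin ST ww' ee'; have sub : end_comp T w' `<=` end_comp S w.
  by rewrite -ww'; exact: end_comp_sub.
case=> [v /sub //|e t|w'' /(end_comp_eq Tfin ST)] /=; last by rewrite ww'.
case=> [[/sub ? /sub ?]|[/sub Cs _ te]|[_ /sub Ct te]]; first by constructor 1.
- have [Ct|Ct] := pselect (end_comp S w (tgt e)); first by constructor 1.
  by constructor 2; split=> //; exact: lt_le_trans te (ee' e).
- have [Cs|Cs] := pselect (end_comp S w (src e)); first by constructor 1.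
  by constructor 3; split=> //; exact: lt_le_trans te (ee' e).
Qed.

Let vtop_basis_cover : \bigcup_(U in vtop_basis) U = setT.
Proof.
apply/seteqP; split=> // z _.
have h2 : 0 < (2^-1 : R) < 1 by rewrite invr_gt0 ltr0n invf_lt1 ?ltr0n ?ltr1n.
case: z => [v|e t|w].
- by exists complex_points => //; left; exact: complex_open_points.
- by exists complex_points => //; left; exact: complex_open_points.
- exists (end_nbhd set0 w (fun=> exist (fun t : R => is_true (0 < t < 1)) _ h2)) => //; right.
  by do 3 eexists; split; last reflexivity.
Qed.

Let vtop_basis_join (U V : set vtop) (z : vtop) :
  vtop_basis U -> vtop_basis V -> U z -> V z ->
  exists W, [/\ vtop_basis W, W z & W `<=` U `&` V].
Proof.
move=> bU bV Uz Vz.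
have [zC|zC] := pselect (complex_points z).
  exists ((U `&` complex_points) `&` (V `&` complex_points)); split=> //.
  - by left; apply: complex_openI; exact: vtop_basis_complex.
  - by move=> y [[? _] [? _]].
case: z Uz Vz zC => [v _ _ []//|e t _ _ []//|w Uw Vw _].
case: bU bV => [[/(_ _ Uw)//]|[S [wS [eS [Sfin UE]]]]].
case=> [[/(_ _ Vw)//]|[T [wT [eT [Tfin VE]]]]]; subst U V.
pose e3 e := if val (eS e) <= val (eT e) then eS e else eT e.
have STfin : finite_set (S `|` T) by rewrite finite_setU.
exists (end_nbhd (S `|` T) w e3); split=> //.
  by right; exists (S `|` T), w, e3.
move=> y Wy; split; apply: end_nbhd_sub Wy => //.
- by move=> e; rewrite /e3; case: ifP => // /negbT; rewrite -ltNge => /ltW.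
- by move=> e; rewrite /e3; case: ifP.
Qed.

HB.instance Definition _ := isBaseTopological.Build vtop
  vtop_basis_cover vtop_basis_join.

Definition dtop : set vtop :=
  [set z | if z is OPoint w then ~ dominated w else True].

Definition edges_of (X : set dtop) : set (edge G) :=
  [set e | exists2 x, X x & exists t, val x = EPoint e t].

End VTOP.
Arguments vtop R G : clear implicits.
Arguments dtop R G : clear implicits.

Definition unit_circle (R : realType) : set (R * R) :=
  [set p | p.1 ^+ 2 + p.2 ^+ 2 = 1].
Arguments unit_circle : clear implicits.

Definition homeomorphic (T U : topologicalType) :=
  exists (f : T -> U) (g : U -> T),
    [/\ cancel f g, cancel g f, continuous f & continuous g].

(* Subsets carry the subspace topology, via the coercion set_type. *)
Definition topological_cycle (R : realType) (T : topologicalType) (X : set T) :=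
  homeomorphic (unit_circle R) X.

(* Main.v *)
From HB Require Import structures.
From mathcomp Require Import all_boot all_order all_algebra finmap.
From mathcomp Require Import all_classical all_reals all_analysis lra ring.
Require Import Defs.

(** The undominated ends are captured by a decreasing sequence of vertex sets
    [Y n] (a layering): the components of the [Y n] have finite neighbourhoods
    and form a tree whose branches are exactly the undominated ends.  A vertex
    set is decided if it is constant on some node of every branch; decided sets
    are the traces of the clopen subsets of the space of vertices and
    undominated ends.  An edge is spanned by [P] if no decided set separates its
    endvertices without separating the endvertices of an edge of [P].  Symmetric
    differences of decided sets give the exchange property, and maximal
    independent sets between [I] and [X] are built layer by layer: below a node
    only the finitely many traces on its finite neighbourhood matter, so that
    one can pass to a spanning subset independently in each node.

    A set [C] is a circuit of this matroid iff it is nonempty, no decided set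
    separates exactly one edge of [C], and any two edges of [C] are exactly the
    edges of [C] separated by some decided set.  Extending decided sets linearly
    along the edges gives continuous functions on DTOP.  By the intermediate
    value theorem these show that a topological cycle satisfies the condition.
    Conversely, given such a [C] and an edge [e] of [C], the sets separating
    just [e] and [g], for the other edges [g] of [C], induce a linear order on
    the points of [C] off [e]; a weighted sum of their functions maps these
    points bijectively onto an interval, which [e] closes up to a circle. *)

Set Implicit Arguments.
Unset Strict Implicit.
Unset Printing Implicit Defensive.

Import Order.TTheory GRing.Theory Num.Theory.
Import numFieldNormedType.Exports.

Local Open Scope classical_set_scope.

(** * Layerings *)

(** Closure is defined dually, by separations instead of arcs, so that topology enters only when
    circuits are identified. The obstacle is then axiom (IM). A circuit may be infinite, so the
    union of a chain of independent sets may be dependent; and spanning sets may decrease to an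
    intersection that no longer spans, as infinitely many parallel edges show. Zorn's lemma thus
    fails in both directions and is available only where dependencies have been made finitary. The
    layers provide the missing compactness. An undominated end can be separated from any finite
    vertex set, but there may be uncountably many such ends, with separators of unbounded size that
    cross each other. One set serving all of them is obtained by choosing separators of least size
    and uncrossing them by submodularity. Being decided is tested only along branches, so dominated
    ends impose no condition; this matches their deletion from the space. *)

Lemma ex_min_measure (T : Type) (P : T -> Prop) (f : T -> nat) :
  (exists x, P x) -> exists2 x, P x & forall y, P y -> (f x <= f y)%N.
Proof.
move=> [x Px]; have [n] := ubnP (f x); elim: n x Px => // n IH x Px xn.
have [h|/existsNP[y /not_implyP[Py /negP]]] :=
  pselect (forall y, P y -> (f x <= f y)%N); first by exists x.
rewrite -ltnNge => yx; apply: (IH y) => //; exact: leq_trans yx _.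
Qed.

Lemma finite_uniform (T : Type) (S : set T) (Q : nat -> T -> Prop) :
  finite_set S -> (forall n m x, (n <= m)%N -> Q n x -> Q m x) ->
  (forall x, S x -> exists n, Q n x) -> exists n, forall x, S x -> Q n x.
Proof.
move=> fS mono /= h.
have /choice[k kP] : forall x, exists n, S x -> Q n x.
  by move=> x; have [/h[n ?]|nS] := pselect (S x); [exists n|exists 0%N].
have /finite_seqP[X XE] : finite_set (k @` S) by exact: finite_image.
exists (\max_(i <- X) i)%N => x Sx; apply: mono (kP _ Sx).
apply: leq_bigmax_seq => //; have : [set` X] (k x) by rewrite -XE; exists x.
by [].
Qed.

Definition ncard (T : choiceType) (A : set T) : nat := #|` fset_set A|%fset.

Lemma ncard_sub (T : choiceType) (A B : set T) :
  finite_set B -> A `<=` B -> (ncard A <= ncard B)%N.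
Proof.
move=> fB AB; apply: fsubset_leq_card; apply/fsubsetP => x.
have fA := sub_finite_set AB fB.
by rewrite !in_fset_set // !inE; exact: AB.
Qed.

Lemma ncard_proper (T : choiceType) (A B : set T) x :
  finite_set B -> A `<=` B -> B x -> ~ A x -> (ncard A < ncard B)%N.
Proof.
move=> fB AB Bx Ax; apply: fproper_ltn_card; have fA := sub_finite_set AB fB.
rewrite fproperE; apply/andP; split.
  by apply/fsubsetP => y; rewrite !in_fset_set // !inE; exact: AB.
apply/fsubsetPn; exists x; rewrite in_fset_set // ?inE //; apply/negP; rewrite inE//.
Qed.

(** Inclusion-exclusion on both sides. The four sets will be neighbourhoods, so that submodularity
    of their sizes reduces to two inclusions. *)
Lemma ncard_submod (T : choiceType) (S S' X Y : set T) :
  finite_set S -> finite_set S' -> X `|` Y `<=` S `|` S' ->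
  X `&` Y `<=` S `&` S' -> (ncard X + ncard Y <= ncard S + ncard S')%N.
Proof.
move=> fS fS' sU sI; have fU : finite_set (S `|` S') by rewrite finite_setU.
have fXY := sub_finite_set sU fU.
have [fX fY] : finite_set X /\ finite_set Y by move: fXY; rewrite finite_setU.
rewrite /ncard -[X in (X <= _)%N]cardfsUI -[X in (_ <= X)%N]cardfsUI.
rewrite -!fset_setU // -!fset_setI //; apply: leq_add; apply: ncard_sub => //.
exact: finite_setIl.
Qed.

Lemma ncard_le_finite (T : choiceType) (S : set T) (m : nat) :
  (forall X : {fset T}, [set` X] `<=` S -> (#|` X| <= m)%N) ->
  finite_set S /\ (ncard S <= m)%N.
Proof.
move=> h; have fS : finite_set S.
  apply: contrapT => /(@infinite_set_fset _ _ m.+1)[B BS].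
  by rewrite leqNgt ltnS h.
by split=> //; apply: h; rewrite fset_setK.
Qed.

(** * Components and neighbourhoods of vertex sets *)

Section Components.
Context {G : graph}.
Implicit Types (O A B D Z U W : set (vertex G)) (x y v : vertex G).

(** [O] is the set of vertices that are kept, not deleted; the result is empty if [x] lies outside
    [O]. *)
Definition comp O x : set (vertex G) := [set y | connected_avoiding (~` O) x y].

Definition nbh B : set (vertex G) :=
  [set v | ~ B v /\ exists2 b, B b & adjacent b v].

Lemma comp_sub O x : comp O x `<=` O.
Proof.
move=> _ [p [_ <- h]]; apply: contrapT; apply: h; exact: mem_last.
Qed.

Lemma comp_id O x : O x -> comp O x x.
Proof. by move=> Ox; apply: connected_refl => /(_ Ox). Qed.

Lemma comp_dom O x y : comp O x y -> O x.
Proof. by move=> [p [_ _ h]]; apply: contrapT; apply: h; rewrite inE eqxx. Qed.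

Lemma comp_step O x a b : comp O x a -> O b -> adjacent a b -> comp O x b.
Proof.
move=> xa Ob ab; have Oa := comp_sub xa; apply: connected_trans xa _.
exists [:: b]; split=> //=; first by rewrite /is_walk /= andbT; apply/asboolP.
by move=> z; rewrite !inE => /orP[] /eqP -> h; exact: h.
Qed.

Lemma comp_ind O x Z : Z x ->
  (forall a b, comp O x a -> Z a -> O b -> adjacent a b -> Z b) -> comp O x `<=` Z.
Proof.
move=> Zx h _ [p [wp <- Op]].
have Ox : O x by apply: contrapT; apply: Op; rewrite inE eqxx.
suff gen q a : comp O x a -> Z a -> is_walk a q ->
    (forall z, z \in a :: q -> ~ (~` O) z) -> Z (last a q).
  by apply: gen => //; exact: comp_id.
elim: q a => //= b q IH a xa Za /andP[/asboolP ab wq] Oq.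
have Ob : O b by apply: contrapT; apply: Oq; rewrite !inE eqxx orbT.
apply: IH => //; first exact: comp_step xa Ob ab.
- exact: (h a).
- by move=> z zq; apply: Oq; rewrite inE zq orbT.
Qed.

Lemma comp_eq O x y : comp O x y -> comp O y = comp O x.
Proof.
move=> xy; apply/seteqP; split=> z h; first exact: connected_trans xy h.
exact: connected_trans (connected_sym xy) h.
Qed.

Lemma comp_mono O O' x : O `<=` O' -> comp O x `<=` comp O' x.
Proof. by move=> OO' y; apply: connected_sub; exact: subsetC. Qed.

Lemma comp_conn O x Z a : comp O x a -> Z a ->
  (forall b c, comp O x b -> comp O x c -> Z b -> adjacent b c -> Z c) ->
  comp O x `<=` Z.
Proof.
move=> xa Za h; rewrite -(comp_eq xa); apply: comp_ind => // b c + Zb Oc bc.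
by rewrite (comp_eq xa) => xb; apply: (h b) => //; exact: comp_step xb Oc bc.
Qed.

Lemma nbh_comp O x v : nbh (comp O x) v -> ~ O v.
Proof. by move=> [nv [b xb bv]] Ov; apply: nv; exact: comp_step xb Ov bv. Qed.

Lemma comp_subcomp O O' x a : comp O x `<=` O' -> comp O x a ->
  comp O x `<=` comp O' a.
Proof.
move=> sub xa; have Oa := sub _ xa; apply: comp_conn xa _ _; first exact: comp_id.
by move=> b c xb xc ab bc; apply: comp_step ab _ bc; exact: sub.
Qed.

Lemma nbh_sub_closed B v w : B v -> adjacent v w -> B w \/ nbh B w.
Proof.
by move=> Bv vw; have [|nB] := pselect (B w); [left|right; split=> //; exists v].
Qed.

Lemma ray_avoid (S : set (vertex G)) (r : ray G) : finite_set S ->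
  exists n, forall m, (n <= m)%N -> ~ S (r m).
Proof.
move=> /(ray_tail_component r)[C [x _ ->] [n h]]; exists n => m /h.
by move=> [p [_ <- hp]]; apply: hp; exact: mem_last.
Qed.

Lemma tail_in_comp A (r : ray G) : tail_in A r ->
  exists n, A (r n) /\ forall m, (n <= m)%N -> comp A (r n) (r m).
Proof.
move=> [n h]; exists n; split; first exact: h.
move=> m /subnK <-; elim: (m - n)%N => [|k IH].
  by apply: comp_id; exact: h.
by rewrite addSn; apply: comp_step IH _ (ray_adj r _); apply: h; rewrite leqW// leq_addl.
Qed.

(** Beyond the finitely many vertices of [nbh B] the ray can no longer pass between [B] and the
    outside. *)
Lemma tail_in_dich B (r : ray G) : finite_set (nbh B) ->
  tail_in B r \/ tail_in (~` (B `|` nbh B)) r.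
Proof.
move=> /(ray_avoid r)[n h].
have [[m [nm Bm]]|nB] := pselect (exists m, (n <= m)%N /\ B (r m)); last first.
  by right; exists n => m nm [Bm|]; [apply: nB; exists m|exact: h].
left; exists m => k /subnK <-; elim: (k - m)%N => [|j IH]; first by rewrite add0n.
rewrite addSn; have [//|] := nbh_sub_closed IH (ray_adj r _).
by move=> /h[]; rewrite leqW// (leq_trans nm)// leq_addl.
Qed.

Lemma tail_inI A B (r : ray G) : tail_in A r -> tail_in B r -> tail_in (A `&` B) r.
Proof.
move=> [n An] [m Bm]; exists (maxn n m) => k; rewrite geq_max => /andP[nk mk].
by split; [exact: An|exact: Bm].
Qed.

Lemma tail_in_sub A B (r : ray G) : A `<=` B -> tail_in A r -> tail_in B r.
Proof. by move=> AB [n h]; exists n => m /h /AB. Qed.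

Lemma tail_in_diff A B (r : ray G) : finite_set (nbh B) ->
  tail_in A r -> ~ tail_in B r -> tail_in (A `\` (B `|` nbh B)) r.
Proof.
move=> fB Ar nBr; have [//|/(tail_inI Ar) h] := tail_in_dich r fB.
by apply: tail_in_sub h => z [].
Qed.

End Components.

(** Each [v] is captured from some member of the chain on, and of finitely many members of a chain
    one contains all others. *)
Lemma chain_capture (T : eqType) (W : Type) (Q : set W -> T -> Prop)
    (F : set (set W)) (X1 : set W) (Z : seq T) :
  total_on F subset -> F X1 ->
  (forall v, v \in Z -> exists X, [/\ F X, X1 `<=` X &
     forall Y, F Y -> X `<=` Y -> Q Y v]) ->
  exists X, [/\ F X, X1 `<=` X & forall Y, F Y -> X `<=` Y -> {in Z, forall v, Q Y v}].
Proof.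
move=> tot FX1; elim: Z => [_|v s IH h]; first by exists X1; split.
have [|X [FX X1X Xs]] := IH; first by move=> w ws; apply: h; rewrite inE ws orbT.
have [|X' [FX' X1X' X'v]] := h v; first by rewrite inE eqxx.
have [sub|sub] := tot _ _ FX FX'.
  exists X'; split=> // Y FY X'Y w; rewrite inE => /orP[/eqP ->|ws].
    exact: X'v.
  by apply: Xs => //; exact: subset_trans X'Y.
exists X; split=> // Y FY XY w; rewrite inE => /orP[/eqP ->|ws].
  by apply: X'v => //; exact: subset_trans XY.
exact: Xs.
Qed.

(** * Separating all given rays from a vertex set at once *)

Section Stage.
Context {G : graph}.
Implicit Types (O A B D Z W : set (vertex G)) (x y v : vertex G).
Variables (U : set (vertex G)) (Rs : set (ray G)).

(** Keeping the neighbourhood away from [U] as well is what later places the neighbourhood of a new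
    component inside the old one. *)
Definition region B :=
  finite_set (nbh B) /\ forall u, U u -> ~ B u /\ ~ nbh B u.

Hypothesis RsP : forall r, Rs r -> exists2 B, region B & tail_in B r.

Let ord B := ncard (nbh B).

Definition tight B (r : ray G) := [/\ region B, tail_in B r &
  forall B', region B' -> tail_in B' r -> (ord B <= ord B')%N].

(** Tightness makes uncrossing profitable, and the uniform bound [k] stops orders from growing
    without limit along a chain. *)
Let good k O := forall x, O x ->
  (ord (comp O x) <= k)%N /\ exists2 r, Rs r & tight (comp O x) r.

Let ex_tight r : Rs r -> exists A, tight A r.
Proof.
move=> /RsP[B rB Br].
have [A [rA Ar] h] := @ex_min_measure _ (fun B => region B /\ tail_in B r) ord
  (ex_intro _ B (conj rB Br)).
by exists A; split=> // B' rB' B'r; apply: h.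
Qed.

Let region_nbh B B' : region B -> region B' ->
  (forall S, nbh S `<=` nbh B `|` nbh B' -> S `<=` B `|` B' -> region S).
Proof.
move=> [fB uB] [fB' uB'] S NS SS; split.
  by apply: sub_finite_set NS _; rewrite finite_setU.
move=> u Uu; have [? ?] := uB _ Uu; have [? ?] := uB' _ Uu.
by split=> [/SS[]|/NS[]].
Qed.

Let nbhU A B : nbh (A `|` B) `<=` nbh A `|` nbh B.
Proof.
move=> v [/not_orP[nA nB] [b [Ab|Bb] bv]]; first by left; split=> //; exists b.
by right; split=> //; exists b.
Qed.

Let nbhI A B : nbh (A `&` B) `<=` nbh A `|` nbh B.
Proof.
move=> v [nAB [b [Ab Bb] bv]].
have [Av|nA] := pselect (A v); last by left; split=> //; exists b.
by right; split; [move=> Bv; apply: nAB|exists b].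
Qed.

Let nbhD A B : nbh (A `\` (B `|` nbh B)) `<=` (nbh A `|` nbh B) `\` B.
Proof.
move=> v [nv [b [Ab /not_orP[nB nNB]] bv]].
have nBv : ~ B v by move=> Bv; apply: nNB; split=> //; exists v => //; exact: adjacentC.
split=> //; have [Av|nA] := pselect (A v); last by left; split=> //; exists b.
right; apply: contrapT => nNBv; apply: nv; split=> //; by case.
Qed.

Let submodUI A B : finite_set (nbh A) -> finite_set (nbh B) ->
  (ord (A `|` B) + ord (A `&` B) <= ord A + ord B)%N.
Proof.
move=> fA fB; apply: ncard_submod => //.
  by move=> v [/nbhU|/nbhI].
move=> v [[/not_orP[nA nB] _] [_ [b [Ab Bb] bv]]].
by split; split=> //; exists b.
Qed.

Let submodD A B : finite_set (nbh A) -> finite_set (nbh B) ->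
  (ord (A `\` (B `|` nbh B)) + ord (B `\` (A `|` nbh A)) <= ord A + ord B)%N.
Proof.
move=> fA fB; apply: ncard_submod => //.
  by move=> v [/nbhD[]//|/nbhD[+ _]]; rewrite setUC.
move=> v [h1 h2]; have [_ nB] := nbhD h1; have [_ nA] := nbhD h2.
move: h1 h2 => [_ [b [Ab _] bv]] [_ [c [Bc _] cv]].
by split; split=> //; [exists b|exists c].
Qed.

(* A tight region of an uncovered ray is uncrossed from the components of [O]   *)
(* by submodularity; once disjoint from them it could be added to [O].           *)
Let good_cover k O r : good k O -> (forall O', O `<` O' -> ~ good k O') ->
  Rs r -> (exists2 A, tight A r & (ord A <= k)%N) ->
  exists2 x, O x & tail_in (comp O x) r.
Proof.
move=> gO maxO Rr [A0 tA0 A0k]; apply: contrapT => unc.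
(* Among the tight regions of [r], one whose neighbourhood meets [O] least; [improve] turns any
   better candidate into a contradiction. *)
have [A tA minA] := @ex_min_measure _ (fun A => tight A r)
  (fun A => ncard (nbh A `&` O)) (ex_intro _ A0 tA0).
have Ak : (ord A <= k)%N.
  by move: tA tA0 => [_ _ h] [rA0 A0r _]; apply: leq_trans (h _ rA0 A0r) A0k.
have [rA Ar hA] := tA; have [fA uA] := rA.
have improve A' v : region A' -> tail_in A' r -> (ord A' <= ord A)%N ->
    nbh A v -> O v -> ~ nbh A' v -> nbh A' `&` O `<=` nbh A `&` O -> False.
  move=> rA' A'r oA' Nv Ov nN' sub; have tA' : tight A' r.
    by split=> // B' rB' B'r; apply: leq_trans oA' (hA _ rB' B'r).
  have := minA _ tA'; rewrite leqNgt => /negP; apply.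
  by apply: (@ncard_proper _ _ _ v) => //; [exact: finite_setIl|case].
have disj v : nbh A v -> O v -> False.
  move=> Nv Ov; have [_ [s Rs_s [rB Bs hB]]] := gO _ Ov.
  set B := comp O v in rB Bs hB; have Bv : B v by exact: comp_id.
  have NBO : nbh B `<=` ~` O by move=> w /nbh_comp.
  have [fB uB] := rB.
  (* If [A] holds a tail of [s], the intersection of [A] and [B] competes with the tight [B], so by
     submodularity the union is no larger than [A]. Otherwise the two differences are compared in
     the same way. Either way the new neighbourhood loses [v] and gains nothing inside [O]. *)
  have [As|nAs] := pselect (tail_in A s).
    have := submodUI fA fB; have rI : region (A `&` B).
      by apply: region_nbh rA rB _ _ _ => // w [Aw _]; left.
    have rU : region (A `|` B) by apply: region_nbh rA rB _ _ _.
    have := hB _ rI (tail_inI As Bs) => le1 le2.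
    apply: (improve (A `|` B) v) => //.
    - by apply: tail_in_sub Ar; left.
    - by rewrite -(leq_add2r (ord (A `&` B))) (leq_trans le2)// leq_add2l.
    - by move=> [nU _]; apply: nU; right.
    - by move=> w [/nbhU[//|/NBO nO] Ow].
  have nBr : ~ tail_in B r by move=> Br; apply: unc; exists v.
  have rA' : region (A `\` (B `|` nbh B)).
    apply: region_nbh rA rB _ _ _ => [w /nbhD[]//|w [Aw _]]; by left.
  have rB' : region (B `\` (A `|` nbh A)).
    apply: region_nbh rA rB _ _ _ => [w /nbhD[+ _]|w [Bw _]]; last by right.
    by rewrite setUC.
  have := hB _ rB' (tail_in_diff fA Bs nAs) => le1; have le2 := submodD fA fB.
  apply: (improve (A `\` (B `|` nbh B)) v) => //.
  - exact: tail_in_diff.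
  - by rewrite -(leq_add2r (ord (B `\` (A `|` nbh A)))) (leq_trans le2)// leq_add2l.
  - by move=> /nbhD[_ /(_ Bv)].
  - by move=> w [/nbhD[[//|/NBO nO] _] Ow].
(* Only the component of [A] holding the tail is added. As its neighbourhood misses [O], it becomes
   a component of the enlarged set, swallows the components of [O] that it meets and leaves the
   others unchanged. *)
have [n [An Dn]] := tail_in_comp Ar; set D := comp A (r n) in Dn.
have DA : D `<=` A by exact: comp_sub.
have ND : nbh D `<=` nbh A.
  by move=> v /[dup] /nbh_comp nAv [_ [b Db bv]]; split=> //; exists b => //; exact: DA.
have NDO v : nbh D v -> O v -> False by move=> /ND; exact: disj.
have Dr : tail_in D r by exists n.
have rD : region D.
  by apply: (region_nbh rA rA) => [v /ND|v /DA]; left.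
have tD : tight D r.
  split=> // B' rB' B'r; apply: leq_trans (hA _ rB' B'r); exact: ncard_sub.
have Dk : (ord D <= k)%N by apply: leq_trans Ak; exact: ncard_sub.
have compD x : D x -> comp (O `|` D) x = D.
  move=> Dx; apply/seteqP; split.
    apply: comp_ind => // a b _ Da Ob ab.
    have [//|Nb] := nbh_sub_closed Da ab.
    by case: Ob => // /(NDO _ Nb).
  rewrite {1}/D; apply: comp_subcomp => //; by right.
have compO x : O x -> ~ D x -> comp (O `|` D) x = comp O x.
  move=> Ox nDx; have dis a : comp O x a -> ~ D a.
    move=> xa Da; apply: nDx; apply: (comp_conn xa Da) (comp_id Ox) => b c _ xc Db bc.
    have [//|Nc] := nbh_sub_closed Db bc.
    by have := NDO _ Nc (comp_sub xc).
  apply/seteqP; split; last by apply: comp_mono; left.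
  apply: comp_ind; first exact: comp_id.
  move=> a b _ xa [Ob|Db] ab; first exact: comp_step xa Ob ab.
  have [Da|Na] := nbh_sub_closed Db (adjacentC ab); first by have := dis _ xa.
  by have := NDO _ Na (comp_sub xa).
apply: (maxO (O `|` D)).
  split; first by left.
  move=> sub; apply: unc; exists (r n); first by apply: sub; right; exact: comp_id.
  exists n => m /Dn; apply: comp_subcomp; last exact: comp_id.
  by move=> z Dz; apply: sub; right.
move=> x OD; have [Dx|nDx] := pselect (D x).
  by rewrite compD //; split=> //; exists r.
by rewrite compO //; [case: OD => // /gO|case: OD].
Qed.

Let compU F x X : total_on F subset -> F X -> X x ->
  comp (\bigcup_(Y in F) Y) x = \bigcup_(Y in [set Y | F Y /\ X `<=` Y]) comp Y x.
Proof.
move=> tot FX Xx; apply/seteqP; split.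
  apply: comp_ind; first by exists X; [split|exact: comp_id].
  move=> a b _ [Y [FY XY] ya] [Y' FY' Y'b] ab.
  have [YY'|Y'Y] := tot _ _ FY FY'.
    exists Y'; first by split=> //; exact: subset_trans YY'.
    exact: comp_step (comp_mono YY' ya) Y'b ab.
  by exists Y => //; apply: comp_step ya _ ab; exact: Y'Y.
by move=> y [Y [FY _]]; apply: comp_mono => z Yz; exists Y.
Qed.

(** Start from a member [X1] of the chain at which the component of [x] has the largest order [m].
    Every finite part of the limit neighbourhood lies in the neighbourhood at some later member, so
    the limit order is at most [m]; as the limit still holds the tail of [r], tightness passes to
    it. *)
Let good_bigcup k F : F !=set0 -> F `<=` good k -> total_on F subset ->
  good k (\bigcup_(Y in F) Y).
Proof.
move=> _ Fg tot x [X0 FX0 X0x]; set O := \bigcup_(Y in F) Y.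
have [X1 [FX1 X1x] maxX] := @ex_min_measure _ (fun X => F X /\ X x)
  (fun X => (k - ord (comp X x))%N) (ex_intro _ X0 (conj FX0 X0x)).
have [le1 [r Rr t1]] := Fg _ FX1 _ X1x; have [r1 T1 h1] := t1.
set m := ord (comp X1 x); have OE := compU tot FX1 X1x.
have ordX X : F X -> X1 `<=` X -> (ord (comp X x) <= m)%N.
  move=> FX X1X; have [leX _] := Fg _ FX _ (X1X _ X1x).
  have := maxX X (conj FX (X1X _ X1x)); rewrite -/m.
  by move=> h; rewrite -(leq_sub2lE (m := k)).
have nbhO v : nbh (comp O x) v -> exists X, [/\ F X, X1 `<=` X &
    forall Y, F Y -> X `<=` Y -> nbh (comp Y x) v].
  rewrite OE => -[nv [b [X [FX X1X] xb] bv]]; exists X; split=> // Y FY XY.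
  split; last by exists b => //; exact: comp_mono XY _ xb.
  by move=> yv; apply: nv; exists Y => //; split=> //; exact: subset_trans XY.
have [fO cO] : finite_set (nbh (comp O x)) /\ (ncard (nbh (comp O x)) <= m)%N.
  apply: ncard_le_finite => Z ZN.
  have [X [FX X1X XZ]] : exists X, [/\ F X, X1 `<=` X &
      forall Y, F Y -> X `<=` Y -> {in enum_fset Z, forall v, nbh (comp Y x) v}].
    apply: (@chain_capture _ _ (fun Y v => nbh (comp Y x) v)) => // v vZ.
    by apply: nbhO; apply: ZN.
  have [_ [s _ [[fX _] _ _]]] := Fg _ FX _ (X1X _ X1x).
  apply: leq_trans (ordX _ FX X1X); rewrite -(set_fsetK Z); apply: ncard_sub => //.
  by move=> v vZ; apply: (XZ X FX _ v vZ).
have rO : region (comp O x).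
  split=> // u Uu; split.
    rewrite OE => -[X [FX X1X] xu].
    by have [_ [s _ [[_ /(_ _ Uu)[]]]]] := Fg _ FX _ (X1X _ X1x).
  move=> /nbhO[X [FX X1X /(_ _ FX)]] => /(_ (fun=> id)) Nu.
  by have [_ [s _ [[_ /(_ _ Uu)[]]]]] := Fg _ FX _ (X1X _ X1x).
split; first exact: leq_trans cO le1.
exists r => //; split=> //.
  by rewrite OE; apply: tail_in_sub T1 => y xy; exists X1 => //; split.
by move=> B' rB' B'r; apply: leq_trans cO (h1 _ rB' B'r).
Qed.

Let good_mono k k' O : (k <= k')%N -> good k O -> good k' O.
Proof. by move=> kk' g x /g[h ?]; split=> //; exact: leq_trans kk'. Qed.

Let good_extend k P : good k P -> exists O, [/\ good k O, P `<=` O &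
  forall O', O `<` O' -> ~ good k O'].
Proof.
move=> gP; have [A [gA maxA]] : exists A, good k (P `|` A) /\
    forall B, A `<` B -> ~ good k (P `|` B).
  apply: (@Zorn_bigcup _ (fun A => good k (P `|` A))) => F FP tot.
  have [->|/set0P[X0 FX0]] := eqVneq F set0.
    by rewrite bigcup_set0 setU0.
  have -> : P `|` \bigcup_(X in F) X = \bigcup_(X in [set P `|` X | X in F]) X.
    apply/seteqP; split=> [x [Px|[X FX Xx]]|x [_ [X FX <-] [Px|Xx]]].
    - by exists (P `|` X0); [exists X0|left].
    - by exists (P `|` X); [exists X|right].
    - by left.
    - by right; exists X.
  apply: good_bigcup.
  - by exists (P `|` X0); exists X0.
  - by move=> _ [X FX <-]; exact: FP.
  - move=> _ _ [X FX <-] [Y FY <-].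
    by have [XY|YX] := tot _ _ FX FY; [left|right]; exact: setUS.
exists (P `|` A); split=> //.
move=> O' PO' gO'; apply: (maxA O').
  split=> [x Ax|O'A]; first by apply: PO'.1; right.
  by apply: PO'.2 => x /O'A; right.
suff -> : P `|` O' = O' by [].
by apply/setUidPr => x Px; apply: PO'.1; left.
Qed.

Let ladder : exists P : nat -> set (vertex G), forall k,
  [/\ good k (P k), P k `<=` P k.+1 & forall O', P k `<` O' -> ~ good k O'].
Proof.
have /choice[f fP] : forall kP : nat * set (vertex G), exists O, good kP.1 kP.2 ->
    [/\ good kP.1 O, kP.2 `<=` O & forall O', O `<` O' -> ~ good kP.1 O'].
  move=> [k P]; have [/good_extend[Q ?]|nG] := pselect (good k P); first by exists Q.
  by exists P.
pose P := fix P k := if k is k'.+1 then f (k, P k') else f (0%N, set0).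
have gP k : [/\ good k (P k), (if k is k'.+1 then P k' else set0) `<=` P k &
    forall O', P k `<` O' -> ~ good k O'].
  elim: k => [|k [gk _ _]]; first by apply: (fP (0%N, set0)) => x [].
  by apply: (fP (k.+1, P k)); apply: good_mono gk.
exists P => k; have [? _ ?] := gP k; split=> //; have [_ + _] := gP k.+1; exact.
Qed.

(** A maximal good set for the bound [k] holds tails of all rays with tight regions of order at most
    [k]. The union over all [k] then has to be cut into pieces with finite neighbourhoods. *)
Lemma stage_separator : exists W, [/\ U `<=` W,
  forall x, ~ W x -> region (comp (~` W) x) &
  forall r, Rs r -> tail_in (~` W) r].
Proof.
have [P PP] := ladder; pose O := \bigcup_k P k.
have Pmono i j : (i <= j)%N -> P i `<=` P j.
  move=> /subnK <-; elim: (j - i)%N => // k IH; rewrite addSn.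
  by apply: subset_trans IH _; have [] := PP (k + i)%N.
have Preg k x : P k x -> region (comp (P k) x).
  by move=> Px; have [/(_ _ Px)[_ [r _ []]]] := PP k.
have [EO|/set0P[d _]] := eqVneq O set0.
  exists setT; split=> // [x /(_ Logic.I)//|r Rr]; exfalso.
  have [A tA] := ex_tight Rr; have [gk _ mk] := PP (ord A).
  have [|x Px _] := good_cover gk mk Rr; first by exists A.
  by have : O x by [exists (ord A)]; rewrite EO.
(* [xget] sees only the set [comp O v], hence returns one root per component of [O]; [d] is its
   default value. *)
pose c v := xget d (comp O v).
have cP v : O v -> comp O v (c v).
  by move=> Ov; apply: (xgetPex d); exists v; exact: comp_id.
have cE v w : comp O v w -> c w = c v by move=> vw; rewrite /c (comp_eq vw).
have compO x y : comp O x y -> exists2 k, P k x & comp (P k) x y.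
  move=> xy; have [k _ Pkx] := comp_dom xy.
  suff : comp O x `<=` [set y | exists2 k, P k x & comp (P k) x y] by exact.
  apply: comp_ind; first by exists k => //; exact: comp_id.
  move=> a b _ [i Pix xa] [j _ Pjb] ab; exists (maxn i j).
    exact: Pmono (leq_maxl i j) _ Pix.
  apply: comp_step ab; last exact: Pmono (leq_maxr i j) _ Pjb.
  exact: comp_mono (Pmono _ _ (leq_maxl i j)) _ xa.
(* A component of [O] is the increasing union of the sets [comp (P k) (c v)], whose orders may be
   unbounded. Deleting the neighbourhoods of all of them slices it into shells. The [j]-th of these
   sets meets only the neighbourhoods of earlier ones, so [W] is finite on it. *)
pose W := [set v | ~ O v \/ exists k, P k (c v) /\ nbh (comp (P k) (c v)) v].
have WfinI j x : P j (c x) -> O x -> finite_set (W `&` comp (P j) (c x)).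
  move=> Pj Ox; apply: (@sub_finite_set _ _ (\bigcup_(i in `I_j)
    (if pselect (P i (c x)) then nbh (comp (P i) (c x)) else set0))).
    move=> v [Wv jv]; have Ov : O v by exists j => //; exact: comp_sub jv.
    case: Wv => // -[i [Pi Ni]].
    have cv : c v = c x.
      have : comp O (c x) v by apply: comp_mono jv => w; exists j.
      by rewrite (comp_eq (cP _ Ox)) => /cE.
    rewrite cv in Pi Ni; exists i; last by case: pselect.
    rewrite /= ltnNge; apply/negP => ji; case: Ni => + _; apply.
    exact: comp_mono (Pmono _ _ ji) _ jv.
  apply: bigcup_finite => // i _; case: pselect => // Pi.
  by have [] := Preg _ _ Pi.
exists W; split.
- move=> u Uu; left => -[k _ Pu].
  by have [_ /(_ _ Uu)[nu _]] := Preg _ _ Pu; apply: nu; exact: comp_id.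
- move=> x nWx; have Ox : O x by apply: contrapT => nO; apply: nWx; left.
  have [j Pj jx] : exists2 j, P j (c x) & comp (P j) (c x) x.
    by apply: compO; exact: connected_sym (cP _ Ox).
  set Z := comp (P j) (c x) in jx.
  have DZ : comp (~` W) x `<=` Z.
    apply: comp_ind => // a b xa Za nWb ab.
    have Ob : O b by apply: contrapT => nO; apply: nWb; left.
    apply: contrapT => nZb; apply: nWb.
    right; exists j; suff -> : c b = c x by split=> //; split=> //; exists a.
    have Oa : comp O x a by apply: comp_mono xa => w nWw; apply: contrapT => ?; apply: nWw; left.
    by apply: cE; exact: comp_step Oa Ob ab.
  have [fZ uZ] := Preg _ _ Pj.
  have ND v : nbh (comp (~` W) x) v -> nbh Z v \/ (W `&` Z) v.
    move=> /[dup] /nbh_comp /contrapT Wv [_ [b xb bv]].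
    by have [|] := nbh_sub_closed (DZ _ xb) bv; [right|left].
  split.
    apply: (@sub_finite_set _ _ (nbh Z `|` (W `&` Z))); first exact: ND.
    by rewrite finite_setU; split=> //; exact: WfinI.
  move=> u Uu; have [nZ nN] := uZ _ Uu; split; first by move=> /DZ.
  by move=> /ND[|[]].
- move=> r Rr; have [A tA] := ex_tight Rr; have [gk _ mk] := PP (ord A).
  have [|y Py Ay] := good_cover gk mk Rr; first by exists A.
  have Oy : O y by exists (ord A).
  have [j Pj jy] : exists2 j, P j (c y) & comp (P j) (c y) y.
    by apply: compO; exact: connected_sym (cP _ Oy).
  have [i Pi Zr] : exists2 i, P i (c y) & tail_in (comp (P i) (c y)) r.
    exists (maxn j (ord A)); first exact: Pmono (leq_maxl _ _) _ Pj.
    have yc : comp (P (maxn j (ord A))) (c y) y.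
      exact: comp_mono (Pmono _ _ (leq_maxl _ _)) _ jy.
    rewrite -(comp_eq yc); apply: tail_in_sub Ay.
    exact: comp_mono (Pmono _ _ (leq_maxr _ _)).
  have [n hn] := ray_avoid r (WfinI _ _ Pi Oy); have [m hm] := Zr.
  exists (maxn n m) => k; rewrite geq_max => /andP[nk mk'] Wr.
  by apply: (hn _ nk); split=> //; exact: hm.
Qed.

End Stage.

(** * Iterating the separation *)

Section Layering.
Context {G : graph}.
Implicit Types (O A B D Z W Y : set (vertex G)) (x y v : vertex G).

(* By [undominated_free], the rays of undominated ends are free. *)
Definition free_ray (r : ray G) :=
  forall U, finite_set U -> exists2 B, region U B & tail_in B r.

(** Nonempty neighbourhoods prevent a component from surviving in all layers, so that every vertex
    drops out eventually. *)
Definition layering (Y : nat -> set (vertex G)) := [/\ Y 0%N = setT,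
  (forall n, Y n.+1 `<=` Y n),
  (forall n x, Y n x -> finite_set (nbh (comp (Y n) x))),
  (forall n x, Y n.+1 x -> nbh (comp (Y n.+1) x) `<=` comp (Y n) x /\
     nbh (comp (Y n.+1) x) !=set0) &
  (forall n r, free_ray r -> tail_in (Y n) r)].

Lemma layer_step Y : (forall x, Y x -> finite_set (nbh (comp Y x))) ->
  exists Y', [/\ Y' `<=` Y, (forall x, Y' x -> finite_set (nbh (comp Y' x))),
    (forall x, Y' x -> nbh (comp Y' x) `<=` comp Y x /\ nbh (comp Y' x) !=set0) &
    (forall r, free_ray r -> tail_in Y r -> tail_in Y' r)].
Proof.
move=> fY; have /choice[W WP] : forall D, exists W, (finite_set (nbh D) /\ D !=set0) ->
    [/\ nbh D `<=` W, D `&` W !=set0,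
      (forall x, ~ W x -> finite_set (nbh (comp (~` W) x)) /\
         nbh (comp (~` W) x) `<=` ~` nbh D) &
      forall r, free_ray r -> tail_in (~` W) r].
  move=> D; have [[fD [d Dd]]|nD] := pselect (finite_set (nbh D) /\ D !=set0); last first.
    by exists set0.
  (* Putting [nbh D] into the set to be separated confines the new components to [D]; putting [d]
     there deletes a vertex of [D], so that each new component has a neighbour. *)
  have fU : finite_set (nbh D `|` [set d]) by rewrite finite_setU.
  have [W [UW regW rW]] := @stage_separator _ (nbh D `|` [set d]) free_ray
    (fun r fr => fr _ fU).
  exists W => _; split=> //.
  - by move=> v Nv; apply: UW; left.
  - by exists d; split=> //; apply: UW; right.
  - move=> x /regW[fx ux]; split=> // v Nv Dv.
    by have [|_] := ux v; first by left.
pose Y' := [set x | Y x /\ ~ W (comp Y x) x].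
have hyp x : Y x -> finite_set (nbh (comp Y x)) /\ comp Y x !=set0.
  by move=> Yx; split; [exact: fY|exists x; exact: comp_id].
have sub x : Y x -> comp (~` W (comp Y x)) x `<=` comp Y x.
  move=> Yx; have [NW _ _ _] := WP _ (hyp _ Yx).
  apply: comp_ind; first exact: comp_id.
  by move=> a b _ Da nWb ab; have [|/NW] := nbh_sub_closed Da ab.
have compE x : Y' x -> comp Y' x = comp (~` W (comp Y x)) x.
  move=> [Yx nWx]; apply/seteqP; split.
    apply: comp_ind; first exact: comp_id.
    move=> a b _ Da [Yb nWb] ab; have Db := comp_step (sub _ Yx _ Da) Yb ab.
    by apply: comp_step Da _ ab; rewrite /setC /= -(comp_eq Db).
  apply: comp_subcomp; last exact: comp_id.
  move=> a Da; have ya := sub _ Yx _ Da; split; first exact: comp_sub ya.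
  by rewrite (comp_eq ya); exact: comp_sub Da.
exists Y'; split.
- by move=> x [].
- move=> x Yx; rewrite compE //; case: Yx => Yx nWx.
  by have [_ _ /(_ _ nWx)[]] := WP _ (hyp _ Yx).
- move=> x Yx; rewrite compE //; case: Yx => Yx nWx.
  have [_ [d [Dd Wd]] /(_ _ nWx)[_ dis] _] := WP _ (hyp _ Yx); split.
    move=> v /[dup] Nv [_ [b Db bv]].
    by have [//|/(dis _ Nv)] := nbh_sub_closed (sub _ Yx _ Db) bv.
  apply: contrapT => N0; suff : comp (~` W (comp Y x)) x d by move=> /comp_sub.
  suff : comp Y x `<=` comp (~` W (comp Y x)) x by exact.
  apply: comp_ind; first exact: comp_id.
  move=> a b _ Da _ ab; have [//|Nb] := nbh_sub_closed Da ab.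
  by case: N0; exists b.
- move=> r fr /tail_in_comp[n [Yn hn]]; have [_ _ _ /(_ _ fr)[m hm]] := WP _ (hyp _ Yn).
  exists (maxn n m) => k; rewrite geq_max => /andP[/hn nk /hm mk].
  by split; [exact: comp_sub nk|rewrite (comp_eq nk)].
Qed.

Lemma exists_layering : exists Y : nat -> set (vertex G), layering Y.
Proof.
pose okY Y := (forall x, Y x -> finite_set (nbh (comp Y x))).
have /choice[f fP] : forall Y, exists Y', okY Y -> [/\ Y' `<=` Y, okY Y',
    (forall x, Y' x -> nbh (comp Y' x) `<=` comp Y x /\ nbh (comp Y' x) !=set0) &
    (forall r, free_ray r -> tail_in Y r -> tail_in Y' r)].
  move=> Y; have [/layer_step[Y' ?]|nY] := pselect (okY Y); first by exists Y'.
  by exists Y.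
pose Y n := iter n f setT.
have ok n : okY (Y n).
  elim: n => [|n /fP[]//] x _.
  suff -> : nbh (comp (Y 0%N) x) = set0 by [].
  by apply/seteqP; split=> // v /nbh_comp /(_ Logic.I).
exists Y; split=> //.
- by move=> n; have [] := fP _ (ok n).
- by move=> n x; have [_ _ + _] := fP _ (ok n); exact.
- move=> n r fr; elim: n => [|n IH]; first by exists 0%N.
  by have [_ _ _] := fP _ (ok n); apply.
Qed.

End Layering.

(** * Decided sets and the closure operator *)

HB.instance Definition _ (G : graph) := gen_eqMixin (edge G).
HB.instance Definition _ (G : graph) := gen_choiceMixin (edge G).

Section Decided.
Context {G : graph}.
Variable Y : nat -> set (vertex G).
Hypothesis YP : layering Y.
Implicit Types (A B D N Z : set (vertex G)) (x y u v : vertex G) (z : nat -> vertex G)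
  (P Q F I X C : set (edge G)) (e f g : edge G).

Local Notation node n x := (comp (Y n) x).

Let YS n : Y n.+1 `<=` Y n. Proof. by case: YP. Qed.

Lemma node_finite n x : Y n x -> finite_set (nbh (node n x)).
Proof. by case: YP => _ _ + _ _; exact. Qed.

Lemma nbh_node n x : Y n.+1 x -> nbh (node n.+1 x) `<=` node n x.
Proof. by case: YP => _ _ _ h _ /h[]. Qed.

Lemma nbh_node0 n x : Y n.+1 x -> nbh (node n.+1 x) !=set0.
Proof. by case: YP => _ _ _ h _ /h[]. Qed.

Lemma layer_mono n m : (n <= m)%N -> Y m `<=` Y n.
Proof.
move=> /subnK <-; elim: (m - n)%N => // k IH; rewrite addSn.
exact: subset_trans (@YS _) IH.
Qed.

Lemma node_mono n m x : (n <= m)%N -> node m x `<=` node n x.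
Proof. by move=> /layer_mono; exact: comp_mono. Qed.

Lemma node_nbr n x a b : node n.+1 x a -> adjacent a b -> node n x b.
Proof.
move=> xa ab; have Yx := comp_dom xa.
by have [|/(nbh_node Yx)//] := nbh_sub_closed xa ab; exact: node_mono.
Qed.

(** Lying in all layers would spread from [x] to its neighbours by [node_nbr], hence over its whole
    node of level 0; but this node contains a neighbour of the node of [x] of level 1. *)
Lemma layer_cap x : exists n, ~ Y n x.
Proof.
apply: contrapT => /forallNP h; have Yx n : Y n x by apply: contrapT.
have [y Ny] := nbh_node0 (Yx 1%N); have := nbh_node (Yx 1%N) Ny.
suff sub : node 0 x `<=` [set z | forall m, node m x z].
  by move=> /sub /(_ 1%N); case: Ny.
apply: comp_ind => [m|a b _ ha _ ab m]; first exact: comp_id.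
exact: node_nbr (ha m.+1) ab.
Qed.

Lemma layer_fin (S : set (vertex G)) : finite_set S -> exists n, S `<=` ~` Y n.
Proof.
move=> fS; apply: (finite_uniform (Q := fun n x => ~ Y n x)) => //.
- by move=> n m x nm nY /(layer_mono nm).
- by move=> x _; exact: layer_cap.
Qed.

Definition branch (x : nat -> vertex G) :=
  forall n, Y n (x n) /\ node n (x n) (x n.+1).

Lemma branch_node z n m : branch z -> (n <= m)%N -> node n (z n) (z m).
Proof.
move=> bx /subnK <-; elim: (m - n)%N => [|k IH]; first exact: comp_id (bx n).1.
rewrite addSn; rewrite -(comp_eq IH).
exact: node_mono (leq_addl _ _) _ (bx (k + n)%N).2.
Qed.

Lemma branch_sub z n m : branch z -> (n <= m)%N -> node m (z m) `<=` node n (z n).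
Proof.
move=> bx nm; rewrite -(comp_eq (branch_node bx nm)); exact: node_mono.
Qed.

Lemma ex_branch (Q : nat -> vertex G -> Prop) n0 x0 :
  (forall n x, Q n x -> Y n x) -> Q n0 x0 ->
  (forall n x, Q n x -> exists2 y, Q n.+1 y & node n x y) ->
  exists2 z, branch z & forall n, (n0 <= n)%N -> Q n (z n).
Proof.
move=> QY Q0 step.
have /choice[f fP] : forall nx : nat * vertex G, exists y, Q nx.1 nx.2 ->
    Q nx.1.+1 y /\ node nx.1 nx.2 y.
  move=> [n x]; have [/step[y ? ?]|nQ] := pselect (Q n x); first by exists y.
  by exists x.
pose g := fix g k := if k is k'.+1 then f ((n0 + k')%N, g k') else x0.
have Qg k : Q (n0 + k)%N (g k).
  elim: k => [|k IH]; first by rewrite addn0.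
  by rewrite addnS; have [] := fP (_, _) IH.
(* Truncated subtraction keeps the branch at [x0] up to level [n0]. *)
exists (fun n => g (n - n0)%N) => [n|n n0n]; last by rewrite -{1}(subnKC n0n).
have [n0n|nn0] := leqP n0 n.
  rewrite subSn //; have := Qg (n - n0)%N; rewrite subnKC // => Qn.
  by split; [exact: QY|have [] := fP (_, _) Qn; rewrite /= subnKC].
rewrite (eqP (ltnW nn0 : (n - n0 == 0)%N)) (eqP (nn0 : (n.+1 - n0 == 0)%N)) /=.
have Yn : Y n x0 by apply: layer_mono (ltnW nn0) _ _; exact: QY.
by split=> //; exact: comp_id.
Qed.

Definition dec A := forall z, branch z ->
  exists n, node n (z n) `<=` A \/ node n (z n) `<=` ~` A.

Lemma dec_node n x : Y n x -> dec (node n x).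
Proof.
move=> Yx z bz; exists n; have [xz|nxz] := pselect (node n x (z n)).
  by left; rewrite (comp_eq xz).
right=> v zv xv; apply: nxz; rewrite -(comp_eq xv); exact: connected_sym.
Qed.

Lemma dec_fin A : finite_set A -> dec A.
Proof.
move=> /layer_fin[n h] z bz; exists n; right=> v /comp_sub Yv Av; exact: h Av Yv.
Qed.

Lemma decC A : dec A -> dec (~` A).
Proof.
by move=> dA z /dA[n [h|h]]; exists n; [right; rewrite setCK|left].
Qed.

Lemma decI A B : dec A -> dec B -> dec (A `&` B).
Proof.
move=> dA dB z bz; have [n hn] := dA _ bz; have [m hm] := dB _ bz.
exists (maxn n m); have sn := branch_sub bz (leq_maxl n m).
have sm := branch_sub bz (leq_maxr n m).
case: hn hm => [An|An] [Bm|Bm].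
- by left=> v zv; split; [apply: An; exact: sn|apply: Bm; exact: sm].
- by right=> v zv [_]; apply: Bm; exact: sm.
- by right=> v zv [+ _]; apply: An; exact: sn.
- by right=> v zv [_]; apply: Bm; exact: sm.
Qed.

Lemma decU A B : dec A -> dec B -> dec (A `|` B).
Proof.
by move=> dA dB; rewrite -(setCK (A `|` B)) setCU; apply: decC; apply: decI; exact: decC.
Qed.

Definition symd A B : set (vertex G) := [set v | ~ (A v <-> B v)].

Lemma dec_symd A B : dec A -> dec B -> dec (symd A B).
Proof.
move=> dA dB.
have -> : symd A B = (A `&` ~` B) `|` (~` A `&` B).
  apply/seteqP; split=> v; rewrite /symd /setU /setI /setC /=; last by tauto.
  by have [] := pselect (A v); have [] := pselect (B v); tauto.
by apply: decU; apply: decI => //; exact: decC.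
Qed.

Definition sep A e := ~ (A (src e) <-> A (tgt e)).
Definition resp A P := forall e, P e -> ~ sep A e.

Lemma respP A P e : resp A P -> P e -> A (src e) <-> A (tgt e).
Proof. by move=> h /h /contrapT. Qed.

Lemma sepC A e : sep (~` A) e <-> sep A e.
Proof. by rewrite /sep /setC /=; have [] := pselect (A (src e)); have [] := pselect (A (tgt e)); tauto. Qed.

Lemma sep_symd A B e : sep (symd A B) e <-> ~ (sep A e <-> sep B e).
Proof.
rewrite /sep /symd /=; have [] := pselect (A (src e)); have [] := pselect (A (tgt e));
have [] := pselect (B (src e)); have [] := pselect (B (tgt e)); tauto.
Qed.

(** Topological connection through the edges of [P], expressed by the absence of a separation
    instead of the presence of an arc. *)
Definition conn P u v := forall A, dec A -> resp A P -> A u <-> A v.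
Definition cl P : set (edge G) := [set e | conn P (src e) (tgt e)].

Lemma clP P e : cl P e <-> forall A, dec A -> resp A P -> ~ sep A e.
Proof.
split=> [h A dA rA|h A dA rA]; first by move=> /(_ (h A dA rA)).
exact: contrapT (h A dA rA).
Qed.

Lemma not_clP P e : ~ cl P e -> exists A, [/\ dec A, resp A P & sep A e].
Proof.
rewrite clP => /existsNP[A /not_implyP[dA /not_implyP[rA /contrapT sA]]].
by exists A.
Qed.

Lemma resp_sub A P Q : P `<=` Q -> resp A Q -> resp A P.
Proof. by move=> PQ rA e /PQ /rA. Qed.

Lemma conn_mono P Q u v : P `<=` Q -> conn P u v -> conn Q u v.
Proof. by move=> PQ h A dA /(resp_sub PQ); exact: h. Qed.

Lemma cl_mono P Q : P `<=` Q -> cl P `<=` cl Q.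
Proof. by move=> PQ e; exact: conn_mono. Qed.

Lemma cl_id P : P `<=` cl P.
Proof. by move=> e Pe A dA rA; exact: respP Pe. Qed.

Lemma conn_cl P Q u v : P `<=` cl Q -> conn P u v -> conn Q u v.
Proof. by move=> PQ h A dA rA; apply: h => // e Pe; exact: (clP Q e).1 (PQ _ Pe) A dA rA. Qed.

Lemma cl_cl P Q : P `<=` cl Q -> cl P `<=` cl Q.
Proof. by move=> PQ e; exact: conn_cl. Qed.

Lemma conn_sym P u v : conn P u v -> conn P v u.
Proof. by move=> h A dA /(h A dA)[]. Qed.

Lemma conn_trans P v u w : conn P u v -> conn P v w -> conn P u w.
Proof. by move=> h1 h2 A dA rA; rewrite (h1 A dA rA); exact: h2. Qed.

Lemma conn0 u v : conn set0 u v -> u = v.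
Proof. by move=> /(_ [set u] (dec_fin (finite_set1 u)))[// e []|+ _] => /(_ erefl) /= ->. Qed.

(** A set witnessing that [e] is not spanned by [P] must separate [f]. So does a set refuting the
    conclusion; in their symmetric difference [f] cancels and [e] remains separated. *)
Lemma exchange P e f : cl (f |` P) e -> ~ cl P e -> cl (e |` P) f.
Proof.
move=> /clP h /not_clP[A [dA rA sA]]; apply/clP => B dB rB sB.
have sAf : sep A f by apply: contrapT => nAf; apply: (h A dA) => // g [->//|]; exact: rA.
apply: (h (symd A B)); first exact: dec_symd.
  move=> g [->|Pg]; rewrite sep_symd; first by tauto.
  by have := rA _ Pg; have : ~ sep B g by [apply: rB; right]; tauto.
rewrite sep_symd; have : ~ sep B e by [apply: rB; left]; tauto.
Qed.

Definition indp I := forall e, I e -> ~ cl (I `\ e) e.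

Lemma indp_sub I J : indp J -> I `<=` J -> indp I.
Proof.
by move=> iJ IJ e Ie h; apply: (iJ _ (IJ _ Ie)); apply: cl_mono h => f [/IJ ? ?].
Qed.

Lemma indp_add I e : indp I -> ~ cl I e -> indp (e |` I).
Proof.
move=> iI ne f [->|If] h.
  by apply: ne; apply: cl_mono h => g [[->|//] /(_ erefl)].
have [ef|ef] := pselect (f = e).
  by apply: ne; apply: cl_id; rewrite -ef.
apply: ne; apply: (@cl_mono (f |` (I `\ f))); first by move=> g [->|[]].
apply: exchange (iI _ If); apply: cl_mono h => g [[->|Ig] gf]; first by left.
by right.
Qed.

Lemma indp_aug I J : indp I -> indp J -> (exists2 e, ~ I e & indp (e |` I)) ->
  (forall e, indp (e |` J) -> J e) ->
  exists e, [/\ J e, ~ I e & indp (e |` I)].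
Proof.
move=> iI iJ [e nIe iIe] maxJ; apply: contrapT => h.
have JI : J `<=` cl I.
  move=> f Jf; apply: contrapT => nf; apply: h; exists f; split=> //.
    by move=> If; apply: nf; exact: cl_id.
  exact: indp_add.
have Jall f : cl J f.
  apply: contrapT => nf; apply: (nf); apply: cl_id; apply: maxJ; exact: indp_add.
apply: (iIe e); first by left.
apply: (@cl_mono I); first by move=> f If; split; [right|move=> fe; apply: nIe; rewrite -fe].
exact: cl_cl JI _ (Jall e).
Qed.

(** Each such [t] in [F] is the only edge of [F] separated by a suitable decided set; symmetric
    difference with that set switches [t] alone. *)
Lemma clean F (ts : seq (edge G)) A : dec A ->
  (forall t, t \in ts -> F t -> ~ cl (F `\ t) t) ->
  exists2 A', dec A' & forall e, F e -> (sep A' e <-> sep A e /\ e \notin ts).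
Proof.
move=> dA; elim: ts => [|t ts IH] h; first by exists A => // e _; split=> [|[]].
have [|A' dA' hA'] := IH; first by move=> s sts; apply: h; rewrite inE sts orbT.
have [[Ft At]|nt] := pselect (F t /\ sep A' t); last first.
  exists A' => // e Fe; rewrite (hA' _ Fe) inE negb_or.
  split=> [[sA ets]|[sA /andP[_ ets]]]; split=> //; apply/andP; split=> //.
  by apply/eqP => et; apply: nt; rewrite -et; split=> //; apply/(hA' _ Fe).
have [|B [dB rB sB]] := not_clP (h t _ Ft); first by rewrite inE eqxx.
exists (symd A' B); first exact: dec_symd.
move=> e Fe; rewrite sep_symd inE negb_or; have [->|et] := eqVneq e t.
  by rewrite /=; split=> [|[//]]; tauto.
have : ~ sep B e by apply: rB; split=> //; exact/eqP.
by move=> nB /=; rewrite -(hA' _ Fe); have [] := pselect (sep A' e); tauto.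
Qed.

(* Only finitely many traces on a finite set are involved, hence the Boolean   *)
(* combinations of decided sets suffice.                                       *)
Lemma trace_dec N P B : finite_set N ->
  (forall s t, N s -> N t -> conn P s t -> (B s <-> B t)) ->
  exists A, [/\ dec A, resp A P & forall s, N s -> (A s <-> B s)].
Proof.
move=> /finite_seqP[X NX] h.
have one s (Z : seq (vertex G)) : {subset Z <= X} -> N s -> B s ->
    exists A, [/\ dec A, resp A P, A s & forall t, t \in Z -> ~ B t -> ~ A t].
  move=> ZX Ns Bs; elim: Z ZX => [|t Z IH] ZX.
    exists setT; split=> //; first by move=> z bz; exists 0%N; left.
    by move=> e _ [].
  have [|A [dA rA As hA]] := IH; first by move=> w wZ; apply: ZX; rewrite inE wZ orbT.
  have [Bt|nBt] := pselect (B t).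
    by exists A; split=> // w; rewrite inE => /orP[/eqP -> //|/hA].
  have Nt : N t by rewrite NX; apply: ZX; rewrite inE eqxx.
  have : ~ conn P s t by move=> /(h _ _ Ns Nt) [/(_ Bs)].
  move=> /existsNP[A' /not_implyP[dA' /not_implyP[rA' nA']]].
  wlog A's : A' dA' rA' nA' / A' s.
    move=> wl; have [A's|nA's] := pselect (A' s); first exact: (wl A').
    apply: (wl (~` A')) => //; first exact: decC.
      by move=> e /rA'; rewrite sepC.
    by rewrite /setC /=; have [] := pselect (A' s); have [] := pselect (A' t); tauto.
  exists (A `&` A'); split=> //; first exact: decI.
    move=> e Pe; have := rA _ Pe; have := rA' _ Pe; rewrite /sep /setI /=; tauto.
  by move=> w; rewrite inE => /orP[/eqP -> _ [_ A't]|wZ nBw [/(hA _ wZ nBw)//]]; tauto.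
suff [A [dA rA hA hA']] : exists A, [/\ dec A, resp A P,
    forall s, s \in X -> B s -> A s & forall t, t \in X -> ~ B t -> ~ A t].
  exists A; split=> // s; rewrite NX => sX; split; last exact: hA.
  by move=> As; apply: contrapT => nB; apply: hA' As.
suff gen (Z : seq (vertex G)) : {subset Z <= X} -> exists A, [/\ dec A, resp A P,
    forall s, s \in Z -> B s -> A s & forall t, t \in X -> ~ B t -> ~ A t].
  by have [//|A ?] := gen X; exists A.
elim: Z => [|s Z IH] ZX.
  exists set0; split=> [||w //|w _ _ []]; first exact: dec_fin.
  by move=> e _ []; split.
have [|A [dA rA hA hA']] := IH; first by move=> w wZ; apply: ZX; rewrite inE wZ orbT.
have [Bs|nBs] := pselect (B s); last first.
  by exists A; split=> // w; rewrite inE => /orP[/eqP -> //|/hA].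
have [|A' [dA' rA' A's hA'']] := one s X (fun _ => id) _ Bs.
  by rewrite NX; apply: ZX; rewrite inE eqxx.
exists (A `|` A'); split=> //; first exact: decU.
- move=> e Pe; have := rA _ Pe; have := rA' _ Pe; rewrite /sep /setU /=; tauto.
- by move=> w; rewrite inE => /orP[/eqP -> _|wZ Bw]; [right|left; exact: hA].
- by move=> w wX nB [/(hA' _ wX nB)|/(hA'' _ wX nB)].
Qed.

(** * Locality of connections, thin edge sets and compact supports *)

Definition at_ P D : set (edge G) := [set e | P e /\ (D (src e) \/ D (tgt e))].

Lemma adjacent_edge e : adjacent (src e) (tgt e).
Proof. by exists e; left. Qed.

(** [B] itself may be undecided. Inside each component of [Y'] it is replaced by a decided set with
    the same trace on the finite neighbourhood; the result is decided because every branch ends up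
    in one component. *)
Lemma conn_local (Y' : set (vertex G)) P B u v :
  (forall x, Y' x -> finite_set (nbh (comp Y' x))) ->
  (forall z, branch z -> exists n, node n (z n) `<=` Y') ->
  (forall e, P e -> ~ Y' (src e) -> ~ Y' (tgt e) -> (B (src e) <-> B (tgt e))) ->
  (forall x s t, Y' x -> nbh (comp Y' x) s -> nbh (comp Y' x) t ->
     conn (at_ P (comp Y' x)) s t -> (B s <-> B t)) ->
  conn P u v -> ~ Y' u -> ~ Y' v -> (B u <-> B v).
Proof.
move=> fY' bY' BP BN uv nu nv.
have /choice[AD ADP] : forall D, exists A, (exists2 x, Y' x & D = comp Y' x) ->
    [/\ dec A, resp A (at_ P D) & forall s, nbh D s -> (A s <-> B s)].
  move=> D; have [[x Yx ->]|nD] := pselect (exists2 x, Y' x & D = comp Y' x); last first.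
    by exists set0.
  have [|A ?] := trace_dec (P := at_ P (comp Y' x)) (B := B) (fY' _ Yx); last by exists A.
  by move=> s t; exact: BN.
pose A := [set w | (Y' w /\ AD (comp Y' w) w) \/ (~ Y' w /\ B w)].
have AY w : Y' w -> (A w <-> AD (comp Y' w) w) by rewrite /A /=; tauto.
have AnY w : ~ Y' w -> (A w <-> B w) by rewrite /A /=; tauto.
have AE x w : Y' x -> comp Y' x w \/ nbh (comp Y' x) w ->
    (A w <-> AD (comp Y' x) w).
  move=> Yx [xw|Nw].
    by rewrite AY ?(comp_eq xw) //; exact: comp_sub xw.
  have [_ _ ->//] := ADP (comp Y' x) (ex_intro2 _ _ x Yx erefl).
  by rewrite AnY //; exact: nbh_comp Nw.
have dA : dec A.
  move=> z bz; have [n hn] := bY' _ bz.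
  have Yz : Y' (z n) by apply: hn; exact: comp_id (bz n).1.
  have [dD _ _] := ADP _ (ex_intro2 _ _ (z n) Yz erefl).
  have [m hm] := dD _ bz; exists (maxn n m).
  have sn w : node (maxn n m) (z (maxn n m)) w -> comp Y' (z n) w.
    move=> /(branch_sub bz (leq_maxl n m)); apply: comp_subcomp => //.
    exact: comp_id (bz n).1.
  have sm := branch_sub bz (leq_maxr n m).
  case: hm => hm; [left|right] => w zw.
    by apply/(AE (z n)) => //; [left; exact: sn|apply: hm; exact: sm].
  move=> /(AE (z n)) => /(_ Yz (or_introl (sn _ zw))).
  by apply: hm; exact: sm.
have edge_in x e : P e -> Y' x -> comp Y' x (src e) \/ comp Y' x (tgt e) -> ~ sep A e.
  move=> Pe Yx xe; have [_ rD _] := ADP _ (ex_intro2 _ _ x Yx erefl).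
  have := rD e (conj Pe xe); rewrite /sep.
  have ab := adjacent_edge e; have ba := adjacentC ab.
  have -> : A (src e) <-> AD (comp Y' x) (src e).
    by apply: AE => //; case: xe => xe; [left|exact: nbh_sub_closed ba].
  have -> // : A (tgt e) <-> AD (comp Y' x) (tgt e).
  by apply: AE => //; case: xe => xe; [exact: nbh_sub_closed ab|left].
have rA : resp A P.
  move=> e Pe; have [Ys|nYs] := pselect (Y' (src e)).
    by apply: (edge_in (src e)) => //; left; exact: comp_id.
  have [Yt|nYt] := pselect (Y' (tgt e)).
    by apply: (edge_in (tgt e)) => //; right; exact: comp_id.
  by rewrite /sep !AnY //; have := BP _ Pe nYs nYt; tauto.
by rewrite -!AnY //; exact: uv.
Qed.

Definition touch D e := D (src e) \/ D (tgt e).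

Lemma touch_same n x y e : touch (node n x) e -> touch (node n y) e ->
  node n x = node n y.
Proof.
have step u v : node n x u -> node n y v -> adjacent u v -> node n x = node n y.
  move=> xu yv uv; have xv := comp_step xu (comp_sub yv) uv.
  by rewrite -(comp_eq xv) (comp_eq yv).
have ab := adjacent_edge e; have ba := adjacentC ab.
case=> xe [] ye.
- by rewrite -(comp_eq xe) (comp_eq ye).
- exact: step xe ye ab.
- exact: step xe ye ba.
- by rewrite -(comp_eq xe) (comp_eq ye).
Qed.

Lemma touch_inside n x e : touch (node n.+1 x) e -> node n x (src e) /\ node n x (tgt e).
Proof.
have ab := adjacent_edge e; have ba := adjacentC ab.
move=> [] xe; split; by [exact: node_nbr ab|exact: node_nbr ba|exact: node_mono xe].
Qed.

Lemma touch_sub D D' e : D `<=` D' -> touch D e -> touch D' e.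
Proof. by move=> DD' [/DD' ?|/DD' ?]; [left|right]. Qed.

(** A substitute for compactness at level [n]: up to finitely many edges, [P] visits only finitely
    many nodes. *)
Definition thin_at n P := exists (es : set (edge G)) (S : set (vertex G)),
  [/\ finite_set es, finite_set S, S `<=` Y n &
    forall f, P f -> es f \/ exists2 x, S x & touch (node n x) f].

Lemma thin_at_mono n m P Q : (n <= m)%N -> Q `<=` P -> thin_at m P -> thin_at n Q.
Proof.
move=> nm QP [es [S [fes fS SY h]]]; exists es, S; split=> //.
  exact: subset_trans SY (layer_mono nm).
move=> f /QP /h[|[x Sx xf]]; [by left|right; exists x => //].
apply: touch_sub xf; exact: node_mono.
Qed.

Lemma thin_atU n P Q : thin_at n P -> thin_at n Q -> thin_at n (P `|` Q).
Proof.
move=> [es [S [fes fS SY h]]] [es' [S' [fes' fS' SY' h']]].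
exists (es `|` es'), (S `|` S'); split; rewrite ?finite_setU ?subUset //.
move=> f [/h|/h'] [ef|[x Sx xf]].
- by left; left.
- by right; exists x => //; left.
- by left; right.
- by right; exists x => //; right.
Qed.

Lemma thin_at1 n e : thin_at n [set e].
Proof. by exists [set e], set0; split=> // f ->; left. Qed.

Lemma thin_at0 n : thin_at n set0.
Proof. by exists set0, set0; split. Qed.

Lemma thin_at_node n P x : Y n x -> thin_at n (at_ P (node n x)).
Proof.
move=> Yx; exists set0, [set x]; split=> //; first by move=> _ ->.
by move=> f [_ xf]; right; exists x.
Qed.

(** If each [T x] met some [R n] only finitely, one index would serve all of the finite set [S], and
    a late [R n] would be finite. *)
Lemma infinite_pigeon (R : nat -> set (edge G)) (T : vertex G -> set (edge G))
    (es : set (edge G)) (S : set (vertex G)) n0 :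
  (forall n m, (n <= m)%N -> R m `<=` R n) -> (forall n, infinite_set (R n)) ->
  finite_set es -> finite_set S ->
  (forall f, R n0 f -> es f \/ exists2 x, S x & T x f) ->
  exists2 x, S x & forall n, infinite_set (R n `&` T x).
Proof.
move=> Rm Ri fes fS h; apply: contrapT => /forall2NP nS.
have [n hn] : exists n, forall x, S x -> finite_set (R n `&` T x).
  apply: finite_uniform => //.
    by move=> n m x nm; apply: sub_finite_set; apply: setSI; exact: Rm.
  by move=> x Sx; have [//|/existsNP[n /contrapT]] := nS x; exists n.
apply: (Ri (maxn n n0)); apply: (@sub_finite_set _ _
    (es `|` \bigcup_(x in S) (R n `&` T x))).
  move=> f Rf; have [|[x Sx xf]] := h f (Rm _ _ (leq_maxr n n0) _ Rf); first by left.
  by right; exists x => //; split=> //; exact: Rm (leq_maxl n n0) _ Rf.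
by rewrite finite_setU; split=> //; exact: bigcup_finite.
Qed.

Lemma infinite_ex (T : Type) (S : set T) : infinite_set S -> exists a : T, S a.
Proof.
move=> iS; apply: contrapT => /forallNP nS; apply: iS.
by rewrite (_ : S = set0) //; apply/seteqP; split=> // x /nS.
Qed.

(* König's lemma: otherwise some branch has infinitely many separated edges at *)
(* each of its nodes, contradicting that the branch is decided.                *)
Lemma finite_cross (P : nat -> set (edge G)) A :
  (forall n m, (n <= m)%N -> P m `<=` P n) -> (forall n, thin_at n (P n)) -> dec A ->
  exists n, finite_set (P n `&` sep A).
Proof.
move=> Pm thP dA; apply: contrapT => /forallNP Pi.
pose heavy m x := Y m x /\ forall n, infinite_set ((P n `&` sep A) `&` touch (node m x)).
have [x hx] : exists x, heavy 0%N x.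
  have [es [S [fes fS SY h]]] := thP 0%N.
  have [||x Sx hx] := @infinite_pigeon (fun n => P n `&` sep A)
      (fun x => touch (node 0%N x)) es S 0%N _ Pi fes fS.
  - by move=> n m nm; apply: setSI; exact: Pm.
  - by move=> f [/h].
  - by exists x; split=> //; exact: SY.
have [||z bz hz] := ex_branch (Q := heavy) _ hx; first by move=> n y [].
  move=> m y [Yy hy]; have [es [S [fes fS SY h]]] := thP m.+1.
  have [||w Sw hw] := @infinite_pigeon (fun n => (P n `&` sep A) `&` touch (node m y))
      (fun x => touch (node m.+1 x)) es S m.+1 _ hy fes fS.
  - by move=> n k nk; apply: setSI; apply: setSI; exact: Pm.
  - by move=> f [[/h]].
  have Yw := SY _ Sw; exists w.
    split=> // n; apply: contra_not (hw n); apply: sub_finite_set.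
    by apply: setSI => f [].
  have [f [[_ yf] wf]] := infinite_ex (hw 0%N).
  rewrite (touch_same yf (touch_sub (node_mono (leqnSn m)) wf)).
  exact: comp_id (YS Yw).
have [n hn] := dA _ bz; have [_ /(_ 0%N)/infinite_ex[f [[_ sf] zf]]] := hz n.+1 isT.
have [zs zt] := touch_inside zf; apply: sf.
have sub := branch_sub bz (leqnn n); move: zs zt.
rewrite (comp_eq (branch_node bz (leqnSn n))) => zs zt.
by case: hn => hn; split=> h; [exact: hn|exact: hn|case: (hn _ zs)|case: (hn _ zt)].
Qed.

Lemma thin_stage n P u v : conn P u v -> ~ Y n u -> ~ Y n v ->
  exists P', [/\ P' `<=` P, conn P' u v & thin_at n P'].
Proof.
move=> uv nu nv.
(* The vertices reached from [u] by a thin part of [P]. Crossing an edge outside [Y n] costs that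
   edge, and passing through a node costs the edges at this node; both are thin, so [conn_local]
   applies to [B]. *)
pose B := [set w | exists P', [/\ P' `<=` P, conn P' u w & thin_at n P']].
have ext P1 s t : P1 `<=` P -> thin_at n P1 -> conn P1 s t -> B s -> B t.
  move=> P1P th1 st [P' [P'P us th']]; exists (P' `|` P1); split.
  - by rewrite subUset.
  - apply: (@conn_trans _ s); first by apply: conn_mono us; left.
    by apply: conn_mono st; right.
  - exact: thin_atU.
suff [+ _] : B u <-> B v by apply; exists set0; split=> //; exact: thin_at0.
apply: (conn_local (Y' := Y n) (P := P)) => //.
- exact: node_finite.
- by move=> z bz; exists n; exact: comp_sub.
- move=> e Pe _ _; have c1 : conn [set e] (src e) (tgt e) by exact: (@cl_id [set e]).
  have sP : [set e] `<=` P by move=> _ ->.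
  split; apply: (ext [set e]) => //; try exact: thin_at1; exact: conn_sym.
- move=> x s t Yx _ _ st; have sP : at_ P (node n x) `<=` P by move=> ? [].
  split; apply: ext sP (thin_at_node _ Yx) _ => //; exact: conn_sym.
Qed.

(** Thin stages at ever higher levels form a decreasing sequence. A set respecting the intersection
    separates only finitely many edges of some stage, by [finite_cross]; all of these are gone at a
    later stage, which still spans [e]. *)
Lemma compact_support P e : cl P e ->
  exists P', [/\ P' `<=` P, cl P' e & forall n, thin_at n P'].
Proof.
move=> Pe; have [n0 nY] : exists n, [set src e; tgt e] `<=` ~` Y n.
  by apply: layer_fin; rewrite finite_setU; split; exact: finite_set1.
have nYk k u : (n0 <= k)%N -> [set src e; tgt e] u -> ~ Y k u.
  by move=> nk /nY h /(layer_mono nk).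
have /choice[f fP] : forall kP : nat * set (edge G), exists P', cl kP.2 e ->
    [/\ P' `<=` kP.2, cl P' e & thin_at (n0 + kP.1)%N P'].
  move=> [k Q]; have [Qe|nQ] := pselect (cl Q e); last by exists Q.
  have [||P' ?] := @thin_stage (n0 + k)%N _ _ _ Qe; last by exists P'.
    by apply: nYk (leq_addr _ _) _; left.
  by apply: nYk (leq_addr _ _) _; right.
pose Q := fix Q k := if k is k'.+1 then f (k, Q k') else f (0%N, P).
have QP k : [/\ Q k `<=` (if k is k'.+1 then Q k' else P), cl (Q k) e &
    thin_at (n0 + k)%N (Q k)].
  elim: k => [|k [_ Qk _]]; first exact: (fP (0%N, P)).
  exact: (fP (k.+1, Q k)).
have Qm n m : (n <= m)%N -> Q m `<=` Q n.
  move=> /subnK <-; elim: (m - n)%N => // k IH; rewrite addSn.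
  by apply: subset_trans IH; have [] := QP (k + n).+1.
have thQ n : thin_at n (Q n).
  by have [_ _] := QP n; apply: thin_at_mono (leq_addl _ _) _.
exists (\bigcap_n Q n); split.
- by move=> g /(_ 0%N Logic.I); have [+ _ _] := QP 0%N; exact.
- apply/clP => A dA rA sA; have [n fin] := finite_cross Qm thQ dA.
  have [||m hm] := @finite_uniform _ _ (fun m g => ~ Q m g) fin.
  - by move=> i j g ij; apply: contra_not; exact: Qm.
  - move=> g [_ sg]; apply: contrapT => /forallNP h; apply: (rA g _ sg) => i _.
    exact: contrapT (h i).
  have [_ /clP/(_ A dA) h _] := QP (maxn n m); apply: h sA => g Qg sg.
  apply: (hm g); last exact: Qm (leq_maxr n m) _ Qg.
  by split=> //; exact: Qm (leq_maxl n m) _ Qg.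
- by move=> n; apply: thin_at_mono (leqnn n) _ (thQ n) => g /(_ n Logic.I).
Qed.

Lemma thin_finite_cross P A : (forall n, thin_at n P) -> dec A -> finite_set (P `&` sep A).
Proof.
by move=> thP dA; have [_] := @finite_cross (fun=> P) A (fun _ _ _ => @subset_refl _ _) thP dA.
Qed.

(** * Maximal independent sets *)

(** Suppose that an edge [e] of [I] is spanned by the rest of [J]. A set witnessing its independence
    in [I] separates only finitely many edges of a thin support; these lie outside [I] and can be
    cleaned away. *)
Lemma indp_coloops I J : I `<=` J -> indp I ->
  (forall f, J f -> ~ I f -> ~ cl (J `\ f) f) -> indp J.
Proof.
move=> IJ iI hJ e Je; have [Ie|/(hJ _ Je)//] := pselect (I e).
move=> /compact_support[P [PJ Pe thP]]; have [A [dA rA sA]] := not_clP (iI _ Ie).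
have /finite_seqP[ts tsE] := thin_finite_cross thP dA.
have tsP t : t \in ts -> P t /\ sep A t.
  by move=> tts; have : [set` ts] t by []; rewrite -tsE.
have [|A' dA' hA'] := @clean J ts A dA.
  move=> t /tsP[Pt st] Jt; apply: hJ => // It; apply: rA st; split=> //.
  by have [] := PJ _ Pt.
move/clP: Pe => /(_ A' dA'); apply.
  move=> f Pf; have Jf : J f by have [] := PJ _ Pf.
  rewrite hA' // => -[sf] /negP; apply.
  by have : [set` ts] f by rewrite -tsE.
by rewrite hA' //; split=> //; apply/negP => /tsP[/PJ[_ /(_ erefl)]].
Qed.

(* The closure after identifying the vertices of [N]. *)
Definition clN N P : set (edge G) := [set e | forall A, dec A -> resp A P ->
  (forall s t, N s -> N t -> (A s <-> A t)) -> ~ sep A e].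

Lemma clN_mono N P Q : P `<=` Q -> clN N P `<=` clN N Q.
Proof. by move=> PQ e h A dA /(resp_sub PQ); exact: h. Qed.

Lemma clN_id N P : P `<=` clN N P.
Proof. by move=> e Pe A _ rA _; exact: rA. Qed.

Lemma clN_trans N P Q : P `<=` clN N Q -> clN N P `<=` clN N Q.
Proof. by move=> PQ e h A dA rA cA; apply: h => // f /PQ; exact. Qed.

(* [F0] is chosen so that its members realize as many traces on [N] as         *)
(* possible; this is what makes every smaller set spanning [F0] modulo [N]     *)
(* span [F0] outright.                                                         *)
Lemma loose_local N I F : finite_set N -> I `<=` F -> exists F0 (Z : set (edge G)),
  [/\ I `<=` F0, F0 `<=` F, finite_set Z, Z `<=` F & F `<=` cl (F0 `|` Z)] /\
  forall F1, I `<=` F1 -> F1 `<=` F0 -> F0 `<=` clN N F1 -> F0 `<=` cl F1.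
Proof.
move=> /finite_seqP[X NX] IF.
(* [code A] is the trace of [A] on [N], and [S P] collects the traces of decided sets respecting
   [P]; it shrinks as [P] grows. *)
pose code A := map_tuple (fun v => `[< A v >]) (in_tuple X).
pose S P := [set b | `[< exists A, [/\ dec A, resp A P & b = code A] >]]%SET.
have SP P Q : P `<=` Q -> S Q \subset S P.
  move=> PQ; apply/fintype.subsetP => b; rewrite !inE => -[A [dA rA ->]].
  by exists A; split=> //; exact: resp_sub rA.
(* If [P] and [Q] allow the same traces, a set respecting [P] can be corrected by one respecting [Q]
   with the same trace. The symmetric difference is empty on [N] and separates the same edges of
   [Q]. *)
have key P Q : P `<=` Q -> (#|S P| <= #|S Q|)%N -> Q `<=` clN N P -> Q `<=` cl P.
  move=> PQ SPQ QP e Qe; apply/clP => A dA rA sA.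
  have /eqP SE : S Q == S P by rewrite eqEcard SP.
  have : code A \in S P by rewrite inE; apply/asboolP; exists A.
  rewrite -SE inE => /asboolP[A1 [dA1 rA1 /(congr1 val) /= /eq_in_map cA]].
  apply: (QP e Qe (symd A A1)); first exact: dec_symd.
  - by move=> f Pf; rewrite sep_symd; have := rA _ Pf; have := rA1 _ (PQ _ Pf); tauto.
  - have AA s : N s -> (A s <-> A1 s).
      by rewrite NX => /cA /= h; split=> hs; apply/asboolP; [rewrite -h|rewrite h]; apply/asboolP.
    by move=> s t /AA hs /AA ht; rewrite /symd /=; tauto.
  - by rewrite sep_symd; have := rA1 _ Qe; tauto.
have [F0 [IF0 F0F FF0] maxF0] := @ex_min_measure _
  (fun Q => [/\ I `<=` Q, Q `<=` F & F `<=` clN N Q])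
  (fun Q => (#|{: (size X).-tuple bool}| - #|S Q|)%N)
  (ex_intro _ F (And3 IF (@subset_refl _ F) (@clN_id N F))).
(* [Z] kills as many traces as any finite addition can. Adding one more edge of [F] then kills none,
   so that [key] applies to it. *)
have [Z [fZ ZF] minZ] := @ex_min_measure _ (fun Z : set (edge G) => finite_set Z /\ Z `<=` F)
  (fun Z : set (edge G) => #|S (F0 `|` Z)|) (ex_intro _ set0 (conj (finite_set0 _) (@sub0set _ _))).
exists F0, Z; split; first split=> //.
- move=> e Fe; have FZ : (e |` Z) `<=` F by rewrite subUset; split=> // _ ->.
  apply: (key _ (F0 `|` (e |` Z))).
  + by move=> f [?|?]; [left|right; right].
  + by apply: minZ; split=> //; rewrite finite_setU; split=> //; exact: finite_set1.
  + move=> f h; apply: (@clN_mono N F0); first by left.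
    by apply: FF0; case: h => [/F0F|/FZ].
  + by right; left.
- move=> F1 IF1 F1F0 F0F1; apply: key => //.
  have := maxF0 F1 (And3 IF1 (subset_trans F1F0 F0F) _).
  rewrite leq_sub2lE; last exact: max_card.
  by apply=> e /FF0; exact: clN_trans F0F1 e.
Qed.

(** [loose_local] splits the edges at each node into a loose part and finitely many others. The
    latter and the edges outside [Y n] are thinned to coloops by Zorn's lemma, their dependencies
    being finitary. Coloops lie in every spanning subset, so any freedom left is inside the loose
    parts, node by node. *)
Lemma base_stage n I F : I `<=` F -> exists F', [/\ I `<=` F', F' `<=` F, F `<=` cl F',
  (forall e, F' e -> ~ I e -> ~ Y n (src e) -> ~ Y n (tgt e) -> ~ cl (F' `\ e) e) &
  (forall F'' x, I `<=` F'' -> F'' `<=` F' -> F' `<=` cl F'' -> Y n x ->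
     at_ F' (node n x) `<=` cl (at_ F'' (node n x)))].
Proof.
move=> IF.
have /choice[p pP] : forall K, exists p : set (edge G) * set (edge G),
    (exists2 x, Y n x & K = node n x) ->
    [/\ at_ I K `<=` p.1, p.1 `<=` at_ F K, finite_set p.2, p.2 `<=` at_ F K &
      at_ F K `<=` cl (p.1 `|` p.2)] /\
    forall F1, at_ I K `<=` F1 -> F1 `<=` p.1 -> p.1 `<=` clN (nbh K) F1 ->
      p.1 `<=` cl F1.
  move=> K; have [[x Yx ->]|nK] := pselect (exists2 x, Y n x & K = node n x); last first.
    by exists (set0, set0).
  have [|F0 [Z hFZ]] := @loose_local (nbh (node n x)) (at_ I (node n x))
    (at_ F (node n x)) (node_finite Yx); first by move=> e [/IF ? ?].
  by exists (F0, Z).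
pose F0 x := (p (node n x)).1; pose Z x := (p (node n x)).2.
have pK x (Yx : Y n x) := pP _ (ex_intro2 _ _ x Yx erefl).
pose Fm := I `|` [set e | exists2 x, Y n x & F0 x e].
pose T0 := [set e | [/\ F e, ~ I e & (~ Y n (src e) /\ ~ Y n (tgt e)) \/
  exists2 x, Y n x & Z x e]].
have FmF : Fm `<=` F.
  by move=> e [/IF//|[x Yx F0e]]; have [[_ /(_ _ F0e)[]]] := pK _ Yx.
have F0touch x e : Y n x -> F0 x e -> touch (node n x) e.
  by move=> Yx F0e; have [[_ /(_ _ F0e)[]]] := pK _ Yx.
have Ztouch x e : Y n x -> Z x e -> touch (node n x) e.
  by move=> Yx Ze; have [[_ _ _ /(_ _ Ze)[]]] := pK _ Yx.
have touchY x e : touch (node n x) e -> ~ (~ Y n (src e) /\ ~ Y n (tgt e)).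
  by move=> [/comp_sub ?|/comp_sub ?] [].
have FT : F `<=` cl (Fm `|` T0).
  move=> e Fe; have [Ie|nIe] := pselect (I e); first by apply: cl_id; left; left.
  have in_node x : Y n x -> touch (node n x) e -> cl (Fm `|` T0) e.
    move=> Yx xe; have [[IF0 F0F fZ ZF sp] _] := pK _ Yx.
    apply: cl_cl (sp _ (conj Fe xe)) => f [F0f|Zf].
      by apply: cl_id; left; right; exists x.
    have [If|nIf] := pselect (I f); first by apply: cl_id; left; left.
    by apply: cl_id; right; split=> //; [have [] := ZF _ Zf|right; exists x].
  have [Ys|nYs] := pselect (Y n (src e)).
    by apply: (in_node (src e)) => //; left; exact: comp_id.
  have [Yt|nYt] := pselect (Y n (tgt e)).
    by apply: (in_node (tgt e)) => //; right; exact: comp_id.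
  by apply: cl_id; right; split=> //; left.
(* Over [Fm], a dependency on edges of [T0] needs only finitely many of them. This is [conn_local]
   for a set [Y'] whose depth varies with the node: each [Z x] is finite, but a single level need
   not avoid all of them. *)
have fin (S : set (edge G)) t : S `<=` T0 -> T0 t -> cl (Fm `|` S) t ->
    exists2 S0 : set (edge G), finite_set S0 /\ S0 `<=` S & cl (Fm `|` S0) t.
  move=> ST Tt ct.
  have /choice[m mP] : forall K, exists m, (n <= m)%N /\
      forall x e, Y n x -> K = node n x -> Z x e -> ~ Y m (src e) /\ ~ Y m (tgt e).
    move=> K; have [[x Yx KE]|nK] := pselect (exists2 x, Y n x & K = node n x); last first.
      by exists n; split=> // x e Yx KE; case: nK; exists x.
    have [[_ _ fZ _ _] _] := pK _ Yx.
    have [|m hm] := @layer_fin ([set src e | e in Z x] `|` [set tgt e | e in Z x]).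
      by rewrite finite_setU; split; apply: finite_image.
    exists (maxn n m); split=> [|y e Yy KE' Ze]; first exact: leq_maxl.
    have {}Ze : Z x e by move: Ze; rewrite /Z -KE' KE.
    split=> /(layer_mono (leq_maxr n m)); apply: hm.
      by left; exists e.
    by right; exists e.
  pose Y' := [set x | Y n x /\ Y (m (node n x)) x].
  have compY' x : Y' x -> comp Y' x = node (m (node n x)) x.
    move=> [Yx Ymx]; have nm := (mP (node n x)).1; apply/seteqP; split.
      apply: comp_ind; first exact: comp_id.
      move=> a b _ xa [Yb Ymb] ab; have nxa := node_mono nm xa.
      have nxb := comp_step nxa Yb ab; apply: comp_step xa _ ab.
      by rewrite -(comp_eq nxb).
    apply: comp_subcomp; last exact: comp_id.
    move=> a xa; have nxa := node_mono nm xa; split; first exact: comp_sub nxa.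
    by rewrite (comp_eq nxa); exact: comp_sub xa.
  have T0Y' e : T0 e -> ~ Y' (src e) /\ ~ Y' (tgt e).
    move=> [_ _ [[ns nt]|[x Yx Ze]]]; first by split=> -[].
    have := mP (node n x) => -[_ /(_ x e Yx erefl Ze)[ns nt]].
    have xe := Ztouch _ _ Yx Ze.
    split=> -[Yv]; [have ve : touch (node n (src e)) e by left; exact: comp_id
      |have ve : touch (node n (tgt e)) e by right; exact: comp_id];
    by rewrite -(touch_same xe ve).
  pose B := [set w | exists S0 : set (edge G), [/\ finite_set S0, S0 `<=` S &
    conn (Fm `|` S0) (src t) w]].
  have ext (S1 : set (edge G)) u v : finite_set S1 -> S1 `<=` S ->
      conn (Fm `|` S1) u v -> B u -> B v.
    move=> fS1 S1S uv [S0 [fS0 S0S tu]]; exists (S0 `|` S1); split.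
    - by rewrite finite_setU.
    - by rewrite subUset.
    - apply: (@conn_trans _ u); first by apply: conn_mono tu; rewrite setUA; left.
      by apply: conn_mono uv => f [?|?]; [left|right; right].
  suff [+ _] : B (src t) <-> B (tgt t).
    by move=> [|S0 [fS0 S0S h]]; [exists set0; split|exists S0].
  have [nts ntt] := T0Y' _ Tt.
  apply: (conn_local (Y' := Y') (P := Fm `|` S)) => //.
  - move=> x Y'x; rewrite compY' //; apply: node_finite; by case: Y'x.
  - move=> z bz; set M := m (node n (z n)); have nM := (mP (node n (z n))).1.
    exists M => v zv; have := branch_sub bz nM zv => nzv; split; first exact: comp_sub nzv.
    by rewrite (comp_eq nzv); exact: comp_sub zv.
  - move=> e [Fme|Se] _ _.
      have ce : conn (Fm `|` set0) (src e) (tgt e) by apply: (@cl_id (Fm `|` set0)); left.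
      by split; apply: (ext set0) => //; exact: conn_sym.
    have ce : conn (Fm `|` [set e]) (src e) (tgt e).
      by apply: (@cl_id (Fm `|` [set e])); right.
    have sS : [set e] `<=` S by move=> _ ->.
    by split; apply: (ext [set e]) => //; exact: conn_sym.
  - move=> x u v Y'x _ _ uv.
    have {}uv : conn (Fm `|` set0) u v.
      apply: conn_mono uv => e [[Fme|Se] xe]; first by left.
      have [ns nt] := T0Y' _ (ST _ Se).
      by case: xe => /comp_sub.
    by split; apply: (ext set0) => //; exact: conn_sym.
(* [fin] is what carries the coloop property to the union of a chain; maximality then makes [T] span
   [T0] over [Fm]. *)
have [T [[TT0 Tcol] maxT]] : exists T, (T `<=` T0 /\
    forall t, T t -> ~ cl (Fm `|` (T `\ t)) t) /\ forall S, T `<` S ->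
    ~ (S `<=` T0 /\ forall t, S t -> ~ cl (Fm `|` (S `\ t)) t).
  apply: (@Zorn_bigcup _ (fun S => S `<=` T0 /\
    forall t, S t -> ~ cl (Fm `|` (S `\ t)) t)) => FF FFP tot.
  split; first by move=> e [S /FFP[h _] /h].
  move=> t [X1 FX1 X1t]; set S := \bigcup_(X in FF) X => ct.
  have [||S0 [fS0 S0S] ct0] := fin (S `\ t) t _ _ ct.
  - by move=> e [[X /FFP[h _] /h]].
  - by have [h _] := FFP _ FX1; exact: h.
  have /finite_seqP[s0 sE] := fS0.
  have [|X [FX X1X hX]] := @chain_capture _ _ (fun X f => X f) FF X1 s0 tot FX1.
    move=> f fs0; have [[X FX Xv] _] : (S `\ t) f by apply: S0S; rewrite sE.
    have [X1X|XX1] := tot _ _ FX1 FX; first by exists X; split=> // W _; exact.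
    by exists X1; split=> // W _ /(_ _ (XX1 _ Xv)).
  have [_ /(_ t (X1X _ X1t))] := FFP _ FX; apply; apply: cl_mono ct0.
  move=> e [Fme|S0e]; [by left|right; split; last by have [] := S0S _ S0e].
  by apply: hX => //; move: S0e; rewrite sE.
have T0cl : T0 `<=` cl (Fm `|` T).
  move=> t T0t; apply: contrapT => nt; have nTt : ~ T t.
    by move=> Tt; apply: nt; apply: cl_id; right.
  apply: (maxT (t |` T)); first by split; [right|move=> /(_ t (or_introl erefl))].
  split; first by rewrite subUset; split=> // _ ->.
  move=> u [->|Tu] cu.
    by apply: nt; apply: cl_mono cu => e [|[[->|] ne]]; [left|case: ne|right].
  apply: nt; apply: (@cl_mono (u |` (Fm `|` (T `\ u)))).
    by move=> e [->|[|[]]]; [right|left|right].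
  apply: exchange (Tcol _ Tu); apply: cl_mono cu.
  by move=> e [|[[->|Te] eu]]; [right; left|left|right; right].
pose F' := Fm `|` T.
have TFm t : T t -> ~ Fm t by move=> Tt Fmt; apply: (Tcol _ Tt); apply: cl_id; left.
have Tcol' t : T t -> ~ cl (F' `\ t) t.
  by move=> Tt; apply: contra_not (Tcol _ Tt); apply: cl_mono => e [[|] ? ?]; [left|right].
have Fat x e : Y n x -> F' e -> touch (node n x) e -> F0 x e \/ (T e /\ Z x e).
  move=> Yx [[Ie|[y Yy F0e]]|Te] xe.
  - by left; have [[h _ _ _ _] _] := pK _ Yx; exact: h.
  - by left; rewrite /F0 (touch_same xe (F0touch _ _ Yy F0e)).
  - right; split=> //; have [_ _ [/(touchY _ _ xe)//|[y Yy Ze]]] := TT0 _ Te.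
    by rewrite /Z (touch_same xe (Ztouch _ _ Yy Ze)).
exists F'; split.
- by left; left.
- by move=> e [/FmF|/TT0[]].
- move=> e Fe; apply: cl_cl (FT _ Fe) => f [Fmf|Tf]; [by apply: cl_id; left|exact: T0cl].
- move=> e [[//|[x Yx /(F0touch _ _ Yx)]]|Te _ _ _]; last exact: Tcol'.
  by move=> /touchY h _ ns nt; case: h.
- move=> F'' x IF'' F''F' spF'' Yx.
  have [[IF0 F0F fZ ZF sp] loose] := pK _ Yx.
  have TF'' : T `<=` F''.
    move=> t Tt; apply: contrapT => nt; apply: (Tcol' _ Tt).
    apply: cl_mono (spF'' t _); last by right.
    by move=> e Fe; split; [exact: F''F'|move=> et; apply: nt; rewrite -et].
  (* By looseness it suffices to span modulo the neighbourhood. A set constant there can be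
     complemented so as to miss it, and then cut down to the node; the finitely many edges of [T] in
     [Z x] are cleaned away. *)
  have main : F0 x `<=` cl (F'' `&` F0 x).
    apply: loose.
    - by move=> e [Ie xe]; split; [exact: IF''|exact: IF0].
    - by move=> e [].
    move=> e F0e A dA rA cA sA.
    wlog AN : A dA rA cA sA / forall s, nbh (node n x) s -> ~ A s.
      move=> wl; have [[s Ns As]|h] := pselect (exists2 s, nbh (node n x) s & A s).
        apply: (wl (~` A)) => //; [exact: decC|by move=> f /rA; rewrite sepC
          |by move=> u v Nu Nv; have := cA _ _ Nu Nv; rewrite /setC /=; tauto
          |by rewrite sepC|].
        by move=> t Nt; have := cA _ _ Ns Nt; rewrite /setC /=; tauto.
      by apply: (wl A) => // s Ns As; apply: h; exists s.
    have dK : dec (A `&` node n x) by apply: decI => //; exact: dec_node.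
    have AK v : node n x v \/ nbh (node n x) v -> ((A `&` node n x) v <-> A v).
      move=> [xv|Nv]; rewrite /setI /=; first by tauto.
      by have := AN _ Nv; tauto.
    have sepK f : touch (node n x) f -> (sep (A `&` node n x) f <-> sep A f).
      move=> xf; have ab := adjacent_edge f; have ba := adjacentC ab.
      rewrite /sep !AK //; case: xf => xf; [exact: nbh_sub_closed ab|by left|by left|].
      exact: nbh_sub_closed ba.
    have nsepK f : ~ touch (node n x) f -> ~ sep (A `&` node n x) f.
      by move=> /not_orP[ns nt]; rewrite /sep /setI /=; tauto.
    have /finite_seqP[ts tsE] : finite_set (T `&` Z x) by exact: finite_setIr.
    have tsP t : t \in ts -> T t.
      by move=> tts; have : [set` ts] t by []; rewrite -tsE => -[].
    have [t /tsP Tt _|A' dA' hA'] := @clean F' ts _ dK; first exact: Tcol'.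
    have Fe : F' e by left; right; exists x.
    have /clP/(_ A' dA') h := spF'' _ Fe; apply: h.
      move=> f Ff; have F'f := F''F' _ Ff; rewrite hA' // => -[sf nts].
      have xf : touch (node n x) f by apply: contrapT => /nsepK.
      move: sf; rewrite sepK // => sf; have [F0f|[Tf Zf]] := Fat _ _ Yx F'f xf.
        by apply: rA sf.
      by move/negP: nts; apply; have : [set` ts] f by rewrite -tsE.
    rewrite hA' // sepK; last exact: F0touch.
    by split=> //; apply/negP => /tsP/TFm; apply; right; exists x.
  move=> e [F'e xe]; have [F0e|[Te _]] := Fat _ _ Yx F'e xe; last first.
    by apply: cl_id; split=> //; exact: TF''.
  apply: cl_mono (main _ F0e) => f [Ff F0f]; split=> //; exact: F0touch F0f.
Qed.

(* The intersection of the stages is spanning because an edge it fails to span   *)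
(* could be traced along a branch through all layers, contradicting that the     *)
(* witnessing set is decided.                                                    *)
Lemma exists_base I X : indp I -> I `<=` X ->
  exists J, [/\ indp J, I `<=` J, J `<=` X & X `<=` cl J].
Proof.
move=> iI IX.
have /choice[stg stP] : forall nF : nat * set (edge G), exists F', I `<=` nF.2 ->
  [/\ I `<=` F', F' `<=` nF.2, nF.2 `<=` cl F',
  (forall e, F' e -> ~ I e -> ~ Y nF.1 (src e) -> ~ Y nF.1 (tgt e) -> ~ cl (F' `\ e) e) &
  (forall F'' x, I `<=` F'' -> F'' `<=` F' -> F' `<=` cl F'' -> Y nF.1 x ->
     at_ F' (node nF.1 x) `<=` cl (at_ F'' (node nF.1 x)))].
  move=> [n F]; have [/(base_stage n)[F' ?]|nI] := pselect (I `<=` F); first by exists F'.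
  by exists F.
pose F := fix F n := if n is k.+1 then stg (k, F k) else X.
have IF n : I `<=` F n by elim: n => //= n /(stP (n, _))[].
have FS n := stP (n, F n) (IF n).
have Fm n m : (n <= m)%N -> F m `<=` F n.
  move=> /subnK <-; elim: (m - n)%N => // k IH; rewrite addSn.
  by apply: subset_trans IH; have [] := FS (k + n)%N.
have Fcl n m : (n <= m)%N -> F n `<=` cl (F m).
  move=> /subnK <-; elim: (m - n)%N => [|k IH]; first exact: cl_id.
  rewrite addSn; apply: subset_trans IH _; apply: cl_cl.
  by have [] := FS (k + n)%N.
pose J := \bigcap_n F n.
have JF n : J `<=` F n by move=> e /(_ n Logic.I).
have col n e : F n.+1 e -> ~ I e -> ~ Y n (src e) -> ~ Y n (tgt e) ->
    ~ cl (F n.+1 `\ e) e by have [_ _ _ + _] := FS n; exact.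
(* Once both endvertices have left [Y n], an edge of [F n.+1] is never discarded: outside [I] it is
   a coloop, and all later stages still span it. *)
have inJ n e : F n.+1 e -> ~ Y n (src e) -> ~ Y n (tgt e) -> J e.
  move=> Fe ns nt; have [Ie|nIe] := pselect (I e); first by move=> m _; exact: IF.
  move=> m _; have [mn|nm] := leqP m n.+1; first exact: Fm mn _ Fe.
  apply: contrapT => nFe; apply: (col _ _ Fe nIe ns nt).
  apply: cl_mono (Fcl _ _ (ltnW nm) _ Fe) => f Ff; split; first exact: Fm (ltnW nm) _ Ff.
  by move=> fe; apply: nFe; rewrite -fe.
have lvl e : exists n, ~ Y n (src e) /\ ~ Y n (tgt e).
  have [|n h] := @layer_fin [set src e; tgt e].
    by rewrite finite_setU; split; exact: finite_set1.
  by exists n; split; apply: h; [left|right].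
have XF n : X `<=` cl (F n) by exact: Fcl (leq0n n).
exists J; split=> //.
- apply: (indp_coloops (I := I)) => //; first by move=> e Ie n _; exact: IF.
  move=> e Je nIe; have [n [ns nt]] := lvl e.
  apply: contra_not (col n e (JF _ _ Je) nIe ns nt); apply: cl_mono.
  by move=> f [Jf fe]; split=> //; exact: JF.
- by move=> e Ie n _; exact: IF.
- exact: (JF 0%N).
move=> e Xe; apply/clP => A dA rA sA; have [n0 [ns nt]] := lvl e.
(* At a bad node, [A] distinguishes two neighbours that the current edges at the node connect. By
   [step], badness passes to a node of the next level. *)
pose bad n x := Y n x /\ exists s t, [/\ nbh (node n x) s, nbh (node n x) t,
  conn (at_ (F n.+1) (node n x)) s t & ~ (A s <-> A t)].
have step P n u v : P `<=` F n.+1 -> conn P u v -> ~ Y n u -> ~ Y n v -> ~ (A u <-> A v) ->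
    exists2 x, Y n x & exists s t, [/\ nbh (node n x) s, nbh (node n x) t,
      conn (at_ P (node n x)) s t & ~ (A s <-> A t)].
  move=> PF uv nu nv nA; apply: contrapT => h; apply: nA.
  apply: (conn_local (Y' := Y n) (P := P)) => //.
  - exact: node_finite.
  - by move=> z bz; exists n; exact: comp_sub.
  - by move=> f Pf fs ft; apply: (respP rA); apply: inJ (PF _ Pf) fs ft.
  - move=> x s t Yx Ns Nt cst; apply: contrapT => nst; apply: h; exists x => //.
    by exists s, t.
have [x0 bad0] : exists x, bad n0 x.
  have [x Yx h] := step (F n0.+1) n0 _ _ (@subset_refl _ _) (XF n0.+1 _ Xe) ns nt sA.
  by exists x; split.
have [||z bz hz] := ex_branch (Q := bad) _ bad0; first by move=> n x [].
  move=> n x [Yx [s [t [Ns Nt st nst]]]].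
  have {}st : conn (at_ (F n.+2) (node n x)) s t.
    have [_ _ _ _ loc] := FS n.
    apply: conn_cl st.
    exact: (loc (F n.+2) x (IF n.+2) (Fm n.+1 n.+2 (leqnSn _)) (Fcl n.+1 n.+2 (leqnSn _)) Yx).
  have [|||y Yy [s' [t' [Ns' Nt' st' nst']]]] := step _ n.+1 _ _ _ st _ _ nst.
  - by move=> f [].
  - by move=> /YS; exact: nbh_comp Ns.
  - by move=> /YS; exact: nbh_comp Nt.
  (* Without an edge at both nodes, [s'] and [t'] would be connected by no edges at all and hence be
     equal. *)
  have [[f [[Ff xf] yf]]|no] := pselect (exists f, at_ (at_ (F n.+2) (node n x)) (node n.+1 y) f).
    exists y; last first.
      rewrite (touch_same xf (touch_sub (node_mono (leqnSn n)) yf)).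
      exact: comp_id (YS Yy).
    by split=> //; exists s', t'; split=> //; apply: conn_mono st' => g [[]].
  exfalso; apply: nst'; suff -> : s' = t' by [].
  by apply: conn0; apply: conn_mono st' => g hg; apply: no; exists g.
have [n hn] := dA _ bz.
have [Yz [s [t [Ns Nt _ nst]]]] := hz (maxn n n0).+1 (leqW (leq_maxr n n0)).
have sub v : nbh (node (maxn n n0).+1 (z (maxn n n0).+1)) v -> node n (z n) v.
  move=> /(nbh_node Yz); rewrite (comp_eq (branch_node bz (leqnSn _))).
  exact: branch_sub bz (leq_maxl n n0) _.
by apply: nst; case: hn => hn; have := hn _ (sub _ Ns); have := hn _ (sub _ Nt);
  rewrite /setC /=; tauto.
Qed.

End Decided.

(** * The matroid and its circuits *)

Section LayerMatroid.
Context {G : graph}.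
Variable Y : nat -> set (vertex G).
Hypothesis YP : layering Y.
Implicit Types (A B D : set (vertex G)) (I J C P : set (edge G)) (e f g : edge G).

Let indp0 : indp Y set0. Proof. by []. Qed.

Let indpS I J : indp Y J -> I `<=` J -> indp Y I.
Proof. exact: indp_sub. Qed.

Let indp_augmentation I J : indp Y I -> ~ maximal_in (indp Y) I ->
  maximal_in (indp Y) J -> exists e, [/\ J e, ~ I e & indp Y (e |` I)].
Proof.
move=> iI nI [iJ maxJ]; apply: indp_aug => //.
- apply: contrapT => h; apply: nI; split=> // B iB IB; apply/seteqP; split=> // e Be.
  apply: contrapT => nIe; apply: h; exists e => //; apply: indp_sub iB _.
  by rewrite subUset; split=> // _ ->.
- by move=> e /maxJ <-; [left|right].
Qed.

Let indp_maximal I X : indp Y I -> I `<=` X ->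
  exists B : set (edge G), maximal_in [set J | [/\ indp Y J, I `<=` J & J `<=` X]] B.
Proof.
move=> iI IX; have [J [iJ IJ JX XJ]] := exists_base YP iI IX.
exists J; split=> // B [iB IB BX] JB; apply/seteqP; split=> // e Be.
apply: contrapT => nJe; apply: (iB _ Be); apply: cl_mono (XJ _ (BX _ Be)) => f Jf.
by split; [exact: JB|move=> fe; apply: nJe; rewrite -fe].
Qed.

Definition layer_matroid : matroid (edge G) :=
  Matroid indp0 indpS indp_augmentation indp_maximal.

Definition cyclic C := [/\ C !=set0,
  (forall A e, dec Y A -> C e -> sep A e -> exists f, [/\ C f, f <> e & sep A f]) &
  (forall e f, C e -> C f -> e <> f -> exists2 A, dec Y A &
     forall g, C g -> (sep A g <-> g = e \/ g = f))].

(** In a minimal dependent set, exchange carries the dependence of one edge to all others, so no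
    edge is separated alone; independence of [C] minus [e] gives a set separating [f] and, of the
    other edges in [C], at most [e]. Conversely, such sets make every proper subset independent. *)
Lemma layer_circuitP C : circuits layer_matroid C <-> cyclic C.
Proof.
rewrite /circuits /minimal_in /=; split.
  move=> [nC minC]; have /existsNP[e0 /not_implyP[Ce0 /contrapT ce0]] := nC.
  have iD e : C e -> indp Y (C `\ e).
    move=> Ce; apply: contrapT => h; have := minC _ h (@subDsetl _ _ _) => CE.
    by have : (C `\ e) e; [rewrite CE|case=> _; apply].
  have cC e : C e -> cl Y (C `\ e) e.
    move=> Ce; have [->//|/eqP ee0] := eqVneq e e0.
    apply: (@cl_mono _ Y (e0 |` ((C `\ e) `\ e0))).
      by move=> f [->|[]//]; split=> //; exact/nesym.
    apply: (exchange YP).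
      apply: cl_mono ce0 => f [Cf fe0]; have [->|/eqP fe] := eqVneq f e; first by left.
      by right; split.
    by apply: iD Ce _ _; split=> //; exact/nesym.
  have c1 A e : dec Y A -> C e -> sep A e -> exists f, [/\ C f, f <> e & sep A f].
    move=> dA Ce sA; apply: contrapT => h; have /clP/(_ A dA) := cC _ Ce; apply=> //.
    by move=> f [Cf fe] sf; apply: h; exists f.
  split=> //; first by exists e0.
  move=> e f Ce Cf ef.
  have [A [dA rA sA]] := not_clP (iD _ Ce f (conj Cf (nesym ef))).
  have only g : C g -> sep A g -> g = e \/ g = f.
    move=> Cg sg; apply: contrapT => /not_orP[ge gf]; apply: rA sg.
    by split.
  exists A => // g Cg; split; first exact: only.
  move=> [->|->] //; have [h [Ch hf sh]] := c1 _ _ dA Cf sA.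
  by have [<-|] := only _ Ch sh.
move=> [[e0 Ce0] c1 c2]; split.
  move=> /(_ _ Ce0); apply; apply/clP => A dA rA sA.
  by have [f [Cf fe sf]] := c1 _ _ dA Ce0 sA; apply: rA sf.
move=> B nB BC; apply/seteqP; split=> // e Ce; apply: contrapT => nBe; apply: nB.
move=> f Bf /clP h; have [|A dA hA] := c2 e f Ce (BC _ Bf).
  by move=> ef; apply: nBe; rewrite ef.
apply: (h A dA).
  by move=> g [Bg gf]; rewrite hA; [move=> [ge|]//; apply: nBe; rewrite -ge|exact: BC].
by rewrite hA; [right|exact: BC].
Qed.

(** A compact support of [e] within [C] becomes dependent when [e] is added, and by minimality it is
    then all of [C]. *)
Lemma cyclic_thin C n : cyclic C -> thin_at Y n C.
Proof.
move=> cC; have [[e Ce] c1 _] := cC.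
have ce : cl Y (C `\ e) e.
  apply/clP => A dA rA sA; have [f [Cf fe sf]] := c1 _ _ dA Ce sA.
  by apply: rA sf.
have [P [PC Pe thP]] := compact_support YP ce.
have [_ minC] := (layer_circuitP C).2 cC.
rewrite -(minC (e |` P)).
- by apply: thin_atU => //; exact: thin_at1.
- move=> /(_ e (or_introl erefl)); apply; apply: cl_mono Pe => f Pf.
  by split; [right|have [] := PC _ Pf].
- by rewrite subUset; split=> [_ ->//|f /PC[]].
Qed.

End LayerMatroid.

(** * Undominated ends and branches *)

Section Ends.
Context {G : graph}.
Implicit Types (S C D U : set (vertex G)) (u v x y : vertex G) (w : gend G) (r : ray G).

Lemma componentE S C : is_component S C <-> exists2 x, ~ S x & C = comp (~` S) x.
Proof. by rewrite /comp setCK. Qed.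

Lemma ray_equiv_sym r r' : ray_equiv r r' -> ray_equiv r' r.
Proof. by move=> h S /h[C [? ? ?]]; exists C. Qed.

Lemma ray_equiv_trans r r' r'' : ray_equiv r r' -> ray_equiv r' r'' -> ray_equiv r r''.
Proof.
move=> h1 h2 S fS; have [C [cC Cr Cr']] := h1 _ fS; have [D [cD Dr' Dr'']] := h2 _ fS.
have [x Cx Dx] := tail_in_meet Cr' Dr'; exists C; split=> //.
by rewrite (component_eq cC cD Cx Dx).
Qed.

Lemma end_rays_equiv w r r' : end_rays w r -> end_rays w r' -> ray_equiv r r'.
Proof.
have [r0 ->] := end_class w => /= h h'.
exact: ray_equiv_trans (ray_equiv_sym h) h'.
Qed.

Lemma end_rays_ex w : exists r, end_rays w r.
Proof. by have [r ->] := end_class w; exists r; exact: ray_equiv_refl. Qed.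

Lemma gend_eq w w' : (exists r, end_rays w r /\ end_rays w' r) -> w = w'.
Proof.
move=> [r [wr w'r]]; have : end_rays w = end_rays w'.
  move: (end_class w) (end_class w') wr w'r => [s ->] [s' ->] /= sr s'r.
  by apply/seteqP; split=> t /= h; [apply: ray_equiv_trans s'r _|apply: ray_equiv_trans sr _];
    [exact: ray_equiv_trans (ray_equiv_sym sr) h|exact: ray_equiv_trans (ray_equiv_sym s'r) h].
case: w w' {wr w'r} => [X cX] [X' cX'] /= XX'; subst X'.
by rewrite (Prop_irrelevance cX cX').
Qed.

Lemma tail_in_equiv O x r r' : finite_set (nbh (comp O x)) ->
  tail_in (comp O x) r -> ray_equiv r r' -> tail_in (comp O x) r'.
Proof.
move=> fD Dr rr'; have [//|Dr'] := tail_in_dich r' fD.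
have [C [/componentE[y ny CE] Cr Cr']] := rr' _ fD; rewrite CE in Cr Cr'.
have [a Ca Da] := tail_in_meet Cr Dr; have [b Cb Db] := tail_in_meet Cr' Dr'.
exfalso; apply: Db; left.
suff : comp (~` nbh (comp O x)) y `<=` comp O x by exact.
apply: comp_conn Ca Da _ => c d _ yd xc cd.
by have [//|/(comp_sub yd)] := nbh_sub_closed xc cd.
Qed.

Lemma is_walk_cross D x (p : seq (vertex G)) : is_walk x p -> ~ D x -> D (last x p) ->
  exists2 z, z \in x :: p & nbh D z.
Proof.
elim: p x => [|y p IH] x //= /andP[/asboolP xy wp] nx Dl.
have [Dy|nDy] := pselect (D y).
  by exists x; [rewrite inE eqxx|split=> //; exists y => //; exact: adjacentC].
by have [z zp Nz] := IH _ wp nDy Dl; exists z => //; rewrite inE zp orbT.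
Qed.

(* Otherwise one finds greedily infinitely many [v]-[r] paths which pairwise   *)
(* meet only in [v].                                                           *)
Lemma undominated_separator w r v : end_rays w r -> ~ dominates v w ->
  exists S, [/\ finite_set S, ~ S v & exists2 C, is_component S C /\ tail_in C r & ~ C v].
Proof.
move=> wr ndom; apply: contrapT => h; apply: ndom; exists r => //.
have step (L : seq (vertex G)) : exists p, v \notin L -> [/\ is_path v p,
    range r (last v p), p != [::] & forall z, z \in p -> z \notin L].
  have [vL|vL] := boolP (v \in L); first by exists [::].
  have [C cC Cr] := ray_tail_component r (finite_seq L).
  have Cv : C v.
    by apply: contrapT => nCv; apply: h; exists [set` L]; split; [|exact/negP|exists C].
  have [n hn] := ray_avoid r (finite_set1 v); have [m hm] := Cr.
  have Crm := hm _ (leq_maxr n m).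
  have [x nx CE] := cC; rewrite CE /= in Cv Crm.
  have [q [wq lq Lq]] := connected_trans (connected_sym Cv) Crm.
  exists (shorten v q) => _; move: lq; case/shortenP: wq => p wp up sub lp; split=> //.
  - by rewrite /is_path /is_walk wp.
  - by exists (maxn n m).
  - apply/eqP => p0; apply: (hn _ (leq_maxl n m)); rewrite /= -lp p0 //.
  - by move=> z /sub zq; apply/negP; apply: Lq; rewrite inE zq orbT.
have /choice[f fP] := step.
pose L := fix L n := if n is k.+1 then L k ++ f (L k) else [::].
have vL n : v \notin L n.
  elim: n => //= n IH; rewrite mem_cat negb_or IH /=.
  by have [/andP[_ /andP[]]] := fP _ IH.
pose p n := f (L n).
have pP n := fP _ (vL n).
have pL n m : (n < m)%N -> forall z, z \in p n -> z \in L m.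
  elim: m => // m IH; rewrite ltnS leq_eqVlt => /orP[/eqP <-|/IH h'] z zp /=.
    by rewrite mem_cat zp orbT.
  by rewrite mem_cat h'.
have disj n m : (n < m)%N -> forall z, z \in p n -> z \in p m -> False.
  by move=> nm z /(pL _ _ nm) zL; have [_ _ _ /(_ z)/[apply]] := pP m; rewrite zL.
have pinj : injective p.
  suff lt n m : (n < m)%N -> p n <> p m.
    by move=> n m pnm; case: (ltngtP n m) => // /lt; [move/(_ pnm)|move/(_ (esym pnm))].
  move=> nm pnm; have [_ _ + _] := pP n; rewrite -/(p n).
  case E : (p n) => [//|z s] _; apply: (disj _ _ nm z); rewrite ?E ?inE ?eqxx //.
  by rewrite -pnm E inE eqxx.
exists (range p); first last.
  split=> [_ [n _ <-]|_ _ [n _ <-] [m _ <-] nm x]; first by have [] := pP n.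
  rewrite !inE => /orP[/eqP //|xn] /orP[/eqP //|xm]; exfalso.
  case: (ltngtP n m) => [/disj h'|/disj h'|nmE]; [exact: h' xn xm|exact: h' xm xn|].
  by apply: nm; rewrite nmE.
move=> fin; apply: infinite_nat.
have -> : [set: nat] = p @^-1` range p by apply/seteqP; split=> // n _; exists n.
by apply: finite_preimage => // a b _ _; exact: pinj.
Qed.

Lemma undominated_free w r : end_rays w r -> ~ dominated w -> free_ray r.
Proof.
move=> wr ndom U fU.
have /choice[S SP] : forall u, exists S, [/\ finite_set S, ~ S u &
    exists2 C, is_component S C /\ tail_in C r & ~ C u].
  by move=> u; apply: undominated_separator wr _ => du; apply: ndom; exists u.
(* The component of the complement of [T] holding the tail lies in [D] for every [u], hence avoids
   [u]. Nor is [u] a neighbour of it: since [S u] does not contain [u], a neighbour [u] would lie in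
   [D]. *)
pose T := \bigcup_(u in U) S u.
have fT : finite_set T by apply: bigcup_finite => // u _; have [] := SP u.
have [C /componentE[x nx CE] Cr] := ray_tail_component r fT.
have NC : nbh C `<=` T by move=> v; rewrite CE => /nbh_comp /contrapT.
exists C => //; split; first exact: sub_finite_set NC fT.
move=> u Uu; have [fS nSu [D [/componentE[y ny DE] Dr] nDu]] := SP u.
have CD : C `<=` D.
  have [a Ca Da] := tail_in_meet Cr Dr; rewrite CE DE -(comp_eq (x := y) (y := a)) -?DE //.
  rewrite CE in Ca; apply: comp_subcomp Ca => z /comp_sub nTz Sz; apply: nTz.
  by exists u.
split; first by move=> /CD.
move=> [_ [b /CD Db bu]]; apply: nDu; rewrite DE in Db *.
exact: comp_step Db nSu bu.
Qed.

End Ends.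

(** * Nodes of an end, and the end of a branch *)

Section EndNodes.
Context {G : graph}.
Variable Y : nat -> set (vertex G).
Hypothesis YP : layering Y.
Implicit Types (A B D S : set (vertex G)) (x v : vertex G) (w : gend G) (r : ray G)
  (z : nat -> vertex G).

Local Notation node n x := (comp (Y n) x).

Definition end_node n w := end_comp (~` Y n) w.

Lemma end_nodeP n w : ~ dominated w -> exists x, [/\ Y n x, end_node n w = node n x &
  forall r, end_rays w r -> tail_in (node n x) r].
Proof.
move=> nd; have [r wr] := end_rays_ex w; have fr := undominated_free wr nd.
have : tail_in (Y n) r by case: YP => _ _ _ _; apply.
move=> /tail_in_comp[m [Ym hm]]; have Dr : tail_in (node n (r m)) r by exists m.
have all r' : end_rays w r' -> tail_in (node n (r m)) r'.
  by move=> wr'; apply: tail_in_equiv (end_rays_equiv wr wr') => //; exact: node_finite.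
exists (r m); split=> //; apply/seteqP; split=> v.
  move=> [C [[x nx CE] Cw Cv]]; have [a Ca Da] := tail_in_meet (Cw _ wr) Dr.
  by rewrite CE in Ca Cv; rewrite -(comp_eq Da) (comp_eq Ca).
by move=> mv; exists (node n (r m)); split=> //; exists (r m) => // /(_ Ym).
Qed.

(** Basic open sets delete only finite vertex sets, while the complement of [Y n] may be infinite;
    the finite neighbourhood of the node takes its place. *)
Lemma end_comp_nbh n w : ~ dominated w ->
  end_comp (nbh (end_node n w)) w = end_node n w.
Proof.
move=> nd; have [x [Yx -> wx]] := end_nodeP n nd.
have [/componentE[y ny ->] wC] := end_compP w (node_finite YP Yx).
have [r wr] := end_rays_ex w; have [a Ca Da] := tail_in_meet (wC _ wr) (wx _ wr).
apply/seteqP; split; last first.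
  rewrite -(comp_eq Ca); apply: comp_subcomp Da.
  by move=> v xv [].
apply: comp_conn Ca Da _ => b c _ yc xb bc.
by have [//|/(comp_sub yc)] := nbh_sub_closed xb bc.
Qed.

Lemma end_node_sub_comp S w : finite_set S -> ~ dominated w ->
  exists n, end_node n w `<=` end_comp S w.
Proof.
move=> fS nd; have [n hn] := layer_fin YP fS; exists n.
have [x [Yx -> wx]] := end_nodeP n nd.
have [/componentE[y ny ->] wC] := end_compP w fS.
have [r wr] := end_rays_ex w; have [a Ca Da] := tail_in_meet (wC _ wr) (wx _ wr).
by rewrite -(comp_eq Ca); apply: comp_subcomp Da => v /comp_sub Yv /hn.
Qed.

Lemma end_node_inj w w' : ~ dominated w -> ~ dominated w' ->
  (forall n, end_node n w = end_node n w') -> w = w'.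
Proof.
move=> nd nd' h; have [r wr] := end_rays_ex w; have [r' wr'] := end_rays_ex w'.
apply: gend_eq; exists r'; split=> //.
have [r0 wE] := end_class w; rewrite wE /=; apply: (@ray_equiv_trans _ _ r).
  by move: wr; rewrite wE.
move=> S fS; have [n sub] := end_node_sub_comp fS nd.
have [cC wC] := end_compP w fS; exists (end_comp S w); split=> //; first exact: wC.
apply: tail_in_sub sub _; rewrite h; have [x [_ -> w'x]] := end_nodeP n nd'.
exact: w'x.
Qed.

Lemma end_branch w : ~ dominated w ->
  exists2 z, branch Y z & forall n, end_node n w = node n (z n).
Proof.
move=> nd; have /choice[z zP] := fun n => end_nodeP n nd.
exists z => [n|n]; last by have [] := zP n.
have [Yn _ wn] := zP n; have [Yn1 _ wn1] := zP n.+1; split=> //.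
have [r wr] := end_rays_ex w; have [a an an1] := tail_in_meet (wn _ wr) (wn1 _ wr).
have := node_mono YP (leqnSn n) an1 => ?.
by rewrite -(comp_eq an); apply: connected_sym.
Qed.

(* A walk through the nodes of the branch visits each vertex only finitely     *)
(* often; deleting its loops leaves a ray.                                     *)
Lemma branch_ray z : branch Y z -> exists r, forall n, tail_in (node n (z n)) r.
Proof.
move=> bz; pose D n := node n (z n).
(* [s n] is an exit of [D n]: a vertex of [D n] adjacent to [D n.+1]. *)
have /choice[s sP] : forall n, exists v, nbh (D n.+1) v.
  by move=> n; have [v] := nbh_node0 YP (bz n.+1).1; exists v.
have sD n : D n (s n).
  have := nbh_node YP (bz n.+1).1 (sP n).
  by rewrite (comp_eq (branch_node YP bz (leqnSn n))).
have /choice[s' s'P] : forall n, exists v, D n.+1 v /\ adjacent (s n) v.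
  by move=> n; have [_ [v Dv vs]] := sP n; exists v; split=> //; exact: adjacentC.
(* [R n k x] asks for a walk of length [k] inside [D n] from [x] to the exit [s n]. The least such
   [k] decreases along the walk until the next level is entered. *)
pose R n := fix R k x := if k is k'.+1 then
  exists y, [/\ D n y, adjacent x y & R k' y] else x = s n.
have RP n x : D n x -> exists k, R n k x.
  move=> Dx; suff : D n `<=` [set x | exists k, R n k x] by exact.
  rewrite /D -(comp_eq (sD n)); apply: comp_ind; first by exists 0%N.
  move=> a b na [k Rk] _ ab; exists k.+1, a; split=> //; last exact: adjacentC.
  by move: na; rewrite (comp_eq (sD n)).
have /choice[d dP] : forall nx : nat * vertex G, exists k, D nx.1 nx.2 ->
    R nx.1 k nx.2 /\ forall j, R nx.1 j nx.2 -> (k <= j)%N.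
  move=> [n x]; have [/RP/(@ex_min_measure _ _ id)[k Rk hk]|nD] := pselect (D n x).
    by exists k.
  by exists 0%N.
have /choice[st stP] : forall nx : nat * vertex G, exists ny : nat * vertex G,
    D nx.1 nx.2 -> [/\ D ny.1 ny.2, adjacent nx.2 ny.2 &
      ny.1 = nx.1.+1 \/ (ny.1 = nx.1 /\ (d ny < d nx)%N)].
  move=> [n x]; have [Dx|nD] := pselect (D n x); last by exists (n, x).
  have [Rd mind] := dP (n, x) Dx; case E : (d (n, x)) Rd => [|k] /=.
    move=> ->; have [? ?] := s'P n; exists (n.+1, s' n) => _; split=> //; by left.
  move=> [y [Dy xy Ry]]; exists (n, y) => _; split=> //; right; split=> //.
  by have [_ /(_ _ Ry)] := dP (n, y) Dy; rewrite ?E ltnS.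
pose W := fun k => iter k st (0%N, z 0%N).
have WD k : D (W k).1 (W k).2.
  by elim: k => [|k /stP[]//]; apply: comp_id (bz 0%N).1.
have WS k := stP _ (WD k).
pose lv k := (W k).1; pose x k := (W k).2.
have lvm k j : (k <= j)%N -> (lv k <= lv j)%N.
  move=> /subnK <-; elim: (j - k)%N => // i IH; rewrite addSn; apply: leq_trans IH _.
  by have [_ _ [E|[E _]]] := WS (i + k)%N; rewrite /lv /= E.
have lvS k : exists2 j, (k <= j)%N & (lv k < lv j)%N.
  have [m] := ubnP (d (W k)); elim: m k => // m IH k dk.
  have [_ _ [E|[E lt]]] := WS k; first by exists k.+1; rewrite // /lv /= E.
  have [|j kj lj] := IH k.+1; first exact: leq_trans lt _.
  by exists j; [exact: ltnW|move: lj; rewrite /lv /= E].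
have lvU n : exists k, (n <= lv k)%N.
  elim: n => [|n [k nk]]; first by exists 0%N.
  by have [j _ lj] := lvS k; exists j; exact: leq_ltn_trans lj.
have lvD n : exists k0, forall k, (k0 <= k)%N -> D n (x k).
  have [k0 h] := lvU n; exists k0 => k k0k.
  exact: (branch_sub YP bz (leq_trans h (lvm _ _ k0k)) (WD k)).
have /choice[l lP] : forall k, exists j, [/\ (k <= j)%N, x j = x k &
    forall i, (j < i)%N -> x i <> x k].
  move=> k; have [n nY] := layer_cap YP (x k); have [k0 hk0] := lvD n.
  have bound i : x i = x k -> (i <= k0)%N.
    move=> xi; rewrite leqNgt; apply/negP => /ltnW/hk0/comp_sub; by rewrite xi.
  have [j [kj xj] hj] := @ex_min_measure _ (fun j => (k <= j)%N /\ x j = x k)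
    (fun j => (k0 - j)%N) (ex_intro _ k (conj (leqnn k) erefl)).
  exists j; split=> // i ji xi; have := hj i (conj (leq_trans kj (ltnW ji)) xi).
  by rewrite leq_sub2lE ?bound // leqNgt ji.
(* Loop erasure: take the next step of the walk, then jump to the last visit of the vertex
   reached. *)
pose q := fix q j := if j is i.+1 then l (q i).+1 else l 0%N.
have lid k : l k = l (l k).
  have [kl xl h] := lP k; have [ll xll _] := lP (l k).
  by apply/eqP; rewrite eqn_leq ll /= leqNgt; apply/negP => /h; rewrite xll xl.
have qS j : (q j < q j.+1)%N by have [] := lP (q j).+1.
have qlt i j : (i < j)%N -> (q i < q j)%N.
  elim: j => // j IH; rewrite ltnS leq_eqVlt => /orP[/eqP -> //|/IH h].
  exact: ltn_trans h (qS j).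
have ql j : q j = l (q j) by case: j => [|j] /=; exact: lid.
have xinj : injective (fun j => x (q j)).
  suff lt i j : (i < j)%N -> x (q j) <> x (q i).
    by move=> i j xij; case: (ltngtP i j) => // /lt; rewrite xij.
  by move=> /qlt; rewrite [X in (X < _)%N]ql; have [_ _] := lP (q i); apply.
have xadj j : adjacent (x (q j)) (x (q j.+1)).
  have [_ -> _] := lP (q j).+1; by have [] := WS (q j).
have qge j : (j <= q j)%N by elim: j => // j IH; exact: leq_ltn_trans IH (qS j).
exists (Ray xinj xadj) => n; have [k0 h] := lvD n; exists k0 => m k0m.
by apply: h; exact: leq_trans k0m (qge m).
Qed.

Lemma branch_end z : branch Y z ->
  exists2 w, ~ dominated w & forall n, end_node n w = node n (z n).
Proof.
move=> bz; have [r hr] := branch_ray bz.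
pose w := @GEnd G [set r' | ray_equiv r r'] (ex_intro _ r erefl).
have wz n r' : end_rays w r' -> tail_in (node n (z n)) r'.
  by move=> rr'; apply: tail_in_equiv (hr n) rr'; exact: node_finite (bz n).1.
have nd : ~ dominated w.
  move=> [v [r' wr' [P iP [Pp Pd]]]]; have [m nY] := layer_cap YP v.
  (* One level more than excludes [v], so that [v] is not a neighbour of the node either. *)
  set D := node m.+1 (z m.+1).
  have nDv : ~ D v by move=> /(node_mono YP (leqnSn m)) /comp_sub.
  have nNv : ~ nbh D v by move=> /(nbh_node YP (bz m.+1).1) /comp_sub.
  have [N hN] := wz m.+1 _ wr'.
  pose F := nbh D `|` [set r' i | i in `I_N].
  have fF : finite_set F.
    rewrite finite_setU; split; first exact: node_finite (bz m.+1).1.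
    exact: finite_image.
  (* Each nontrivial path from [v] to the ray meets the finite set [F] outside [v], and distinct
     paths share no vertex there; [g] recovers the path from such a vertex. *)
  pose g a := xget [::] [set p | P p /\ a \in p].
  apply: iP; apply: (@sub_finite_set _ _ ([::] |` (g @` (F `\ v)))); last first.
    rewrite finite_setU; split; first exact: finite_set1.
    by apply: finite_image; exact: finite_setD.
  move=> p Pp0; have [->|p0] := eqVneq p [::]; first by left.
  have [/andP[wp /andP[vp up]] [i _ ri]] := Pp _ Pp0.
  have lp : last v p \in p.
    by case: p p0 {wp vp up ri Pp0} => //= a p _; exact: mem_last.
  have [a ap Fa] : exists2 a, a \in p & F a.
    have [Ni|iN] := leqP N i; last by exists (last v p) => //; right; exists i.
    have [||a] := @is_walk_cross _ D v p wp; rewrite ?ri //.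
      by rewrite -ri; exact: hN.
    rewrite inE => /orP[/eqP ->//|ap Na]; by exists a => //; left.
  right; exists a; first by split=> // av; move: vp; rewrite -av ap.
  have : [set p | P p /\ a \in p] (g a) by apply: xgetPex; exists p.
  move=> [Pg ag]; apply: contrapT => gp.
  have := Pd _ _ Pg Pp0 gp a; rewrite !inE ag ap !orbT => /(_ isT isT) av.
  by move: vp; rewrite -av ap.
exists w => // n; have [x [Yx -> wx]] := end_nodeP n nd.
have wr : end_rays w r by exact: ray_equiv_refl.
have [a xa za] := tail_in_meet (wx _ wr) (wz n _ wr).
by rewrite -(comp_eq xa) (comp_eq za).
Qed.

End EndNodes.

Local Open Scope ring_scope.

(** * The space DTOP *)

Lemma hausdorff_funsep (R : realType) (T : topologicalType) :
  (forall p q : T, p <> q -> exists2 F : T -> R, continuous F & F p <> F q) ->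
  hausdorff_space T.
Proof.
move=> h p q pq; apply: contrapT => /h[F cF Fpq].
have e0 : 0 < `|F p - F q| / 2 by rewrite divr_gt0 // normr_gt0 subr_eq0; exact/eqP.
have Np : nbhs p [set y | `|F p - F y| < `|F p - F q| / 2].
  by have /cvgrPdist_lt/(_ _ e0) := cF p.
have Nq : nbhs q [set y | `|F q - F y| < `|F p - F q| / 2].
  by have /cvgrPdist_lt/(_ _ e0) := cF q.
have [y [/= yp yq]] := pq _ _ Np Nq.
have : `|F p - F q| <= `|F p - F y| + `|F q - F y|.
  by rewrite (distrC (F q)); exact: ler_distD.
by lra.
Qed.

Lemma compact_set_type (T : topologicalType) (A : set T) :
  compact A -> compact [set: A].
Proof.
move=> cA F FF _; pose H := fmap (@set_val _ A) F.
have HA : H A.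
  rewrite /H /fmap /=; suff -> : set_val @^-1` A = [set: A] by exact: filterT.
  by apply/seteqP; split=> // -[x xA] _; exact: set_mem xA.
have [p [Ap cp]] := cA H _ HA.
exists (exist _ p (mem_set Ap)); split=> // U V FU [_ [[W oW <-] Wp WV]].
have [_ [[u Uu <-] Wu]] : (set_val @` U) `&` W !=set0.
  apply: cp; last exact: open_nbhs_nbhs.
  have : F (set_val @^-1` (set_val @` U)) by apply: filterS FU => u Uu; exists u.
  exact.
by exists u; split=> //; exact: WV.
Qed.

Lemma continuous_bij_homeo (T U : topologicalType) (f : T -> U) (g : U -> T) :
  compact [set: T] -> hausdorff_space U -> continuous f -> cancel f g -> cancel g f ->
  continuous g.
Proof.
move=> cT hU cf fg gf; apply/continuous_closedP => Z cZ.
have -> : g @^-1` Z = f @` Z.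
  by apply/seteqP; split=> [y Zy|_ [x Zx <-]]; [exists (g y)|rewrite /preimage /= fg].
apply: compact_closed => //; apply: continuous_compact; first exact: continuous_subspaceT.
exact: subclosed_compact cZ cT _.
Qed.

(** If no finite sequence worked, the uncovered parts would generate a proper filter. At a cluster
    point [q] they all meet [p q], but the part left uncovered by [[:: q]] does not. *)
Lemma compact_pointwise_cover (T : topologicalType) (K : set T) (p : T -> set T) :
  compact K -> (forall x, K x -> nbhs x (p x)) ->
  exists s : seq T, (forall x, x \in s -> K x) /\ forall y, K y -> exists2 x, x \in s & p x y.
Proof.
move=> cK pK; apply: contrapT => nos.
pose rest (s : seq T) := [set y | K y /\ forall x, x \in s -> ~ p x y].
pose F : set_system T := [set U | exists2 s : seq T, (forall x, x \in s -> K x) &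
  rest s `<=` U].
have FF : ProperFilter F.
  split.
    move=> [s sK s0]; apply: nos; exists s; split=> // y Ky; apply: contrapT => h.
    by apply: (s0 y); split=> // x xs px; apply: h; exists x.
  split.
  - by exists [::].
  - move=> U V [s sK sU] [s' s'K s'V]; exists (s ++ s').
      by move=> x; rewrite mem_cat => /orP[/sK|/s'K].
    move=> y [Ky h]; split; [apply: sU|apply: s'V]; split=> // x xs; apply: h;
      by rewrite mem_cat xs ?orbT.
  - by move=> U V UV [s sK sU]; exists s => //; exact: subset_trans UV.
have [|q [Kq cq]] := cK F FF; first by exists [::] => // y [].
have [y [[_ h] pq]] : rest [:: q] `&` p q !=set0.
  apply: cq; last exact: pK.
  by exists [:: q] => // x; rewrite inE => /eqP ->.
by apply: (h q) => //; rewrite inE.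
Qed.

Lemma ivt_unordered (R : realType) (f : R -> R) (a b v : R) : continuous f ->
  f a < v -> v < f b -> exists c, f c = v.
Proof.
move=> cf cutf fb; have cf' (A : set R) : {within A, continuous f} by exact: continuous_subspaceT.
have [ab|ba] := leP a b.
  have [|c _ <-] := IVT ab (cf' _) (v := v); last by exists c.
  by rewrite ge_min (ltW cutf) le_max (ltW fb) orbT.
have [|c _ <-] := IVT (ltW ba) (cf' _) (v := v); last by exists c.
by rewrite ge_min (ltW cutf) orbT le_max (ltW fb).
Qed.

Lemma ivt_itv (R : realType) (f : R -> R) (a b v : R) :
  {within `[a, b], continuous f} -> a <= b ->
  (f a < v /\ v < f b) \/ (f b < v /\ v < f a) -> exists2 c, a <= c <= b & f c = v.
Proof.
move=> cf ab h; have [|c + <-] := IVT ab cf (v := v); last first.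
  by rewrite in_itv /= => ?; exists c.
by case: h => -[h1 h2]; rewrite ge_min le_max (ltW h1) (ltW h2) ?orbT.
Qed.

Section Points.
Context {R : realType} {G : graph}.
Implicit Types (e f g : edge G) (v : vertex G) (w : gend G) (t s : R) (x y : dtop R G).

Local Notation vtop := (vtop R G).

Lemma vtop_basis_open (U : set vtop) : vtop_basis U -> open U.
Proof. by move=> bU; exists [set U]; [move=> _ ->|rewrite bigcup_set1]. Qed.

Lemma dtop_nbhsP x (U : set (dtop R G)) : nbhs x U <->
  exists2 B : set vtop, vtop_basis B /\ B (val x) & forall y, B (val y) -> U y.
Proof.
split=> [[_ [[W [D DB <-] <-] [B DBB Bx] WU]]|[B [bB Bx] BU]].
  by exists B => [|y By]; [split=> //; exact: DB|apply: WU; exists B].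
exists (set_val @^-1` B); split=> //; first by exists B => //; exact: vtop_basis_open.
Qed.

Definition vp v : dtop R G := exist _ (VPoint v) (mem_set (I : dtop R G (VPoint v))).

Lemma dtop_edge e t : dtop R G (edge_map e t).
Proof. by rewrite /edge_map; case: insub. Qed.

Definition ed e t : dtop R G := exist _ (edge_map e t) (mem_set (dtop_edge e t)).

Definition op w (nd : ~ dominated w) : dtop R G :=
  exist _ (OPoint w) (mem_set (nd : dtop R G (OPoint w))).

Lemma dtop_eq x y : val x = val y -> x = y. Proof. exact: val_inj. Qed.

Lemma ed0 e : ed e 0 = vp (src e).
Proof. by apply: dtop_eq; rewrite /= edge_map0. Qed.

Lemma ed1 e : ed e 1 = vp (tgt e).
Proof. by apply: dtop_eq; rewrite /= edge_map1. Qed.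

Lemma val_ed e t (t01 : 0 < t < 1) : val (ed e t) = EPoint e (exist _ t t01).
Proof. by rewrite /= /edge_map insubT. Qed.

Variant dtop_spec x : Prop :=
  | DtopV v of x = vp v
  | DtopE e t of 0 < t < 1 & x = ed e t
  | DtopO w (nd : ~ dominated w) of x = op nd.

Lemma dtopP x : dtop_spec x.
Proof.
case: x => -[v|e [t t01]|w] xP; have := set_mem xP => /= h.
- by apply: (@DtopV _ v); apply: dtop_eq.
- by apply: (@DtopE _ e t) => //; apply: dtop_eq; rewrite val_ed.
- by apply: (@DtopO _ w h); apply: dtop_eq.
Qed.

Lemma edges_ofP (X : set (dtop R G)) e :
  edges_of X e <-> exists2 t, 0 < t < 1 & X (ed e t).
Proof.
split=> [[x Xx [[t t01] xE]]|[t t01 Xt]].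
  by exists t => //; rewrite (_ : ed e t = x) //; apply: dtop_eq; rewrite xE -val_ed.
by exists (ed e t) => //; exists (exist _ t t01); rewrite val_ed.
Qed.

Lemma ed_continuous e : {within `[0, 1], continuous (ed e)}.
Proof.
move=> t U /dtop_nbhsP[B [bB Bt] BU]; have [_ /(_ e) oB] := vtop_basis_complex bB.
have : nbhs (t : subspace `[0, 1]%classic) (edge_map e @^-1` (B `&` complex_points)).
  apply: open_nbhs_nbhs; split=> //; split=> //=; rewrite /edge_map; by case: insub.
by apply: filterS => s [Bs _]; exact: BU.
Qed.

Lemma edge_compact e : compact (ed e @` `[0, 1]).
Proof. apply: continuous_compact; [exact: ed_continuous|exact: segment_compact]. Qed.

(** Away from ends the topology is that of the 1-complex, so a test on each edge suffices there;
    only undominated ends call for their basic neighbourhoods. *)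
Lemma dtop_continuous (F : vtop -> R) :
  (forall e, exists2 g : R -> R, continuous g &
     forall t, 0 <= t <= 1 -> F (edge_map e t) = g t) ->
  (forall w eps, ~ dominated w -> 0 < eps -> exists S d, finite_set S /\
     forall y : dtop R G, end_nbhd S w d (val y) -> `|F (OPoint w) - F (val y)| < eps) ->
  continuous (fun x : dtop R G => F (val x)).
Proof.
move=> Fe Fw x U /nbhs_ballP[eps /= eps0 epsU]; apply/dtop_nbhsP.
suff [B BP hB] : exists2 B : set vtop, vtop_basis B /\ B (val x) &
    forall y : dtop R G, B (val y) -> `|F (val x) - F (val y)| < eps.
  by exists B => // y /hB h; apply: epsU; rewrite -ball_normE.
have cplx : complex_points (val x) -> exists2 B : set vtop, vtop_basis B /\ B (val x) &
    forall y : dtop R G, B (val y) -> `|F (val x) - F (val y)| < eps.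
  move=> cx; exists [set z | complex_points z /\ `|F (val x) - F z| < eps]; last by move=> y [].
  split; last by split=> //; rewrite subrr normr0.
  left; split=> [w [[]]//|e]; have [g cg gE] := Fe e.
  apply/open_subspaceP; exists [set t | `|F (val x) - g t| < eps].
    apply: (@open_comp _ _ g [set s | `|F (val x) - s| < eps]) => [t _|]; first exact: cg.
    rewrite (_ : [set s | _] = ball (F (val x)) eps); last first.
      by apply/seteqP; split=> s; rewrite -ball_normE.
    exact: ball_open.
  have cE t : complex_points (edge_map (R := R) e t) by rewrite /edge_map; case: insub.
  apply/seteqP; split=> t [h It]; split=> //=.
    by split; [exact: cE|rewrite gE //; move: It; rewrite /= in_itv].
  by move: h => [_]; rewrite gE //; move: It; rewrite /= in_itv.
case: (dtopP x) cplx => [v ->|e t t01 ->|w nd -> _]; first by apply.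
  by apply; rewrite /= /edge_map; case: insub.
have [S [d [fS h]]] := Fw w eps nd eps0.
by exists (end_nbhd S w d) => //; split=> //; right; exists S, w, d.
Qed.

(** Functions living on one edge. With [phi 0 = phi 1 = c] they are continuous, because every end
    has a neighbourhood missing the edge. *)
Definition chi e (phi : R -> R) (c : R) (x : vtop) : R :=
  if x is EPoint f t then (if f == e then phi (val t) else c) else c.

Lemma chi_continuous e (phi : R -> R) (c : R) : continuous phi -> phi 0 = c -> phi 1 = c ->
  continuous (fun x : dtop R G => chi e phi c (val x)).
Proof.
move=> cphi p0 p1; apply: dtop_continuous => [f|w eps nd eps0].
  have [->|fe] := pselect (f = e); last first.
    exists (fun=> c); first by move=> t; exact: cvg_cst.
    by move=> t _; rewrite /edge_map; case: insub => [s|] //=; case: eqP.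
  exists phi => // t t01; have It : `[0, 1]%classic t by rewrite /= in_itv.
  have [->|->|[s <- ->]] := edge_mapP e It.
  - by rewrite edge_map0.
  - by rewrite edge_map1.
  - by rewrite /chi eqxx.
have h2 : 0 < (2^-1 : R) < 1 by rewrite invr_gt0 ltr0n invf_lt1 ?ltr0n ?ltr1n.
have fS : finite_set [set src e; tgt e] by rewrite finite_setU; split; exact: finite_set1.
exists [set src e; tgt e], (fun=> exist (fun t : R => is_true (0 < t < 1)) _ h2); split=> //.
have [[a na CE] _] := end_compP w fS.
have nC u : [set src e; tgt e] u -> ~ end_comp [set src e; tgt e] w u.
  by rewrite CE => Su [p [_ pu hp]]; apply: (hp u) => //; rewrite -pu mem_last.
move=> y; case: (val y) => [v _|f t|w' _] /=; rewrite ?subrr ?normr0 //.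
case: eqP => [->|_]; last by rewrite subrr normr0.
have ns := nC (src e) (or_introl erefl); have nt := nC (tgt e) (or_intror erefl).
by case=> -[].
Qed.

Lemma chi_ed e (phi : R -> R) (c : R) t : phi 0 = c -> phi 1 = c -> 0 <= t <= 1 ->
  chi e phi c (val (ed e t)) = phi t.
Proof.
move=> p0 p1 t01; have It : `[0, 1]%classic t by rewrite /= in_itv.
rewrite /=; have [->|->|[s <- ->]] := edge_mapP e It.
- by rewrite edge_map0.
- by rewrite edge_map1.
- by rewrite /chi eqxx.
Qed.

Lemma chi_other e f phi c t : f <> e -> chi e phi c (val (ed f t)) = c.
Proof. by move=> fe; rewrite /= /edge_map; case: insub => //= s; case: eqP. Qed.

Definition bump e (x : dtop R G) : R := chi e (fun t => t * (1 - t)) 0 (val x).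

Lemma bump_continuous e : continuous (bump e).
Proof.
apply: chi_continuous; rewrite ?mul0r ?subrr ?mulr0 // => t.
by apply: cvgM; [exact: cvg_id|apply: cvgB; [exact: cvg_cst|exact: cvg_id]].
Qed.

Lemma bump_ed e t : 0 <= t <= 1 -> bump e (ed e t) = t * (1 - t).
Proof. by move=> t01; rewrite /bump chi_ed // ?mul0r ?subrr ?mulr0. Qed.

Lemma bump_gt0 e x : 0 < bump e x <-> exists2 t, 0 < t < 1 & x = ed e t.
Proof.
split=> [|[t /andP[t0 t1] ->]]; last by rewrite bump_ed ?(ltW t0) ?(ltW t1) // mulr_gt0 ?subr_gt0.
case: (dtopP x) => [v ->|f t t01 ->|w nd ->]; rewrite /bump ?ltxx //.
have [->|fe] := pselect (f = e); first by exists t.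
by rewrite chi_other // ltxx.
Qed.

Lemma bump_ge0 e x : 0 <= bump e x.
Proof.
rewrite /bump /chi; case: (val x) => [v|f t|w] //; case: eqP => // _.
by have /andP[t0 t1] := valP t; apply: mulr_ge0; rewrite ?subr_ge0 ltW.
Qed.

Lemma ed_inj e f t s : 0 < t < 1 -> 0 < s < 1 -> ed e t = ed f s -> e = f /\ t = s.
Proof. by move=> t01 s01 /(congr1 val); rewrite !val_ed => -[-> ->]. Qed.

Lemma ed_vp e t v : 0 < t < 1 -> ed e t <> vp v.
Proof. by move=> t01 /(congr1 val); rewrite val_ed. Qed.

End Points.

(** * Cut functions of decided sets *)

Section Layered.
Context {R : realType} {G : graph}.
Variable Y : nat -> set (vertex G).
Hypothesis YP : layering Y.
Implicit Types (A B : set (vertex G)) (e f g : edge G) (v : vertex G) (w : gend G)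
  (t s : R) (x y : dtop R G).

Local Notation vtop := (vtop R G).
Local Notation node n x := (comp (Y n) x).

Definition ind (P : Prop) : R := (`[< P >])%:R.

Lemma ind1 (P : Prop) : P -> ind P = 1.
Proof. by move=> p; rewrite /ind asboolT. Qed.

Lemma ind0 (P : Prop) : ~ P -> ind P = 0.
Proof. by move=> p; rewrite /ind asboolF. Qed.

Lemma indP (P : Prop) : (P /\ ind P = 1) \/ (~ P /\ ind P = 0).
Proof. by have [p|p] := pselect P; [left|right]; rewrite ?(ind1 p) ?(ind0 p). Qed.

Lemma ind_iff (P Q : Prop) : (P <-> Q) -> ind P = ind Q.
Proof. by move=> PQ; congr (nat_of_bool _)%:R; exact: asbool_equiv_eq. Qed.

Definition side A w := exists n, end_node Y n w `<=` A.

Lemma end_node_mono n m w : ~ dominated w -> (n <= m)%N ->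
  end_node Y m w `<=` end_node Y n w.
Proof.
move=> nd nm; have [z bz zE] := end_branch YP nd; rewrite !zE; exact: branch_sub.
Qed.

Lemma end_node_ex n w : ~ dominated w -> exists v, end_node Y n w v.
Proof. by move=> nd; have [x [Yx -> _]] := end_nodeP YP n nd; exists x; exact: comp_id. Qed.

Lemma sideP A w : dec Y A -> ~ dominated w -> side A w \/ side (~` A) w.
Proof.
move=> dA nd; have [z bz zE] := end_branch YP nd.
by have [n [h|h]] := dA _ bz; [left|right]; exists n; rewrite zE.
Qed.

Lemma sideI A B w : ~ dominated w -> side A w -> side B w -> side (A `&` B) w.
Proof.
move=> nd [n An] [m Bm]; exists (maxn n m) => v wv; split.
  by apply: An; apply: end_node_mono wv => //; exact: leq_maxl.
by apply: Bm; apply: end_node_mono wv => //; exact: leq_maxr.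
Qed.

Lemma side_sub A B w : A `<=` B -> side A w -> side B w.
Proof. by move=> AB [n h]; exists n; exact: subset_trans AB. Qed.

Lemma sideC A w : dec Y A -> ~ dominated w -> (side (~` A) w <-> ~ side A w).
Proof.
move=> dA nd; split=> [sA sA'|nA]; last by have [] := sideP dA nd.
have [n h] := sideI nd sA sA'; have [v wv] := end_node_ex n nd.
by have [] := h _ wv.
Qed.

Definition fav A (z : vtop) : R :=
  match z with
  | VPoint v => ind (A v)
  | EPoint e t => (1 - val t) * ind (A (src e)) + val t * ind (A (tgt e))
  | OPoint w => ind (side A w)
  end.

Definition cutf A (x : dtop R G) := fav A (val x).

Lemma cutf_vp A v : cutf A (vp v) = ind (A v). Proof. by []. Qed.

Lemma cutf_op A w (nd : ~ dominated w) : cutf A (op nd) = ind (side A w). Proof. by []. Qed.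

Lemma cutf_ed A e t : 0 <= t <= 1 ->
  cutf A (ed e t) = (1 - t) * ind (A (src e)) + t * ind (A (tgt e)).
Proof.
move=> t01; have It : `[0, 1]%classic t by rewrite /= in_itv.
rewrite /cutf /=; have [->|->|[s <- ->]] := edge_mapP e It; rewrite ?edge_map0 ?edge_map1 //=.
  by rewrite subr0 mul1r mul0r addr0.
by rewrite subrr mul0r add0r mul1r.
Qed.

Lemma cutf_continuous A : dec Y A -> continuous (cutf A).
Proof.
move=> dA; apply: dtop_continuous => [e|w eps nd eps0].
  exists (fun t => (1 - t) * ind (A (src e)) + t * ind (A (tgt e))); last first.
    by move=> t t01; rewrite -cutf_ed.
  move=> t; apply: cvgD; apply: cvgM; try exact: cvg_cst; last exact: cvg_id.
  by apply: cvgB; [exact: cvg_cst|exact: cvg_id].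
(* This number is below both [1], as required of a basic neighbourhood, and [eps]. *)
have d01 : 0 < eps / (1 + eps) < 1.
  by rewrite divr_gt0 ?addr_gt0 //= ltr_pdivrMr ?addr_gt0 // mul1r ltrDr.
have deps : eps / (1 + eps) < eps.
  by rewrite ltr_pdivrMr ?addr_gt0 // mulrDr mulr1 ltrDl mulr_gt0.
set c := fav A (OPoint w).
have [n [Kc Kw]] : exists n, (forall v, end_node Y n w v -> ind (A v) = c) /\
    forall w', ~ dominated w' -> end_node Y n w' = end_node Y n w -> ind (side A w') = c.
  rewrite /c /=; have [[n h]|[n h]] := sideP dA nd; exists n; split.
  - by move=> v /h Av; rewrite !ind1 //; exists n.
  - by move=> w' nd' E; rewrite !ind1 //; exists n; rewrite ?E.
  - by move=> v /h nAv; rewrite !ind0 //; apply/sideC => //; exists n.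
  - by move=> w' nd' E; rewrite !ind0 //; apply/sideC => //; exists n; rewrite ?E.
have [x [Yx KE wx]] := end_nodeP YP n nd.
exists (nbh (end_node Y n w)), (fun=> exist (fun t : R => is_true (0 < t < 1)) _ d01).
split; first by rewrite KE; exact: node_finite.
have lt1 (P : Prop) t : 0 <= t -> t < eps / (1 + eps) -> (P /\ ind P = 1) \/ (~ P /\ ind P = 0) ->
    (c = 0 \/ c = 1) -> `|c - ((1 - t) * c + t * ind P)| < eps.
  move=> t0 td iP ic; have te : t < eps by exact: lt_trans deps.
  rewrite ltr_norml; case: iP => -[_ ->]; case: ic => ->; apply/andP; split; lra.
have ic : c = 0 \/ c = 1 by rewrite /c /=; have [[_ ->]|[_ ->]] := indP (side A w); [right|left].
move=> y; rewrite /end_nbhd end_comp_nbh //.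
case yE : (val y) => [v|e t|w'] /=.
- by move=> /Kc ->; rewrite subrr normr0.
- have /andP[t0 t1] := valP t; case=> [[/Kc -> /Kc ->]|[/Kc -> _ td]|[_ /Kc -> td]].
  + by rewrite -mulrDl subrK mul1r subrr normr0.
  + by apply: lt1 => //; [exact: ltW|exact: indP].
  + have t1' : 0 <= 1 - val t by rewrite subr_ge0 ltW.
    by have := lt1 (A (src e)) _ t1' td (indP _) ic; rewrite subKr [val t * c + _]addrC.
- move=> E; have nd' : ~ dominated w' by have := set_mem (valP y); rewrite yE.
  rewrite Kw ?subrr ?normr0 //; have [x' [Yx' K'E w'x']] := end_nodeP YP n nd'.
  have fN : finite_set (nbh (end_node Y n w)) by rewrite KE; exact: node_finite.
  have [_ w'C] := end_compP w' fN; have [r wr] := end_rays_ex w'.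
  have [a Ca Da] := tail_in_meet (w'C _ wr) (w'x' _ wr).
  by move: Ca; rewrite E K'E KE => Ca; rewrite -(comp_eq Da) (comp_eq Ca).
Qed.

Lemma end_node_neq w w' : ~ dominated w -> ~ dominated w' -> w <> w' ->
  exists n, ~ side (end_node Y n w) w'.
Proof.
move=> nd nd' ww'; apply: contrapT => /forallNP h; apply: ww'.
apply: (end_node_inj YP) => // n; have /contrapT[m hm] := h n.
have [x [Yx KE _]] := end_nodeP YP n nd; have [x' [Yx' K'E _]] := end_nodeP YP n nd'.
have [a ha] := end_node_ex (maxn n m) nd'.
have : end_node Y n w' a by apply: end_node_mono ha => //; exact: leq_maxl.
have : end_node Y n w a by apply: hm; apply: end_node_mono ha => //; exact: leq_maxr.
by rewrite KE K'E => xa x'a; rewrite -(comp_eq xa) (comp_eq x'a).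
Qed.

Lemma side_self n w : side (end_node Y n w) w. Proof. by exists n. Qed.

Lemma dec_end_node n w : ~ dominated w -> dec Y (end_node Y n w).
Proof. by move=> nd; have [x [Yx -> _]] := end_nodeP YP n nd; exact: dec_node. Qed.

Lemma dec1 v : dec Y [set v]. Proof. exact: dec_fin YP _ (finite_set1 v). Qed.

Lemma nside1 v w : ~ dominated w -> ~ side [set v] w.
Proof.
move=> nd; apply/sideC => //; first exact: dec1.
have [n nY] := layer_cap YP v; exists n; have [x [Yx -> _]] := end_nodeP YP n nd.
by move=> a /comp_sub Ya /= av; apply: nY; rewrite -av.
Qed.

Definition vertex_or_end x := forall e t, 0 < t < 1 -> x <> ed e t.

Lemma vertex_or_end_sep x y : vertex_or_end x -> vertex_or_end y -> x <> y ->
  exists2 A, dec Y A & cutf A x <> cutf A y.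
Proof.
have n10 : (1 : R) <> 0 by apply/eqP; rewrite oner_eq0.
have n01 := nesym n10.
case: (dtopP x) => [v ->|e t t01 -> /(_ e t t01 erefl)//|w nd ->] _;
case: (dtopP y) => [v' ->|e t t01 -> /(_ e t t01 erefl)//|w' nd' ->] _ neq.
- exists [set v]; first exact: dec1.
  by rewrite !cutf_vp ind1 // ind0 // => /= E; apply: neq; rewrite E.
- exists [set v]; first exact: dec1.
  by rewrite cutf_vp cutf_op ind1 // ind0 //; exact: nside1.
- exists [set v']; first exact: dec1.
  by rewrite cutf_vp cutf_op ind0; [rewrite ind1|exact: nside1].
- have [|n hn] := end_node_neq nd nd'.
    by move=> E; subst w'; apply: neq; congr op; exact: Prop_irrelevance.
  exists (end_node Y n w); first exact: dec_end_node.
  by rewrite !cutf_op ind1 ?ind0 //; exact: side_self.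
Qed.

Lemma cutf01 A x : vertex_or_end x -> cutf A x = 0 \/ cutf A x = 1.
Proof.
move=> h; case: (dtopP x) => [v ->|e t t01 /(h _ _ t01)//|w nd ->].
  by rewrite cutf_vp; have [[_ ->]|[_ ->]] := indP (A v); [right|left].
by rewrite cutf_op; have [[_ ->]|[_ ->]] := indP (side A w); [right|left].
Qed.

Lemma dtop_hausdorff : hausdorff_space (dtop R G).
Proof.
apply: (@hausdorff_funsep R) => x y xy.
have Ecase e t z : 0 < t < 1 -> ed e t <> z ->
    exists2 F : dtop R G -> R, continuous F & F (ed e t) <> F z.
  move=> t01 tz; have /andP[t0 t1] := t01.
  have [bz|bz] := eqVneq (bump e (ed e t)) (bump e z); last first.
    by exists (bump e); [exact: bump_continuous|exact/eqP].
  have : 0 < bump e z by rewrite -bz; apply/bump_gt0; exists t.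
  move=> /bump_gt0[s s01 zE]; have /andP[s0 s1] := s01; subst z.
  move: bz; rewrite !bump_ed ?(ltW t0) ?(ltW t1) ?(ltW s0) ?(ltW s1) // => bz.
  (* The bump agrees at [t] and [1 - t]; the extra factor [u] tells these two points apart. *)
  pose phi (u : R) := u * (u * (1 - u)).
  exists (fun x => chi e phi 0 (val x)).
    apply: chi_continuous; rewrite /phi ?mul0r ?subrr ?mulr0 //.
    move=> u; apply: cvgM; first exact: cvg_id.
    by apply: cvgM; [exact: cvg_id|apply: cvgB; [exact: cvg_cst|exact: cvg_id]].
  rewrite !chi_ed /phi ?mul0r ?subrr ?mulr0 ?(ltW t0) ?(ltW t1) ?(ltW s0) ?(ltW s1) // bz.
  have s10 : s * (1 - s) != 0 by rewrite mulf_neq0 ?gt_eqF ?subr_gt0.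
  by move=> /(mulIf s10) ts; apply: tz; rewrite ts.
have [[e [t [t01 xE]]]|nx] := pselect (exists e t, 0 < t < 1 /\ x = ed e t).
  by rewrite xE in xy *; exact: Ecase.
have [[e [t [t01 yE]]]|ny] := pselect (exists e t, 0 < t < 1 /\ y = ed e t).
  rewrite yE in xy *; have [F cF FE] := Ecase _ _ _ t01 (nesym xy).
  by exists F => //; exact/nesym.
have [|||A dA Axy] := @vertex_or_end_sep x y => //.
- by move=> e t t01 xE; apply: nx; exists e, t.
- by move=> e t t01 yE; apply: ny; exists e, t.
- by exists (cutf A) => //; exact: cutf_continuous.
Qed.

Lemma open_gt_fun (F : dtop R G -> R) c : continuous F -> open [set x | c < F x].
Proof.
move=> cF; apply: (@open_comp _ _ F [set s | c < s]) => [x _|]; first exact: cF.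
exact: open_gt.
Qed.

Lemma open_lt_fun (F : dtop R G -> R) c : continuous F -> open [set x | F x < c].
Proof.
move=> cF; apply: (@open_comp _ _ F [set s | s < c]) => [x _|]; first exact: cF.
exact: open_lt.
Qed.

Lemma closed_le_fun (F : dtop R G -> R) c : continuous F -> closed [set x | F x <= c].
Proof.
move=> cF; rewrite (_ : [set x | _] = ~` [set x | c < F x]).
  by apply: open_closedC; exact: open_gt_fun.
by apply/seteqP; split=> x /=; rewrite leNgt => /negP.
Qed.

(** At each point of [K] the cut function of some node of [w] is below 1. Since the nodes decrease,
    compactness yields one level for all vertices of [K]. *)
Lemma end_node_avoid (K : set (dtop R G)) w (nd : ~ dominated w) : compact K ->
  ~ K (op nd) -> exists n, forall v, end_node Y n w v -> ~ K (vp v).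
Proof.
move=> cK nK; have cn n := cutf_continuous (dec_end_node n nd).
have /choice[m mP] : forall x, exists n, K x -> cutf (end_node Y n w) x < 1.
  move=> x; case: (dtopP x) => [v ->|e t /andP[t0 t1] ->|w' nd' ->].
  - have [n nY] := layer_cap YP v; exists n => _; rewrite cutf_vp ind0 //.
    by have [y [_ -> _]] := end_nodeP YP n nd; move=> /comp_sub.
  - have [n nY] := layer_cap YP (src e); exists n => _; rewrite cutf_ed ?ltW //.
    rewrite ind0; last by have [y [_ -> _]] := end_nodeP YP n nd; move=> /comp_sub.
    by have [[_ ->]|[_ ->]] := indP (end_node Y n w (tgt e)); lra.
  - have [ww'|ww'] := pselect (w = w').
      exists 0%N => Kw'; exfalso; apply: nK; subst w'.
      by rewrite (Prop_irrelevance nd nd').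
    have [n hn] := end_node_neq nd nd' ww'; exists n => _.
    by rewrite cutf_op ind0.
have [|s [sK Ks]] := @compact_pointwise_cover _ K
    (fun x => [set y | cutf (end_node Y (m x) w) y < 1]) cK.
  move=> x Kx; apply: open_nbhs_nbhs; split; last exact: mP.
  by apply: open_lt_fun; exact: cn.
exists (\max_(x <- s) m x)%N => v wv Kv; have [x xs] := Ks _ Kv.
rewrite /= cutf_vp ind1 ?ltxx //; apply: end_node_mono wv => //.
by apply: leq_bigmax_seq.
Qed.

(** Every point of [K1] has an open neighbourhood whose vertices lie in a decided set missing [K2]:
    a singleton, the empty set for an inner point of an edge, or a node for an end. Finitely many of
    these suffice. *)
Lemma compact_separation (K1 K2 : set (dtop R G)) : compact K1 -> compact K2 ->
  K1 `&` K2 = set0 -> exists A, [/\ dec Y A, forall v, K1 (vp v) -> A v &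
    forall v, K2 (vp v) -> ~ A v].
Proof.
move=> cK1 cK2 K12.
have dis x : K1 x -> ~ K2 x by move=> ? ?; have : (K1 `&` K2) x by []; rewrite K12.
have /choice[p pP] : forall x, exists p : set (dtop R G) * set (vertex G), K1 x ->
    [/\ open p.1, p.1 x, dec Y p.2, forall v, p.1 (vp v) -> p.2 v &
      forall v, p.2 v -> ~ K2 (vp v)].
  move=> x; have [K1x|nK1] := pselect (K1 x); last by exists (set0, set0).
  case: (dtopP x) K1x => [v ->|e t t01 ->|w nd ->] K1x.
  - exists ([set x | 0 < cutf [set v] x], [set v]) => _; split=> /=.
    + by apply: open_gt_fun; exact/cutf_continuous/dec1.
    + by rewrite cutf_vp ind1.
    + exact: dec1.
    + by move=> u; rewrite cutf_vp; have [[]|[_ ->]] := indP ([set v] u); rewrite ?ltxx.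
    + by move=> _ ->; exact: dis.
  - exists ([set x | 0 < bump e x], set0) => _; split=> //=.
    + by apply: open_gt_fun; exact: bump_continuous.
    + by apply/bump_gt0; exists t.
    + exact: dec_fin.
    + by move=> v /bump_gt0[s s01 /esym/ed_vp].
  - have [n hn] := end_node_avoid cK2 (dis _ K1x).
    exists ([set x | 0 < cutf (end_node Y n w) x], end_node Y n w) => _; split=> //=.
    + by apply: open_gt_fun; exact/cutf_continuous/dec_end_node.
    + by rewrite cutf_op ind1 //; exact: side_self.
    + exact: dec_end_node.
    + by move=> u; rewrite cutf_vp; have [[]|[_ ->]] := indP (end_node Y n w u); rewrite ?ltxx.
have [|D [DK1 KD]] := @compact_pointwise_cover _ K1 (fun x => (p x).1) cK1.
  by move=> x /pP[oP Px _ _ _]; exact: open_nbhs_nbhs.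
exists (\bigcup_(x in [set` D]) (p x).2); split.
- suff gen (s : seq (dtop R G)) : {in s, forall x, K1 x} ->
      dec Y (\bigcup_(x in [set` s]) (p x).2) by apply: gen.
  elim: s => [|x s IH] sK.
    by rewrite (_ : \bigcup_(x in _) _ = set0);
      [exact: dec_fin|apply/seteqP; split=> // u [x]].
  rewrite (_ : \bigcup_(y in _) _ = (p x).2 `|` \bigcup_(y in [set` s]) (p y).2).
    apply: decU => //; first by have [|] := pP x; first by apply: sK; rewrite inE eqxx.
    by apply: IH => y ys; apply: sK; rewrite inE ys orbT.
  apply/seteqP; split=> [u [y /=]|u [xu|[y ys yu]]].
  + by rewrite inE => /orP[/eqP -> ?|ys yu]; [left|right; exists y].
  + by exists x => //=; rewrite inE eqxx.
  + by exists y => //=; rewrite inE; apply/orP; right.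
- move=> v K1v; have [x xD hx] := KD _ K1v; exists x => //.
  by have [_ _ _ + _] := pP _ (DK1 _ xD); apply.
- move=> v K2v [x xD xv]; by have [_ _ _ _ /(_ _ xv)] := pP _ (DK1 _ xD).
Qed.

End Layered.

(** * Topological cycles are cyclic *)

Section Circle.
Context {R : realType}.
Implicit Types (p q : unit_circle R) (s c : R).

Local Notation cx p := (val p).1.
Local Notation cy p := (val p).2.

Lemma circleP p : cx p ^+ 2 + cy p ^+ 2 = 1.
Proof. exact: set_mem (valP p). Qed.

Definition stw s : R := 2 / (1 + s ^+ 2).

Lemma stw_gt0 s : 0 < stw s.
Proof. by rewrite divr_gt0 // ltr_pwDl // sqr_ge0. Qed.

Lemma stwE s : stw s * (1 + s ^+ 2) = 2.
Proof. by rewrite /stw divfK // gt_eqF // ltr_pwDl // sqr_ge0. Qed.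

(* Stereographic parametrization of the circle minus [p]: the point [(1 - w, s w)] *)
(* with [w = 2 / (1 + s^2)], rotated so that the missing point [(1, 0)] becomes [p]. *)
Definition stv p s : R * R :=
  (cx p * (1 - stw s) - cy p * (s * stw s), cx p * (s * stw s) + cy p * (1 - stw s)).

Lemma stv_circle p s : unit_circle R (stv p s).
Proof.
rewrite /unit_circle /stv /=; have wE := stwE s; have pE := circleP p.
rewrite (_ : _ + _ = (cx p ^+ 2 + cy p ^+ 2) * (1 - 2 * stw s + stw s * (stw s * (1 + s ^+ 2)))).
  by rewrite pE wE; ring.
by ring.
Qed.

Definition st p s : unit_circle R := exist _ (stv p s) (mem_set (stv_circle p s)).

(** Coordinates of [q] after rotating [p] to [(1, 0)]: the real and imaginary parts of [q] times the
    complex conjugate of [p]. *)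
Definition ucoord p q := cx p * cx q + cy p * cy q.
Definition vcoord p q := cx p * cy q - cy p * cx q.

Lemma ucoord_st p s : ucoord p (st p s) = 1 - stw s.
Proof.
rewrite /ucoord /= (_ : _ + _ = (cx p ^+ 2 + cy p ^+ 2) * (1 - stw s)); last by ring.
by rewrite circleP mul1r.
Qed.

Lemma vcoord_st p s : vcoord p (st p s) = s * stw s.
Proof.
rewrite /vcoord /= (_ : _ - _ = (cx p ^+ 2 + cy p ^+ 2) * (s * stw s)); last by ring.
by rewrite circleP mul1r.
Qed.

Lemma coord_eq p q q' : ucoord p q = ucoord p q' -> vcoord p q = vcoord p q' -> q = q'.
Proof.
move=> uE vE; apply: val_inj.
have xE r : cx r = cx p * ucoord p r - cy p * vcoord p r.
  rewrite /ucoord /vcoord (_ : _ - _ = (cx p ^+ 2 + cy p ^+ 2) * cx r); last by ring.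
  by rewrite circleP mul1r.
have yE r : cy r = cx p * vcoord p r + cy p * ucoord p r.
  rewrite /ucoord /vcoord (_ : _ + _ = (cx p ^+ 2 + cy p ^+ 2) * cy r); last by ring.
  by rewrite circleP mul1r.
have := xE q; rewrite uE vE -xE; have := yE q; rewrite uE vE -yE.
by case: (val q) (val q') => [a b] [a' b'] /= -> ->.
Qed.

Lemma coord_circle p q : ucoord p q ^+ 2 + vcoord p q ^+ 2 = 1.
Proof.
rewrite /ucoord /vcoord (_ : _ + _ =
  (cx p ^+ 2 + cy p ^+ 2) * (cx q ^+ 2 + cy q ^+ 2)); last by ring.
by rewrite !circleP mul1r.
Qed.

Lemma coord_self p : ucoord p p = 1 /\ vcoord p p = 0.
Proof.
split; first by rewrite /ucoord -!expr2 circleP.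
by rewrite /vcoord mulrC subrr.
Qed.

Lemma st_neq p s : st p s <> p.
Proof.
move=> E; have := ucoord_st p s; rewrite E (coord_self p).1 => h.
by have := stw_gt0 s; lra.
Qed.

Lemma st_inj p : injective (st p).
Proof.
move=> s s' E; have := ucoord_st p s; rewrite E ucoord_st => uE.
have := vcoord_st p s; rewrite E vcoord_st => vE.
have w0 : stw s != 0 by rewrite gt_eqF // stw_gt0.
have wE : stw s' = stw s by lra.
by apply: (mulIf w0); rewrite -vE wE.
Qed.

Lemma st_surj p q : q <> p -> exists s, st p s = q.
Proof.
move=> qp; have cE := coord_circle p q; set u := ucoord p q in cE; set v := vcoord p q in cE.
have u1 : 1 - u != 0.
  rewrite subr_eq0 eq_sym; apply/eqP => uE; apply: qp; apply: (@coord_eq p).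
    by rewrite (coord_self p).1.
  rewrite (coord_self p).2 -/v; apply/eqP; rewrite -sqrf_eq0; apply/eqP.
  by move: cE; rewrite uE; lra.
have wE : stw (v / (1 - u)) = 1 - u.
  have s0 : 1 + (v / (1 - u)) ^+ 2 != 0 by rewrite gt_eqF // ltr_pwDl // sqr_ge0.
  apply: (mulIf s0); rewrite stwE expr_div_n; apply: (mulIf u1).
  have -> : (1 - u) * (1 + v ^+ 2 / (1 - u) ^+ 2) * (1 - u) = (1 - u) ^+ 2 + v ^+ 2.
    by field.
  have -> : v ^+ 2 = 1 - u ^+ 2 by lra.
  by ring.
exists (v / (1 - u)); apply: (@coord_eq p).
  by rewrite ucoord_st wE -/u; ring.
by rewrite vcoord_st wE -/v divfK.
Qed.

Lemma stw_continuous : continuous stw.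
Proof.
move=> s; apply: cvgM; first exact: cvg_cst.
apply: cvgV; first by rewrite gt_eqF // ltr_pwDl // sqr_ge0.
apply: cvgD; first exact: cvg_cst.
by rewrite expr2; apply: cvgM; exact: cvg_id.
Qed.

Lemma st_continuous p : continuous (st p).
Proof.
apply: continuous_comp_initial => s; have sw := stw_continuous (x := s).
have w1 : 1 - stw s' @[s' --> s] --> 1 - stw s by apply: cvgB => //; exact: cvg_cst.
have w2 : s' * stw s' @[s' --> s] --> s * stw s by apply: cvgM => //; exact: cvg_id.
apply: (@cvg_pair _ _ _ (nbhs s) (nbhs (stv p s).1) (nbhs (stv p s).2) _ _ _
  (fun s' => (stv p s').1) (fun s' => (stv p s').2)); [apply: cvgB|apply: cvgD];
  by apply: cvgM => //; exact: cvg_cst.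
Qed.

Lemma circle_val_continuous : continuous (fun q => val q : R * R).
Proof. exact: initial_continuous. Qed.

Lemma coord_continuous (a b d : R) : continuous (fun q => a * cx q + b * cy q + d).
Proof.
have cF : continuous (fun z : R * R => a * z.1 + b * z.2 + d).
  move=> z; apply: cvgD; last exact: cvg_cst.
  by apply: cvgD; apply: cvgM; try exact: cvg_cst; [exact: cvg_fst|exact: cvg_snd].
by move=> q; have := continuous_comp (@circle_val_continuous q) (cF (val q)).
Qed.

Lemma circle_compact : compact [set: unit_circle R].
Proof.
have c1 : unit_circle R (1, 0) by rewrite /unit_circle /= expr1n expr0n addr0.
have c2 : unit_circle R (-1, 0) by rewrite /unit_circle /= sqrrN expr1n expr0n addr0.
pose p1 : unit_circle R := exist (fun z => z \in unit_circle R) _ (mem_set c1).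
pose p2 : unit_circle R := exist (fun z => z \in unit_circle R) _ (mem_set c2).
have -> : [set: unit_circle R] = (st p1 @` `[-1, 1]) `|` (st p2 @` `[-1, 1]).
  apply/seteqP; split=> // q _.
  (* Parameters between -1 and 1 cover the closed half circle opposite [p]; two opposite points [p]
     thus give the whole circle. *)
  have key p : ucoord p q <= 0 -> (st p @` `[-1, 1]) q.
    move=> u0; have qp : q <> p.
      by move=> E; move: u0; rewrite E (coord_self p).1 ler10.
    have [s sE] := st_surj qp; exists s => //.
    move: u0; rewrite -sE ucoord_st => w1; have := stwE s => wE.
    rewrite /= in_itv /= -ler_norml -(@ler_pXn2r _ 2) ?nnegrE // expr1n real_normK ?num_real //.
    have w0 := stw_gt0 s; rewrite leNgt; apply/negP => s1.
    by clear -w0 w1 wE s1; nra.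
  have [x0|x0] := leP (cx q) 0; [left|right]; apply: key; rewrite /ucoord /=; lra.
by apply: compactU; apply: continuous_compact; try exact: segment_compact;
  apply: continuous_subspaceT; exact: st_continuous.
Qed.

Lemma circle_hausdorff : hausdorff_space (unit_circle R).
Proof.
apply: (@hausdorff_funsep R) => p q pq.
have [E|E] := eqVneq (cx p) (cx q); last first.
  exists (fun q => 1 * cx q + 0 * cy q + 0); first exact: coord_continuous.
  by rewrite !mul1r !mul0r !addr0; exact/eqP.
exists (fun q => 0 * cx q + 1 * cy q + 0); first exact: coord_continuous.
rewrite !mul1r !mul0r !add0r !addr0 => E'; apply: pq; apply: val_inj.
by case: (val p) (val q) E E' => [a b] [a' b'] /= -> ->.
Qed.

(** The chart turns a cycle minus a point into a line, where the intermediate value theorem applies;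
    the compact closed half-lines are the two arcs between [x0] and [h c]. *)
Lemma cycle_param (T : topologicalType) (X : set T) : topological_cycle R X ->
  [/\ compact X, X !=set0 & forall x0, X x0 -> exists h : R -> T,
    [/\ continuous h, (forall s, X (h s) /\ h s <> x0), injective h,
      (forall x, X x -> x <> x0 -> exists s, h s = x) &
      forall c, compact (x0 |` (h @` [set s | s <= c])) /\
        compact (x0 |` (h @` [set s | c <= s]))]].
Proof.
move=> [f [g [fg gf cf cg]]]; pose F q : T := set_val (f q).
have cF : continuous F.
  move=> q; apply: continuous_comp; [exact: cf|exact: initial_continuous].
have FX q : X (F q) by exact: set_mem (valP (f q)).
have Finj : injective F by move=> q q' /val_inj E; rewrite -(fg q) E fg.
have XF x : X x -> exists q, F q = x.
  by move=> Xx; exists (g (exist _ x (mem_set Xx))); rewrite /F gf.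
have cFA (A : set (unit_circle R)) : closed A -> compact (F @` A).
  move=> cA; apply: continuous_compact; first exact: continuous_subspaceT.
  exact: subclosed_compact cA circle_compact _.
have c1 : unit_circle R (1, 0) by rewrite /unit_circle /= expr1n expr0n addr0.
split.
- rewrite (_ : X = F @` setT); first by apply: cFA; exact: closedT.
  by apply/seteqP; split=> [x /XF[q <-]|_ [q _ <-]]; first by exists q.
- by exists (F (exist (fun z => z \in unit_circle R) _ (mem_set c1))).
move=> x0 /XF[p pE]; exists (fun s => F (st p s)); split.
- by move=> s; apply: continuous_comp; [exact: st_continuous|exact: cF].
- by move=> s; split=> //; rewrite -pE => /Finj; exact: st_neq.
- by move=> s s' /Finj; exact: st_inj.
- move=> x /XF[q <-] qx0; have [|s <-] := @st_surj p q; last by exists s.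
  by move=> E; apply: qx0; rewrite E.
(* An affine function that vanishes at [p] and has the sign of [s - c] at [st p s]; its two closed
   half-planes cut out the arcs. *)
move=> c; pose l q := vcoord p q - c * (1 - ucoord p q).
have lst s : l (st p s) = (s - c) * stw s by rewrite /l ucoord_st vcoord_st; ring.
have lp : l p = 0 by rewrite /l (coord_self p).1 (coord_self p).2; ring.
have cl : continuous l.
  have -> : l = fun q => ((c * cx p - cy p) * cx q + (cx p + c * cy p) * cy q) + - c.
    by apply/funext => q; rewrite /l /ucoord /vcoord; ring.
  exact: coord_continuous.
have w0 := stw_gt0.
have clo (A : set R) : closed A -> closed (l @^-1` A).
  by move=> cA; move/continuous_closedP: cl; apply.
split.
  rewrite (_ : _ |` _ = F @` (l @^-1` [set y | y <= 0])).
    by apply: cFA; apply: clo; exact: closed_le.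
  apply/seteqP; split.
    move=> _ [->|[s sc <-]]; first by exists p => //=; rewrite lp.
    by exists (st p s) => //=; rewrite lst pmulr_lle0 ?subr_le0.
  move=> _ [q lq <-]; have [->|/eqP qp] := eqVneq q p; first by left.
  have [s sE] := st_surj qp; right; exists s; last by rewrite sE.
  by move: lq; rewrite -sE /= lst pmulr_lle0 ?subr_le0.
rewrite (_ : _ |` _ = F @` (l @^-1` [set y | 0 <= y])).
  by apply: cFA; apply: clo; exact: closed_ge.
apply/seteqP; split.
  move=> _ [->|[s sc <-]]; first by exists p => //=; rewrite lp.
  by exists (st p s) => //=; rewrite lst pmulr_lge0 ?subr_ge0.
move=> _ [q lq <-]; have [->|/eqP qp] := eqVneq q p; first by left.
have [s sE] := st_surj qp; right; exists s; last by rewrite sE.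
by move: lq; rewrite -sE /= lst pmulr_lge0 ?subr_ge0.
Qed.

End Circle.

Ltac real_cvg := repeat first [exact: cvg_id | exact: cvg_cst
  | apply: cvgB | apply: cvgD | apply: cvgM].

Lemma extremal3 (R : realType) (t1 t2 t3 : R) :
  (t1 < t2 /\ t1 < t3) \/ (t2 < t1 /\ t3 < t1) ->
  (t2 < t1 /\ t2 < t3) \/ (t1 < t2 /\ t3 < t2) ->
  (t3 < t1 /\ t3 < t2) \/ (t1 < t3 /\ t2 < t3) -> False.
Proof. lra. Qed.

Lemma opposite3 (R : realType) (t1 t2 t3 m : R) :
  (t1 < m /\ m < t2) \/ (t2 < m /\ m < t1) ->
  (t1 < m /\ m < t3) \/ (t3 < m /\ m < t1) ->
  (t2 < m /\ m < t3) \/ (t3 < m /\ m < t2) -> False.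
Proof. lra. Qed.

(** * The edge set of a topological cycle *)

Section CycleEdges.
Context {R : realType} {G : graph}.
Variable Y : nat -> set (vertex G).
Hypothesis YP : layering Y.
Variable X : set (dtop R G).
Hypothesis tX : topological_cycle R X.
Implicit Types (A B : set (vertex G)) (e f g : edge G) (v : vertex G) (w : gend G)
  (t s : R) (x y : dtop R G).

Let cutf := @cutf R G Y.
Let half : R := 2^-1.
Let half01 : 0 < half < 1. Proof. by rewrite /half; apply/andP; split; lra. Qed.

Let X0 : X !=set0. Proof. by have [] := cycle_param tX. Qed.
Let par x0 (Xx0 : X x0) : exists h : R -> dtop R G,
    [/\ continuous h, (forall s, X (h s) /\ h s <> x0), injective h,
      (forall x, X x -> x <> x0 -> exists s, h s = x) &
      forall c, compact (x0 |` (h @` [set s | s <= c])) /\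
        compact (x0 |` (h @` [set s | c <= s]))].
Proof. by have [_ _ h] := cycle_param tX; exact: h. Qed.

Let closedX : closed X.
Proof. by apply: compact_closed (dtop_hausdorff YP) _; have [] := cycle_param tX. Qed.

Let third a b : exists y, [/\ X y, y <> a & y <> b].
Proof.
have [x1 /par[h [_ hX hinj _ _]]] := X0; apply: contrapT => no.
have ab s : h s = a \/ h s = b.
  by apply: contrapT => /not_orP[? ?]; apply: no; exists (h s); split=> //; case: (hX s).
have n01 : h 0 <> h 1 by move=> /hinj; lra.
have n02 : h 0 <> h 2 by move=> /hinj; lra.
have n12 : h 1 <> h 2 by move=> /hinj; lra.
by case: (ab 0) (ab 1) (ab 2) n01 n02 n12 => -> [] -> [] ->.
Qed.

(** A circle minus a point is connected. Taking for [x0] a known crossing therefore yields a second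
    one. *)
Let cross (F : dtop R G -> R) c x0 a b : continuous F -> X x0 -> X a -> X b ->
  a <> x0 -> b <> x0 -> F a < c -> c < F b -> exists y, [/\ X y, y <> x0 & F y = c].
Proof.
move=> cF Xx0 Xa Xb ax bx Fa Fb; have [h [ch hX _ hs _]] := par Xx0.
have [sa ha] := hs _ Xa ax; have [sb hb] := hs _ Xb bx.
have cFh : continuous (F \o h) by move=> s; apply: continuous_comp; [exact: ch|exact: cF].
have [||s hc] := @ivt_unordered R (F \o h) sa sb c cFh; rewrite /= ?ha ?hb //.
by exists (h s); have [] := hX s.
Qed.

Let itv_sign e (l u : R) : 0 < l -> l < u -> u < 1 -> exists F : dtop R G -> R,
  [/\ continuous F, (forall x, 0 < F x <-> exists2 t, l < t < u & x = ed e t) &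
    forall x, F x = 0 <-> x = ed e l \/ x = ed e u].
Proof.
(* The quadratic factor has different values at 0 and 1 in general; the positive affine factor [k]
   makes both equal to [c], as [chi_continuous] demands. *)
move=> l0 lu u1; pose k t := (1 - t) * ((1 - l) * (1 - u)) + t * (l * u).
pose phi t := (t - l) * (u - t) * k t; pose c := - (l * u * ((1 - l) * (1 - u))).
have p0 : phi 0 = c by rewrite /phi /k /c; ring.
have p1 : phi 1 = c by rewrite /phi /k /c; ring.
have c0 : c < 0 by rewrite oppr_lt0; do ?apply: mulr_gt0; lra.
have k0 t : 0 <= t <= 1 -> 0 < k t.
  move=> /andP[t0 t1]; have h1 : 0 < (1 - l) * (1 - u) by apply: mulr_gt0; lra.
  have h2 : 0 < l * u by apply: mulr_gt0; lra.
  have [th|th] := leP t 2^-1.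
    by apply: ltr_pwDl; [apply: mulr_gt0 => //; lra|apply: mulr_ge0 => //; exact: ltW].
  by apply: ltr_wpDl; [apply: mulr_ge0; [lra|exact: ltW]|apply: mulr_gt0 => //; lra].
have lu01 t : l <= t <= u -> 0 < t < 1.
  by move=> /andP[? ?]; apply/andP; split; lra.
have W t : 0 < t < 1 -> 0 <= t <= 1 by move=> /andP[? ?]; apply/andP; split; lra.
have sgn t : 0 < t < 1 -> (0 < phi t <-> l < t < u) /\ (phi t = 0 <-> t = l \/ t = u).
  move=> /W/k0 kt; rewrite /phi pmulr_lgt0 //; split.
    split=> [h|/andP[? ?]]; last by apply: mulr_gt0; lra.
    by apply/andP; split; rewrite ltNge; apply/negP => ?; nra.
  split=> [/eqP|[->|->]]; last 2 first.
  - by rewrite subrr !mul0r.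
  - by rewrite subrr mulr0 mul0r.
  by rewrite mulf_eq0 (gt_eqF kt) orbF mulf_eq0 !subr_eq0 => /orP[/eqP|/eqP]; [left|right].
exists (fun x => chi e phi c (val x)); split.
- by apply: chi_continuous => // t; rewrite /phi /k; real_cvg.
- move=> x; split=> [|[t /[dup] tlu /andP[lt tu] ->]]; last first.
    have t01 : 0 < t < 1 by apply: lu01; rewrite !ltW.
    by rewrite chi_ed ?W //; apply/(sgn t t01).1.
  case: (dtopP x) => [v ->|f t t01 ->|w nd ->]; try by move=> /(lt_trans c0); rewrite ltxx.
  have [->|fe] := pselect (f = e); last by rewrite chi_other // => /(lt_trans c0); rewrite ltxx.
  by rewrite chi_ed ?W // => /(sgn t t01).1; exists t.
- move=> x; split=> [|[->|->]]; last 2 first.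
  + have l01 : 0 < l < 1 by apply: lu01; rewrite lexx ltW.
    by rewrite chi_ed ?W //; apply/(sgn l l01).2; left.
  + have u01 : 0 < u < 1 by apply: lu01; rewrite lexx ltW.
    by rewrite chi_ed ?W //; apply/(sgn u u01).2; right.
  have cn : c <> 0 by move=> cE; rewrite cE ltxx in c0.
  case: (dtopP x) => [v ->|f t t01 ->|w nd ->] //.
  have [->|fe] := pselect (f = e); last by rewrite chi_other.
  by rewrite chi_ed ?W // => /(sgn t t01).2[] ->; [left|right].
Qed.

Let in_edge e x := exists2 t, 0 < t < 1 & x = ed e t.

(** Otherwise no point of [X] would lie between two others on the edge, because removing it leaves
    [X] connected; three points contradict this. *)
Let not_sub_edge e : ~ (forall x, X x -> in_edge e x).
Proof.
move=> sub; pose J t := 0 < t < 1 /\ X (ed e t).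
have ext b : J b -> (forall t, J t -> t <> b -> b < t) \/ (forall t, J t -> t <> b -> t < b).
  move=> [b01 Xb]; apply: contrapT => /not_orP[/existsNP[a /not_implyP[[a01 Xa]
    /not_implyP[ab /negP lea]]] /existsNP[c /not_implyP[[c01 Xc] /not_implyP[cb /negP lec]]]].
  have la : a < b by rewrite lt_neqAle (introN eqP ab) leNgt.
  have lc : b < c by rewrite lt_neqAle eq_sym (introN eqP cb) leNgt.
  pose phi t := (t - b) * (t * (1 - t)).
  have p0 : phi 0 = 0 by rewrite /phi; ring.
  have p1 : phi 1 = 0 by rewrite /phi; ring.
  have W t : 0 < t < 1 -> 0 <= t <= 1 by move=> /andP[? ?]; apply/andP; split; lra.
  have pos t : 0 < t < 1 -> 0 < t * (1 - t) by move=> /andP[? ?]; apply: mulr_gt0; lra.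
  have cF : continuous (fun x : dtop R G => chi e phi 0 (val x)).
    by apply: chi_continuous => // t; rewrite /phi; real_cvg.
  have [||||y [Xy yb]] := cross (c := 0) cF Xb Xa Xc.
  - by move=> /(ed_inj a01 b01)[].
  - by move=> /(ed_inj c01 b01)[].
  - by rewrite chi_ed ?W // /phi nmulr_rlt0 ?pos // subr_lt0.
  - by rewrite chi_ed ?W // /phi mulr_gt0 ?pos // subr_gt0.
  have [t t01 yE] := sub _ Xy; rewrite yE chi_ed ?W // /phi => /eqP.
  rewrite mulf_eq0 (gt_eqF (pos _ t01)) orbF subr_eq0 => /eqP tb.
  by apply: yb; rewrite yE tb.
have [x1 Xx1] := X0; have [x2 [Xx2 x21 _]] := third x1 x1.
have [x3 [Xx3 x31 x32]] := third x1 x2.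
have [t1 t1P E1] := sub _ Xx1; have [t2 t2P E2] := sub _ Xx2; have [t3 t3P E3] := sub _ Xx3.
subst x1 x2 x3; have J1 : J t1 by []; have J2 : J t2 by []; have J3 : J t3 by [].
have n12 : t1 <> t2 by move=> E; apply: x21; rewrite E.
have n13 : t1 <> t3 by move=> E; apply: x31; rewrite E.
have n23 : t2 <> t3 by move=> E; apply: x32; rewrite E.
case: (ext _ J1) => h1; case: (ext _ J2) => h2; case: (ext _ J3) => h3;
have := h1 _ J2 (nesym n12); have := h1 _ J3 (nesym n13);
have := h2 _ J1 n12; have := h2 _ J3 (nesym n23);
have := h3 _ J1 n13; have := h3 _ J2 n23; move=> *; apply: (@extremal3 R t1 t2 t3); tauto.
Qed.

(** The function of [itv_sign] changes sign on [X], between [ed e t] and a point off the open edge.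
    Removing a zero that lies in [X] still leaves a crossing, so both [ed e l] and [ed e u] must be
    in [X]. *)
Let gap e (l u : R) : 0 < l -> l < u -> u < 1 -> ~ (X (ed e l) /\ X (ed e u)) ->
  forall t, l < t < u -> ~ X (ed e t).
Proof.
move=> l0 lu u1 nlu t tlu Xt; have [F [cF Fpos F0]] := itv_sign e l0 lu u1.
apply: (@not_sub_edge e) => b Xb; apply: contrapT => nb.
have inE (s : R) : l <= s <= u -> 0 < s < 1 by move=> /andP[? ?]; apply/andP; split; lra.
have Fb : F b < 0.
  rewrite lt_neqAle; apply/andP; split.
    apply/eqP => /F0[bE|bE]; apply: nb; [exists l|exists u] => //; apply: inE; rewrite lexx ltW//.
  rewrite leNgt; apply/negP => /Fpos[s /andP[? ?] bE]; apply: nb; exists s => //.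
  by apply: inE; rewrite !ltW.
have Ft : 0 < F (ed e t) by apply/Fpos; exists t.
have zero y : X y -> F y = 0 -> (X (ed e l) /\ y = ed e l) \/ (X (ed e u) /\ y = ed e u).
  by move=> Xy /F0[E|E]; [left|right]; rewrite -E.
have neq z : F z = 0 -> ed e t <> z /\ b <> z.
  by move=> Fz; split=> E; [move: Ft|move: Fb]; rewrite E Fz ltxx.
have main x0 : X x0 -> F x0 = 0 \/ (x0 <> b /\ x0 <> ed e t) ->
    exists y, [/\ X y, y <> x0 & F y = 0].
  move=> Xx0 h; have [n1 n2] : ed e t <> x0 /\ b <> x0.
    by case: h => [/neq|[/nesym ? /nesym ?]].
  exact: (cross cF Xx0 Xb Xt).
have Fl : F (ed e l) = 0 by apply/F0; left.
have Fu : F (ed e u) = 0 by apply/F0; right.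
have [Xl|nXl] := pselect (X (ed e l)).
  have [|y [Xy yl /(zero _ Xy)[[_ //]|[Xu _]]]] := main _ Xl; first by left.
  by apply: nlu.
have [Xu|nXu] := pselect (X (ed e u)).
  by have [|y [Xy yu /(zero _ Xy)[[//]|[_ //]]]] := main _ Xu; first by left.
have [x0 [Xx0 xb xt]] := third b (ed e t).
by have [|y [Xy _ /(zero _ Xy)[[//]|[//]]]] := main _ Xx0; first by right.
Qed.

(** If the parameter [m] is missed, [gap] leaves at most one parameter of [X] on either side of [m].
    But near an inner point of the edge the cycle has at least three points on it. *)
Let whole_edge e : edges_of X e -> forall t, 0 < t < 1 -> X (ed e t).
Proof.
move=> /edges_ofP[s s01 Xs] m m01; apply: contrapT => nXm.
pose J t := 0 < t < 1 /\ X (ed e t).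
have below t t' : J t -> J t' -> t < t' -> t' < m -> False.
  move=> [/andP[t0 _] Xt] [_ Xt'] tt' t'm; have /andP[_ m1] := m01.
  by apply: (@gap e t m t0 (lt_trans tt' t'm) m1 _ t') => //; [case|rewrite tt'].
have above t t' : J t -> J t' -> m < t -> t < t' -> False.
  move=> [_ Xt] [/andP[_ t'1] Xt'] mt tt'; have /andP[m0 _] := m01.
  by apply: (@gap e m t' m0 (lt_trans mt tt') t'1 _ t) => //; [case|rewrite mt].
have [x0 [Xx0 x0s _]] := third (ed e s) (ed e s).
have [h [ch hX hinj hs _]] := par Xx0; have [c hc] := hs _ Xs (nesym x0s).
have cb : continuous (bump e \o h).
  by move=> t; apply: continuous_comp; [exact: ch|exact: bump_continuous].
have b0 : 0 < bump e (h c) by rewrite hc; apply/bump_gt0; exists s.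
have [d d0 hd] : exists2 d, 0 < d & forall t, `|c - t| < d -> 0 < bump e (h t).
  have /cvgrPdist_lt/(_ _ b0) := cb c; move=> /nbhs_ballP[d /= d0 hd]; exists d => // t ct.
  have := hd t; rewrite -ball_normE /= => /(_ ct); rewrite ltr_norml => /andP[_].
  by rewrite /= ltrBlDr ltrDl.
have pt (j : R) : 0 <= j < 1 -> exists2 t, J t & ed e t = h (c + j * d).
  move=> /andP[j0 j1]; have [|t t01 tE] := (@bump_gt0 R G e (h (c + j * d))).1.
    have jd : 0 <= j * d by apply: mulr_ge0 => //; exact: ltW.
    by apply: hd; rewrite opprD addrA subrr sub0r normrN ger0_norm // gtr_pMl.
  by exists t => //; split=> //; rewrite -tE; have [] := hX (c + j * d).
have [|t1 J1 E1] := pt 0; first by apply/andP; split; lra.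
have [|t2 J2 E2] := pt (1/2); first by apply/andP; split; lra.
have [|t3 J3 E3] := pt (1/4); first by apply/andP; split; lra.
have diff (i j t t' : R) : i <> j -> ed e t = h (c + i * d) -> ed e t' = h (c + j * d) -> t <> t'.
  move=> ij Et Et' tt'; apply: ij; move: Et; rewrite tt' Et' => /hinj /addrI.
  by move=> /(mulIf (lt0r_neq0 d0)).
have n12 : t1 <> t2 by apply: diff E1 E2; lra.
have n13 : t1 <> t3 by apply: diff E1 E3; lra.
have n23 : t2 <> t3 by apply: diff E2 E3; lra.
have nm t : J t -> t <> m by move=> [_ Xt] tm; apply: nXm; rewrite -tm.
have two t t' : J t -> J t' -> t <> t' -> (t < m /\ m < t') \/ (t' < m /\ m < t).
  move=> Jt Jt' tt'; have := nm _ Jt; have := nm _ Jt'.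
  move=> /eqP n1 /eqP n2; have [tm|mt] : t < m \/ m < t.
    by apply/orP; rewrite -neq_lt.
  - have [t'm|mt'] : t' < m \/ m < t' by apply/orP; rewrite -neq_lt.
      have [h'|h'] : t < t' \/ t' < t by apply/orP; rewrite -neq_lt; exact/eqP.
        by case: (below _ _ Jt Jt' h' t'm).
      by case: (below _ _ Jt' Jt h' tm).
    by left.
  - have [t'm|mt'] : t' < m \/ m < t' by apply/orP; rewrite -neq_lt.
      by right.
    have [h'|h'] : t < t' \/ t' < t by apply/orP; rewrite -neq_lt; exact/eqP.
      by case: (above _ _ Jt Jt' mt h').
    by case: (above _ _ Jt' Jt mt' h').
exact: (opposite3 (two _ _ J1 J2 n12) (two _ _ J1 J3 n13) (two _ _ J2 J3 n23)).
Qed.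

Let edge_closed e t : edges_of X e -> 0 <= t <= 1 -> X (ed e t).
Proof.
move=> /whole_edge we /andP[t0 t1]; apply: contrapT => nXt.
have It : `[0, 1]%classic t by rewrite /= in_itv /= t0.
have := ed_continuous (x := (t : subspace `[0, 1]%classic)) => cE.
have : nbhs (ed e t) (~` X) by apply: open_nbhs_nbhs; split=> //; exact: (closed_openC closedX).
move=> /cE; rewrite /nbhs /= -nbhs_subspace_in //.
move=> /nbhs_ballP[d /= d0 hd].
have [s [s01 sd]] : exists s, 0 < s < 1 /\ `|t - s| < d.
  pose dd := Num.min d (1/2); have dd0 : 0 < dd by rewrite lt_min d0 /=; lra.
  have ddd : dd <= d by rewrite ge_min lexx.
  have dd1 : dd <= 1 / 2 by rewrite ge_min lexx orbT.
  have [th|th] := leP t (1/2); [exists (t + dd/2)|exists (t - dd/2)].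
    split; first by apply/andP; split; lra.
    by rewrite opprD addrA subrr sub0r normrN gtr0_norm; lra.
  split; first by apply/andP; split; lra.
  by rewrite opprB addrCA subrr addr0 gtr0_norm; lra.
have := hd s; rewrite -ball_normE /= => /(_ sd); apply; last exact: we.
by rewrite in_itv /= !ltW //; have /andP[] := s01.
Qed.

(** Without edges, every cut function would be 0 or 1 on [X], while one that distinguishes two
    points of [X] also takes the value 1/2. *)
Let edge_ex : exists e, edges_of X e.
Proof.
apply: contrapT => no; have [x1 Xx1] := X0; have [x2 [Xx2 x21 _]] := third x1 x1.
have noE x : X x -> forall e t, 0 < t < 1 -> x = ed e t -> False.
  by move=> Xx e t t01 xE; apply: no; exists e; apply/edges_ofP; exists t; rewrite -?xE.
have [A dA Aneq] : exists2 A, dec Y A & cutf A x1 <> cutf A x2.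
  apply: (vertex_or_end_sep YP); [exact: noE|exact: noE|exact/nesym].
have [x0 [Xx0 x01 x02]] := third x1 x2.
have key a b : X a -> X b -> x0 <> a -> x0 <> b -> cutf A a = 0 -> cutf A b = 1 -> False.
  move=> Xa Xb xa xb Fa Fb.
  have [||y [Xy _ Fy]] := cross (c := half) (cutf_continuous YP dA) Xx0 Xa Xb (nesym xa) (nesym xb).
  - by rewrite -/cutf Fa; case/andP: half01.
  - by rewrite -/cutf Fb; case/andP: half01.
  have /andP[h0 h1] := half01.
  by case: (cutf01 Y A (noE _ Xy)); rewrite /cutf Fy => E; move: h0 h1; rewrite E ltxx.
have := cutf01 Y A (noE _ Xx1); have := cutf01 Y A (noE _ Xx2).
case=> E2 [] E1; try by case: Aneq; rewrite /cutf E1 E2.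
  exact: key Xx2 Xx1 x02 x01 E2 E1.
exact: key Xx1 Xx2 x01 x02 E1 E2.
Qed.

(** With the midpoint of [e] removed, the cut function still takes the value [half] between the
    endvertices of [e]. This can happen only inside an edge separated by [A], and on [e] only at the
    midpoint. *)
Let cyclic1 A e : dec Y A -> edges_of X e -> sep A e ->
  exists f, [/\ edges_of X f, f <> e & sep A f].
Proof.
move=> dA Ce sA; apply: contrapT => no; pose x0 := ed e half.
have Xx0 : X x0 by apply: whole_edge.
have Xs : X (vp (src e)) by rewrite -ed0; apply: edge_closed; rewrite ?lexx ?ler01.
have Xt : X (vp (tgt e)) by rewrite -ed1; apply: edge_closed; rewrite ?lexx ?ler01.
have nv v : vp v <> x0 by apply/nesym; exact: ed_vp.
have /andP[h0 h1] := half01.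
have [y [Xy yx0 Fy]] : exists y, [/\ X y, y <> x0 & cutf A y = half].
  have cross' a b := @cross (cutf A) half x0 (vp a) (vp b) (cutf_continuous YP dA) Xx0.
  have [As|nAs] := pselect (A (src e)); have [At|nAt] := pselect (A (tgt e));
    try by case: sA; tauto.
    by apply: (cross' (tgt e) (src e)) => //; rewrite /cutf cutf_vp; [rewrite (ind0 nAt)|rewrite (ind1 As)].
  by apply: (cross' (src e) (tgt e)) => //; rewrite /cutf cutf_vp; [rewrite (ind0 nAs)|rewrite (ind1 At)].
have : forall f t, 0 < t < 1 -> y = ed f t -> False.
  move=> f t t01 yE; have Cf : edges_of X f by apply/edges_ofP; exists t; rewrite -?yE.
  have /andP[t0 t1] := t01; have W : 0 <= t <= 1 by rewrite !ltW.
  move: Fy; rewrite /cutf yE cutf_ed //; have [fe|fe] := pselect (f = e).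
    subst f; move: sA; rewrite /sep.
    have [[As ->]|[As ->]] := indP (R := R) (A (src e));
    have [[At ->]|[At ->]] := indP (R := R) (A (tgt e)); rewrite ?mulr1 ?mulr0 ?addr0 ?add0r => sA E;
      try by case: sA; tauto.
      by apply: yx0; rewrite yE /x0; congr ed; move: E; rewrite /half; lra.
    by apply: yx0; rewrite yE /x0 E.
  have nsf : ~ sep A f by move=> sf; apply: no; exists f.
  rewrite (ind_iff (contrapT nsf)) -mulrDl subrK mul1r.
  by have [[_ ->]|[_ ->]] := indP (R := R) (A (tgt f)) => E; move: h0 h1; rewrite -E ltxx.
rewrite /cutf in Fy; move=> /(cutf01 Y A)[E|E]; rewrite Fy in E; move: h0 h1; by rewrite E ltxx.
Qed.

(** The midpoints of [e] and [f] cut [X] into two compact arcs, disjoint off these open edges, whose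
    vertices are separated by a decided set. Every other edge stays in one arc, the two halves of
    [f] lie in different arcs, and [e] follows by [cyclic1]. *)
Let cyclic2 e f : edges_of X e -> edges_of X f -> e <> f -> exists2 A, dec Y A &
  forall g, edges_of X g -> (sep A g <-> g = e \/ g = f).
Proof.
move=> Ce Cf ef; pose x0 := ed e half; pose y0 := ed f half.
have Xx0 : X x0 by apply: whole_edge.
have Xy0 : X y0 by apply: whole_edge.
have xy0 : y0 <> x0 by move=> /(ed_inj half01 half01)[/esym].
have [h [ch hX hinj hs hK]] := par Xx0; have [c hc] := hs _ Xy0 xy0.
have [cL cR] := hK c; set L := _ |` _ in cL; set Rr := _ |` _ in cR.
have LR x : X x -> L x \/ Rr x.
  move=> Xx; have [->|/eqP xx0] := eqVneq x x0; first by left; left.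
  have [s <-] := hs _ Xx xx0; have [sc|cs] := leP s c; first by left; right; exists s.
  by right; right; exists s => //; exact: ltW.
have LRI x : L x -> Rr x -> x = x0 \/ x = y0.
  move=> [->|[s sc <-]]; first by left.
  move=> [E|[s' cs' /hinj E]]; first by have [_ /(_ E)] := hX s.
  by right; rewrite -hc; congr h; apply: le_anti; rewrite sc /= -E.
have clL : closed L by exact: compact_closed (dtop_hausdorff YP) cL.
have clR : closed Rr by exact: compact_closed (dtop_hausdorff YP) cR.
have split g (I : interval R) : edges_of X g -> [set` I] `<=` `[0, 1] ->
    (forall t, [set` I] t -> ed g t <> x0 /\ ed g t <> y0) ->
    (forall t, [set` I] t -> L (ed g t)) \/ (forall t, [set` I] t -> Rr (ed g t)).
  move=> Cg I01 avoid.
  have Xg t : [set` I] t -> X (ed g t).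
    by move=> /I01; rewrite /= in_itv /= => t01; exact: edge_closed.
  have conE : connected (ed g @` [set` I]).
    apply: connected_continuous_connected.
      by apply/connected_intervalP; exact: interval_is_interval.
    exact: continuous_subspaceW I01 (ed_continuous (e := g)).
  have dis t : [set` I] t -> L (ed g t) -> Rr (ed g t) -> False.
    by move=> It Lt Rt; have [n1 n2] := avoid _ It; case: (LRI _ Lt Rt).
  have [[t It Lt]|nL] := pselect (exists2 t, [set` I] t & L (ed g t)); last first.
    right=> t It; have [Lt|//] := LR _ (Xg _ It).
    by case: nL; exists t.
  left=> u Iu; suff E : (ed g @` [set` I]) `&` L = ed g @` [set` I].
    have : ((ed g @` [set` I]) `&` L) (ed g u) by rewrite E; exists u.
    by case.
  apply: conE.
  - by exists (ed g t); split=> //; exists t.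
  - exists (~` Rr); first exact: closed_openC.
    apply/seteqP; split=> x [[s Is <-] h']; split; try by exists s.
      by move=> Rs; exact: dis Is h' Rs.
    by have [//|/h'] := LR _ (Xg _ Is).
  - by exists L.
pose K1 := (L `&` [set x | bump e x <= 0]) `&` [set x | bump f x <= 0].
pose K2 := (Rr `&` [set x | bump e x <= 0]) `&` [set x | bump f x <= 0].
have cb g : closed [set x | bump (R := R) g x <= 0].
  by apply: closed_le_fun; exact: bump_continuous.
have cK1 : compact K1 by do 2!apply: compact_closedI => //.
have cK2 : compact K2 by do 2!apply: compact_closedI => //.
have bh g : 0 < bump g (ed g half) by apply/bump_gt0; exists half.
have K12 : K1 `&` K2 = set0.
  apply/seteqP; split=> // x [[[Lx /= ex] fx] [[Rx _] _]].
  case: (LRI _ Lx Rx) => xE; move: ex fx; rewrite /= xE => ex fx.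
    by have := bh e; rewrite ltNge ex.
  by have := bh f; rewrite ltNge fx.
have [A [dA A1 A2]] := compact_separation YP cK1 cK2 K12.
have bv g v : bump (R := R) g (vp v) <= 0 by rewrite leNgt; apply/negP => /bump_gt0[t t01 /esym/ed_vp].
have AL v : L (vp v) -> A v.
  by move=> Lv; apply: A1; split; [split|]; [exact: Lv|exact: bv|exact: bv].
have AR v : Rr (vp v) -> ~ A v.
  by move=> Rv; apply: A2; split; [split|]; [exact: Rv|exact: bv|exact: bv].
have W t : 0 < t < 1 -> 0 <= t <= 1 by move=> /andP[? ?]; rewrite !ltW.
have others g : edges_of X g -> g <> e -> g <> f -> ~ sep A g.
  move=> Cg ge gf; have avoid t : [set` `[0, 1]%R] t -> ed g t <> x0 /\ ed g t <> y0.
    rewrite /= in_itv /= => /andP[]; rewrite le_eqVlt => /orP[/eqP <-|t0].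
      by rewrite ed0; split; apply/nesym; exact: ed_vp.
    rewrite le_eqVlt => /orP[/eqP ->|t1]; first by rewrite ed1; split; apply/nesym; exact: ed_vp.
    have t01 : 0 < t < 1 by rewrite t0.
    by split=> /(ed_inj t01 half01)[].
  have i0 : [set` `[(0 : R), 1]] 0 by rewrite /= in_itv /= lexx ler01.
  have i1 : [set` `[(0 : R), 1]] 1 by rewrite /= in_itv /= lexx ler01.
  have [//|hL|hR] := split g `[0, 1] Cg _ avoid.
    by have := hL _ i0; have := hL _ i1; rewrite ed0 ed1 /sep => /AL ? /AL ?; tauto.
  by have := hR _ i0; have := hR _ i1; rewrite ed0 ed1 /sep => /AR ? /AR ?; tauto.
have avoidf t : 0 <= t <= 1 -> t <> half -> ed f t <> x0 /\ ed f t <> y0.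
  move=> /andP[]; rewrite le_eqVlt => /orP[/eqP <-|t0].
    by rewrite ed0 => *; split; apply/nesym; exact: ed_vp.
  rewrite le_eqVlt => /orP[/eqP ->|t1]; first by rewrite ed1 => *; split; apply/nesym; exact: ed_vp.
  have t01 : 0 < t < 1 by rewrite t0.
  by move=> th; split=> /(ed_inj t01 half01)[] // /esym.
have /andP[h0 h1] := half01.
have near : exists2 d, 0 < d & forall s, `|c - s| < d -> 0 < bump f (h s).
  have cbh : continuous (bump f \o h).
    by move=> t; apply: continuous_comp; [exact: ch|exact: bump_continuous].
  have b0 : 0 < bump f (h c) by rewrite hc; exact: bh.
  have /cvgrPdist_lt/(_ _ b0)/nbhs_ballP[d /= d0 hd] := cbh c; exists d => // t ct.
  have := hd t; rewrite -ball_normE /= => /(_ ct); rewrite ltr_norml => /andP[_].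
  by rewrite /= ltrBlDr ltrDl.
have [d d0 hd] := near.
have at_d (s : R) : `|c - s| < d -> s <> c ->
    exists t, [/\ 0 < t < 1, t <> half & h s = ed f t].
  move=> /hd /bump_gt0[t t01 tE] sc; exists t; split=> // th; apply: sc.
  by apply: hinj; rewrite tE th hc.
have sf : sep A f.
  have hl : (forall t, 0 <= t < half -> L (ed f t)) \/ (forall t, 0 <= t < half -> Rr (ed f t)).
    have [||hl|hl] := split f `[0, half[ Cf; last 2 first.
    - by left=> t ti; apply: hl; rewrite /= in_itv.
    - by right=> t ti; apply: hl; rewrite /= in_itv.
    - by move=> t; rewrite /= !in_itv /= => /andP[-> /ltW th]; exact: le_trans th (ltW h1).
    - move=> t; rewrite /= in_itv /= => /andP[t0 th]; apply: avoidf.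
        by rewrite t0 /=; exact: le_trans (ltW th) (ltW h1).
      by move=> E; rewrite E ltxx in th.
  have hr : (forall t, half < t <= 1 -> L (ed f t)) \/ (forall t, half < t <= 1 -> Rr (ed f t)).
    have [||hr|hr] := split f `]half, 1] Cf; last 2 first.
    - by left=> t ti; apply: hr; rewrite /= in_itv.
    - by right=> t ti; apply: hr; rewrite /= in_itv.
    - by move=> t; rewrite /= !in_itv /= => /andP[/ltW th ->]; rewrite (le_trans (ltW h0) th).
    - move=> t; rewrite /= in_itv /= => /andP[ht t1]; apply: avoidf.
        by rewrite t1 (le_trans (ltW h0) (ltW ht)).
      by move=> E; rewrite E ltxx in ht.
  (* If both halves of [f] lay in one arc, that arc would contain points of [h] on both sides of
     [c]. *)
  have both (Q : set (dtop R G)) : (forall t, 0 <= t < half -> Q (ed f t)) ->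
      (forall t, half < t <= 1 -> Q (ed f t)) -> Q (h (c + d / 2)) /\ Q (h (c - d / 2)).
    move=> Q1 Q2; have Qt t : 0 < t < 1 -> t <> half -> Q (ed f t).
      move=> /andP[t0 t1] th; case: (ltgtP t half) => // ht; [apply: Q1|apply: Q2].
        by rewrite ltW.
      by rewrite ht ltW.
    have d2 : 0 < d / 2 by rewrite divr_gt0.
    have dd : d / 2 < d by rewrite ltr_pdivrMr // mulr_natr mulr2n ltrDl.
    split.
      have [||t [t01 th ->]] := at_d (c + d / 2); last exact: Qt.
        by rewrite opprD addrA subrr sub0r normrN gtr0_norm.
      by move=> /eqP; rewrite -subr_eq0 addrAC subrr add0r gt_eqF.
    have [||t [t01 th ->]] := at_d (c - d / 2); last exact: Qt.
      by rewrite opprB addrCA subrr addr0 gtr0_norm.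
    by move=> /eqP; rewrite -subr_eq0 addrAC subrr sub0r oppr_eq0 gt_eqF.
  have d2 : 0 < d / 2 by rewrite divr_gt0.
  have s0 : 0 <= (0 : R) < half by rewrite lexx.
  have s1 : half < 1 <= (1 : R) by rewrite lexx andbT.
  case: hl hr => hl [] hr.
  - have [+ _] := both _ hl hr; case=> [E|[s sc /hinj E]]; first by have [] := hX (c + d / 2).
    by move: sc; rewrite /= E gerDl leNgt d2.
  - have := hl _ s0; have := hr _ s1; rewrite ed0 ed1 /sep => /AR ? /AL ?; tauto.
  - have := hl _ s0; have := hr _ s1; rewrite ed0 ed1 /sep => /AL ? /AR ?; tauto.
  - have [_ +] := both _ hl hr; case=> [E|[s sc /hinj E]]; first by have [] := hX (c - d / 2).
    by move: sc; rewrite /= E lerBrDr gerDl leNgt d2.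
have only g : edges_of X g -> sep A g -> g = e \/ g = f.
  by move=> Cg sg; apply: contrapT => /not_orP[? ?]; exact: others sg.
exists A => // g Cg; split; first exact: only.
move=> [->|->] //; have [k [Ck kf sk]] := cyclic1 dA Cf sf.
by have [<-|] := only _ Ck sk.
Qed.

Lemma cycle_cyclic : cyclic Y (edges_of X).
Proof. by split; [exact: edge_ex|exact: cyclic1|exact: cyclic2]. Qed.

End CycleEdges.

(** * Cyclic sets are topological cycles *)

Section WeightedSum.
Context {R : realType} {T : topologicalType}.
Variable a : nat -> T -> R.
Hypothesis a_cont : forall k, continuous (a k).
Hypothesis a01 : forall k x, 0 <= a k x <= 1.
Implicit Types (x y : T) (n k : nat).

Let q k : R := (2^-1) ^+ k.
Let q0 k : 0 < q k. Proof. by rewrite exprn_gt0 // invr_gt0. Qed.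
Let qS k : q k.+1 + q k.+1 = q k.
Proof. by rewrite /q exprS; field. Qed.

Fixpoint psum n x : R := if n is k.+1 then psum k x + q k.+1 * a k x else 0.

(** The sum of a series with geometric weights; the partial sums increase, so that their supremum is
    the limit. *)
Definition wsum x := sup [set psum n x | n in setT].

Let psum_cont n : continuous (psum n).
Proof.
elim: n => [|n IH] x /=; first exact: cvg_cst.
by apply: cvgD; [exact: IH|apply: cvgM; [exact: cvg_cst|exact: a_cont]].
Qed.

Let psumS n x : psum n x <= psum n.+1 x.
Proof.
by rewrite /= lerDl; apply: mulr_ge0; [exact/ltW/q0|case/andP: (a01 n x)].
Qed.

Let psum_mono n m x : (n <= m)%N -> psum n x <= psum m x.
Proof.
move=> /subnK <-; elim: (m - n)%N => // k IH; rewrite addSn.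
exact: le_trans IH (psumS _ _).
Qed.

Let psum_tail n m x : psum (n + m) x + q (n + m) <= psum n x + q n.
Proof.
elim: m => [|m IH]; first by rewrite addn0.
apply: le_trans IH; rewrite addnS /= -(qS (n + m)) addrA lerD2r lerD2l.
by rewrite ger_pMr //; case/andP: (a01 (n + m) x).
Qed.

Let psum_le n m x : psum m x <= psum n x + q n.
Proof.
have [nm|mn] := leqP n m.
  have := psum_tail n (m - n) x; rewrite subnKC // => h.
  by apply: le_trans h; rewrite lerDl ltW.
by apply: le_trans (psum_mono x (ltnW mn)) _; rewrite lerDl ltW.
Qed.

Let wsum_sup x : has_sup [set psum n x | n in setT].
Proof.
split; first by exists 0, 0%N.
by exists (psum 0 x + q 0) => _ [m _ <-]; exact: psum_le.
Qed.

Let wsum_ge n x : psum n x <= wsum x.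
Proof. by apply: sup_upper_bound => //; exists n. Qed.

Let wsum_le n x : wsum x <= psum n x + q n.
Proof.
apply: ge_sup; first by exists 0, 0%N.
by move=> _ [m _ <-]; exact: psum_le.
Qed.

Lemma wsum_continuous : continuous wsum.
Proof.
move=> x; apply/cvgrPdist_lt => eps eps0.
have e2 : 0 < eps / 2 by rewrite divr_gt0.
have [n qn] : exists n, q n < eps / 2.
  have := near_infty_natSinv_expn_lt (PosNum e2) => -[n _ /(_ n (leqnn n))] /= h.
  by exists n; rewrite /q exprVn -div1r.
have /cvgrPdist_lt/(_ _ e2) := @psum_cont n x; apply: filterS => y.
have := wsum_ge n x; have := wsum_ge n y; have := wsum_le n x; have := wsum_le n y.
by rewrite !ltr_norml => *; apply/andP; split; lra.
Qed.

Lemma wsum_ge0 x : 0 <= wsum x. Proof. exact: (wsum_ge 0). Qed.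

Lemma wsum_mono x y : (forall k, a k x <= a k y) -> wsum x <= wsum y.
Proof.
move=> h; apply: ge_sup; first by exists 0, 0%N.
move=> _ [n _ <-]; apply: le_trans (wsum_ge n y).
by elim: n => //= n IH; rewrite lerD // ler_pM2l.
Qed.

Lemma wsum_lt x y k : (forall k, a k x <= a k y) -> a k x < a k y -> wsum x < wsum y.
Proof.
(* The gain [d] at index [k] persists in all later partial sums and hence in the supremum. *)
move=> h hk; pose d := q k.+1 * (a k y - a k x).
have d0 : 0 < d by rewrite mulr_gt0 // subr_gt0.
have gap n : (k < n)%N -> psum n x + d <= psum n y.
  elim: n => // n IH; rewrite ltnS leq_eqVlt => /orP[/eqP <-|/IH hn] /=.
    have : psum k x <= psum k y.
      by elim: {hk d d0 IH}k => //= k IH; rewrite lerD // ler_pM2l.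
    by rewrite /d; lra.
  by rewrite addrAC lerD // ler_pM2l.
suff : wsum x + d <= wsum y by lra.
rewrite -lerBrDr; apply: ge_sup; first by exists 0, 0%N.
move=> _ [n _ <-]; rewrite lerBrDr.
apply: le_trans (wsum_ge (maxn n k.+1) y); apply: le_trans (gap _ (leq_maxr n k.+1)).
by rewrite lerD2r; apply: psum_mono; exact: leq_maxl.
Qed.

Lemma wsum_scale x y t : 0 <= t -> (forall k, a k y = t * a k x) -> wsum y = t * wsum x.
Proof.
move=> t0 h; have pE n : psum n y = t * psum n x.
  by elim: n => [|n IH] /=; rewrite ?mulr0 // IH h; ring.
have le1 : wsum y <= t * wsum x.
  apply: ge_sup; first by exists 0, 0%N.
  by move=> _ [n _ <-]; rewrite pE ler_wpM2l.
apply/le_anti; rewrite le1 /=.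
have [->|tn0] := eqVneq t 0; first by rewrite mul0r wsum_ge0.
have tp : 0 < t by rewrite lt_neqAle eq_sym tn0.
rewrite mulrC -ler_pdivlMr //; apply: ge_sup; first by exists 0, 0%N.
by move=> _ [n _ <-]; rewrite ler_pdivlMr // mulrC -pE.
Qed.

End WeightedSum.

(** A continuous bijection from a compact space onto the Hausdorff circle is a homeomorphism. *)
Lemma circle_homeo (R : realType) (T : topologicalType) (X : set T) (F1 F2 : T -> R) :
  compact X -> continuous F1 -> continuous F2 ->
  (forall x, X x -> F1 x ^+ 2 + F2 x ^+ 2 = 1) ->
  (forall x y, X x -> X y -> F1 x = F1 y -> F2 x = F2 y -> x = y) ->
  (forall u v : R, u ^+ 2 + v ^+ 2 = 1 -> exists x, [/\ X x, F1 x = u & F2 x = v]) ->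
  topological_cycle R X.
Proof.
move=> cX c1 c2 FX Finj Fsurj.
have XP (x : X) : X (val x) by exact: set_mem (valP x).
have FP (x : X) : unit_circle R (F1 (val x), F2 (val x)) by apply: FX.
pose F (x : X) : unit_circle R := exist (fun z => z \in unit_circle R) _ (mem_set (FP x)).
have cP : continuous (fun x : T => (F1 x, F2 x)).
  move=> x; apply: (@cvg_pair _ _ _ (nbhs x) (nbhs (F1 x)) (nbhs (F2 x)));
    [exact: c1|exact: c2].
have cF : continuous F.
  apply: continuous_comp_initial => x.
  have := continuous_comp (@initial_continuous _ _ (@set_val _ X) x) (cP (set_val x)).
  exact.
have /choice[f fP] : forall p : unit_circle R, exists x : X, F x = p.
  move=> p; have [x [Xx xu xv]] := Fsurj _ _ (circleP p).
  exists (exist (fun z => z \in X) x (mem_set Xx)); apply: val_inj => /=.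
  by rewrite xu xv -surjective_pairing.
have Fi : injective F.
  move=> x y /(congr1 val) /= [E1 E2]; apply: val_inj; apply: Finj => //; exact: XP.
have Ff : cancel F f by move=> x; apply: Fi; rewrite fP.
exists f, F; split=> //.
apply: (@continuous_bij_homeo _ _ F) => //; [exact: compact_set_type|exact: circle_hausdorff].
Qed.

Lemma ultra_or (T : Type) (F : set_system T) (A B : set T) : UltraFilter F ->
  F (A `|` B) -> F A \/ F B.
Proof.
move=> uF FAB; have [|FC] := in_ultra_setVsetC A uF; first by left.
by right; apply: filterS (filterI FAB FC) => x [[]].
Qed.

Lemma ultra_finite (T : Type) (I : eqType) (F : set_system T) (s : seq I)
    (A : I -> set T) (B : set T) : UltraFilter F ->
  F (B `|` \bigcup_(i in [set` s]) A i) -> F B \/ exists2 i, i \in s & F (A i).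
Proof.
move=> uF; elim: s => [|i s IH] h.
  by left; apply: filterS h => x [//|[]].
have : F (A i `|` (B `|` \bigcup_(j in [set` s]) A j)).
  apply: filterS h => x [Bx|[j /=]]; first by right; left.
  by rewrite inE => /orP[/eqP -> ?|js jx]; [left|right; right; exists j].
move=> /(ultra_or uF)[Fi|/IH[|[j js Fj]]].
- by right; exists i => //; rewrite inE eqxx.
- by left.
- by right; exists j => //; rewrite inE js orbT.
Qed.

Section CircleCoordinates.
Context {R : realType}.
Implicit Types (u v t : R).

Lemma affine_continuous (T : topologicalType) (p : T -> R) W : continuous p ->
  continuous (fun x => 2 * (p x / W) - 1).
Proof.
move=> cp x; apply: cvgB; last exact: cvg_cst.
by apply: cvgM; [exact: cvg_cst|apply: cvgM; [exact: cp|exact: cvg_cst]].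
Qed.

Lemma arc_continuous (T : topologicalType) (p q : T -> R) W : continuous p -> continuous q ->
  continuous (fun x => 2 * Num.sqrt (p x / W * (1 - p x / W)) - 4 * Num.sqrt (q x)).
Proof.
move=> cp cq.
have cpW : continuous (fun x => p x / W) by move=> x; apply: cvgM; [exact: cp|exact: cvg_cst].
have cm : continuous (fun x => p x / W * (1 - p x / W)).
  by move=> x; apply: cvgM; [exact: cpW|apply: cvgB; [exact: cvg_cst|exact: cpW]].
move=> x; apply: cvgB; apply: cvgM; try exact: cvg_cst.
  exact: (continuous_comp (cm x) (@sqrt_continuous R _)).
exact: (continuous_comp (cq x) (@sqrt_continuous R _)).
Qed.

Lemma circle_half u v : u ^+ 2 + v ^+ 2 = 1 ->
  [/\ 0 <= (1 + u) / 2, (1 + u) / 2 <= 1 &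
    2 * Num.sqrt ((1 + u) / 2 * (1 - (1 + u) / 2)) = `|v|].
Proof.
move=> uv; split; [nra|nra|].
have -> : (1 + u) / 2 * (1 - (1 + u) / 2) = (v / 2) ^+ 2.
  rewrite exprMn.
  have -> : v ^+ 2 = 1 - u ^+ 2 by rewrite -uv addrC addKr.
  by field.
by rewrite sqrtr_sqr normf_div [X in _ / X]ger0_norm // mulrC mulfVK.
Qed.

Lemma circle_lower u v : u ^+ 2 + v ^+ 2 = 1 -> v < 0 -> 0 < (1 + u) / 2 < 1.
Proof. by move=> uv v0; apply/andP; split; nra. Qed.

Lemma arcs_apart u v : 2 * u = - (2 * v) -> 0 < v -> 0 <= u -> False.
Proof. lra. Qed.

(* The double-angle parametrization [(2 a^2 - 1, 2 a sqrt(1 - a^2))] of the      *)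
(* circle, with [a = 1 - 2 t].                                                   *)
Definition loop_x t : R := 1 - 8 * (t * (1 - t)).
Definition loop_y t : R := 4 * (1 - 2 * t) * Num.sqrt (t * (1 - t)).

Let quad_continuous : continuous (fun t : R => t * (1 - t)).
Proof.
by move=> t; apply: cvgM; [exact: cvg_id|apply: cvgB; [exact: cvg_cst|exact: cvg_id]].
Qed.

Lemma loop_x_continuous : continuous loop_x.
Proof.
move=> t; apply: cvgB; first exact: cvg_cst.
by apply: cvgM; [exact: cvg_cst|exact: quad_continuous].
Qed.

Lemma loop_y_continuous : continuous loop_y.
Proof.
move=> t; apply: cvgM.
  apply: cvgM; first exact: cvg_cst.
  by apply: cvgB; [exact: cvg_cst|apply: cvgM; [exact: cvg_cst|exact: cvg_id]].
exact: (continuous_comp (quad_continuous (x := t)) (@sqrt_continuous R _)).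
Qed.

Lemma loop_circle t : 0 <= t <= 1 -> loop_x t ^+ 2 + loop_y t ^+ 2 = 1.
Proof.
move=> /andP[t0 t1]; rewrite /loop_x /loop_y exprMn sqr_sqrtr; first by ring.
by rewrite mulr_ge0 ?subr_ge0.
Qed.

Lemma loop_inj t u : 0 <= t < 1 -> 0 <= u < 1 -> loop_x t = loop_x u -> loop_y t = loop_y u ->
  t = u.
Proof.
move=> /andP[t0 t1] /andP[u0 u1]; rewrite /loop_x /loop_y => Ex.
have -> : t * (1 - t) = u * (1 - u) by lra.
have [u00|uN0] := eqVneq u 0.
  have : t * (1 - t) = 0 by move: Ex; rewrite u00; lra.
  by move=> /eqP; rewrite mulf_eq0 subr_eq0 (gt_eqF t1) orbF => /eqP ->; rewrite u00.
have up : 0 < u by rewrite lt_neqAle eq_sym uN0.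
have s0 : Num.sqrt (u * (1 - u)) != 0 by rewrite gt_eqF // sqrtr_gt0 mulr_gt0 ?subr_gt0.
by move=> /(mulIf s0); lra.
Qed.

Lemma loop_surj u v : u ^+ 2 + v ^+ 2 = 1 ->
  exists t, [/\ 0 <= t <= 1, loop_x t = u & loop_y t = v].
Proof.
move=> uv; have [h0 h1 _] := circle_half uv.
(* [r] is the absolute value of the cosine of half the angle and [c] the sign of [v]; their product
   is the parameter [a] of the double-angle formula. *)
pose r := Num.sqrt ((1 + u) / 2); pose c : R := if 0 <= v then 1 else -1.
have r0 : 0 <= r by exact: sqrtr_ge0.
have r2 : r * r = (1 + u) / 2 by rewrite -expr2 sqr_sqrtr.
have r1 : r <= 1 by nra.
have cc : c * c = 1 by rewrite /c; case: ifP => _; ring.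
have c1 : c = 1 \/ c = -1 by rewrite /c; case: ifP => _; [left|right].
have cv : c * `|v| = v.
  rewrite /c; have [v0|v0] := leP 0 v; first by rewrite mul1r ger0_norm.
  by rewrite ltr0_norm // mulN1r opprK.
have q : (1 - c * r) / 2 * (1 - (1 - c * r) / 2) = (1 - u) / 8.
  transitivity ((1 - (c * c) * (r * r)) / 4); first by field.
  by rewrite cc r2; field.
exists ((1 - c * r) / 2); split.
- by case: c1 => ->; apply/andP; split; lra.
- by rewrite /loop_x q; field.
rewrite /loop_y q (_ : 1 - 2 * ((1 - c * r) / 2) = c * r); last by field.
rewrite -[RHS]cv (_ : 4 * (c * r) * _ = c * (4 * (r * Num.sqrt ((1 - u) / 8)))); last by ring.
rewrite -sqrtrM //; congr (c * _).
have -> : (1 + u) / 2 * ((1 - u) / 8) = (v / 4) ^+ 2.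
  rewrite exprMn; have -> : v ^+ 2 = 1 - u ^+ 2 by rewrite -uv addrC addKr.
  by field.
by rewrite sqrtr_sqr normf_div [X in _ / X]ger0_norm // mulrC mulfVK.
Qed.

End CircleCoordinates.

(** * The circle carried by a cyclic set *)

Section CyclicCycle.
Context {R : realType} {G : graph}.
Variable Y : nat -> set (vertex G).
Hypothesis YP : layering Y.
Variable C : set (edge G).
Hypothesis cC : cyclic Y C.
Implicit Types (A B Z : set (vertex G)) (e f g h k : edge G) (v : vertex G) (w : gend G)
  (t s : R) (x y : dtop R G).

Local Notation node n x := (comp (Y n) x).
Let cutf := @cutf R G Y.

(** Meant as the closure of the union of the edges in [C]: an undominated end belongs to it if [C]
    reaches all of its nodes. *)
Definition cycle_points : set (dtop R G) := [set x | match val x with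
  | VPoint v => exists2 g, C g & v = src g \/ v = tgt g
  | EPoint g _ => C g
  | OPoint w => forall n, exists2 g, C g & touch (end_node Y n w) g
  end].

Let X := cycle_points.

Let X_vp v : X (vp v) <-> exists2 g, C g & v = src g \/ v = tgt g.
Proof. by []. Qed.

Let X_ed g t : 0 < t < 1 -> (X (ed g t) <-> C g).
Proof. by move=> t01; rewrite /X /cycle_points /mkset (val_ed g t01). Qed.

Let X_op w (nd : ~ dominated w) :
  X (op nd) <-> forall n, exists2 g, C g & touch (end_node Y n w) g.
Proof. by []. Qed.

Let X_edge g t : C g -> 0 <= t <= 1 -> X (ed g t).
Proof.
move=> Cg /andP[]; rewrite le_eqVlt => /orP[/eqP <- _|t0].
  by rewrite ed0; apply/X_vp; exists g => //; left.
rewrite le_eqVlt => /orP[/eqP ->|t1].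
  by rewrite ed1; apply/X_vp; exists g => //; right.
by apply/X_ed; rewrite ?t0.
Qed.

Let edges_of_X : edges_of X = C.
Proof.
apply/seteqP; split=> g; first by move=> /edges_ofP[t t01 /X_ed]; exact.
by move=> Cg; apply/edges_ofP; exists 2^-1; [apply/andP; split; lra|apply/X_ed => //; apply/andP; split; lra].
Qed.

Let cutf_ed1 A g t : 0 < t < 1 -> cutf A (ed g t) = 1 <-> A (src g) /\ A (tgt g).
Proof.
move=> /andP[t0 t1]; rewrite /cutf cutf_ed ?ltW //.
have [[As ->]|[As ->]] := indP (R := R) (A (src g));
have [[At ->]|[At ->]] := indP (R := R) (A (tgt g)); split; try (by case); try (by split);
  try lra.
Qed.

Let cutf_vp1 A v : cutf A (vp v) = 1 <-> A v.
Proof.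
rewrite /cutf cutf_vp; have [[Av ->]|[Av ->]] := indP (R := R) (A v); split=> //; lra.
Qed.

Let cutf_op1 A w (nd : ~ dominated w) : cutf A (op nd) = 1 <-> side Y A w.
Proof.
rewrite /cutf cutf_op; have [[Av ->]|[Av ->]] := indP (R := R) (side Y A w); split=> //; lra.
Qed.

Let touch_node_edge n v g : touch (node n.+1 v) g -> forall t, 0 < t < 1 ->
  cutf (node n v) (ed g t) = 1.
Proof. by move=> /(touch_inside YP) xg t t01; apply/cutf_ed1. Qed.

(** Thinness is used at level [n.+1], since an edge touching a node there has both endvertices in
    one node of level [n]. *)
Let X_cover n : exists es (S : set (vertex G)), [/\ finite_set es, es `<=` C, finite_set S,
  S `<=` Y n & forall x, X x -> (exists2 g, es g & (ed g @` `[0, 1]) x) \/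
    exists2 z, S z & cutf (node n z) x = 1].
Proof.
have [es [S [fes fS SY thC]]] := cyclic_thin YP n.+1 cC.
exists (es `&` C), S; split=> //.
- exact: finite_setIl.
- by move=> z /SY; apply: layer_mono YP _ _ (leqnSn n) z.
move=> x; case: (dtopP x) => [v ->|g t t01 ->|w nd ->].
- move=> /X_vp[g Cg vg]; have [eg|[z Sz zg]] := thC _ Cg.
    left; exists g => //; case: vg => ->; [exists 0|exists 1];
      by rewrite ?ed0 ?ed1 //= in_itv /= lexx ler01.
  by right; exists z => //; apply/cutf_vp1; have [? ?] := touch_inside YP zg; case: vg => ->.
- move=> /(X_ed _ t01) Cg; have [eg|[z Sz zg]] := thC _ Cg.
    by left; exists g => //; exists t => //; rewrite /= in_itv /=; case/andP: t01 => *; rewrite !ltW.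
  by right; exists z => //; exact: touch_node_edge.
- move=> /X_op Xw; right.
  (* A deep node of [w] touches none of the finitely many edges [es], so an edge of [C] reaching it
     has to touch a node from [S]. *)
  have [m hm] : exists m, forall g, es g -> ~ touch (end_node Y m w) g.
    apply: finite_uniform => //.
      move=> i j g ij ni gj; apply: ni; apply: touch_sub gj; exact: (end_node_mono YP nd ij).
    move=> g _; have [|m hm] := @layer_fin _ _ YP [set src g; tgt g].
      by rewrite finite_setU; split; exact: finite_set1.
    exists m; have [z [Yz -> _]] := end_nodeP YP m nd.
    by case=> /comp_sub; apply: hm; [left|right].
  have [g Cg wg] := Xw (maxn m n.+1).
  have wgm : touch (end_node Y m w) g.
    by apply: touch_sub wg; exact: (end_node_mono YP nd (leq_maxl _ _)).
  have wgn : touch (end_node Y n.+1 w) g.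
    by apply: touch_sub wg; exact: (end_node_mono YP nd (leq_maxr _ _)).
  have [/hm/(_ wgm)//|[z Sz zg]] := thC _ Cg; exists z => //; apply/cutf_op1.
  exists n.+1; move: wgn; have [z' [Yz' -> _]] := end_nodeP YP n.+1 nd => wgn.
  rewrite -(touch_same zg wgn); exact: node_mono YP _ _ _ (leqnSn n).
Qed.

(** An ultrafilter on [X] that contains no closed edge of [C] selects one node at each level by
    [X_cover]. Selected nodes intersect, hence form a branch, and the ultrafilter converges to its
    end. *)
Let X_compact : compact X.
Proof.
rewrite compact_ultra => F uF FX.
have [[g Cg Fg]|nE] := pselect (exists2 g, C g & F (ed g @` `[0, 1])).
  have := @edge_compact R G g; rewrite compact_ultra => /(_ F uF Fg)[p [[t ti <-] Fp]].
  exists (ed g t); split=> //; apply: X_edge => //; by move: ti; rewrite /= in_itv.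
have /choice[z zP] : forall n, exists z, Y n z /\ F [set x | cutf (node n z) x = 1].
  move=> n; have [es [S [/finite_seqP[es' esE] esC /finite_seqP[S' SE] SY cov]]] := X_cover n.
  have : F ((\bigcup_(g in [set` es']) (ed g @` `[0, 1])) `|`
      \bigcup_(z in [set` S']) [set x | cutf (node n z) x = 1]).
    apply: filterS FX => x /cov[[g eg gx]|[z Sz zx]].
      by left; exists g => //; rewrite -esE.
    by right; exists z => //; rewrite -SE.
  move=> /(ultra_finite uF)[Fe|[z zS Fz]]; last first.
    by exists z; split=> //; apply: SY; rewrite SE.
  have : F (set0 `|` \bigcup_(g in [set` es']) (ed g @` `[0, 1])) by rewrite set0U.
  move=> /(ultra_finite uF)[F0|[g ges Fg]].
    by exfalso; exact: filter_not_empty F0.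
  by exfalso; apply: nE; exists g => //; apply: esC; rewrite esE.
have bz : branch Y z.
  move=> n; have [Yn Fn] := zP n; split=> //; have [Yn1 Fn1] := zP n.+1.
  have [x [/= xn xn1]] := filter_ex (filterI Fn Fn1).
  have [a an an1] : exists2 a, node n (z n) a & node n.+1 (z n.+1) a.
    case: (dtopP x) xn xn1 => [v ->|g t t01 ->|w nd ->].
    - by move=> /cutf_vp1 ? /cutf_vp1 ?; exists v.
    - by move=> /(cutf_ed1 _ _ t01)[? _] /(cutf_ed1 _ _ t01)[? _]; exists (src g).
    - move=> /cutf_op1 s1 /cutf_op1 s2; have [m hm] := sideI YP nd s1 s2.
      by have [a wa] := end_node_ex YP m nd; have [] := hm _ wa; exists a.
  have := node_mono YP (leqnSn n) an1 => za.
  by rewrite -(comp_eq an); exact: connected_sym.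
have [w nd wE] := branch_end YP bz.
exists (op nd); split.
  apply/X_op => n; have [_ Fn] := zP n; rewrite wE.
  have [x [/= xn Xx]] := filter_ex (filterI Fn FX).
  case: (dtopP x) xn Xx => [v ->|g t t01 ->|w' nd' ->].
  - by move=> /cutf_vp1 vn /X_vp[g Cg [vg|vg]]; exists g => //; [left|right]; rewrite -vg.
  - by move=> /(cutf_ed1 _ _ t01)[? _] /(X_ed _ t01) ?; exists g => //; left.
  - move=> /cutf_op1[m hm] /X_op/(_ m)[g Cg wg]; exists g => //.
    exact: touch_sub hm wg.
move=> U /dtop_nbhsP[B [bB Bw] BU].
case: bB => [[/(_ w)/(_ Bw)//]|[S [w0 [eps [fS BE]]]]]; subst B.
have CE : end_comp S w = end_comp S w0 by exact: Bw.
have [n hn] := end_node_sub_comp YP fS nd; rewrite wE CE in hn.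
have [_ Fn] := zP n; apply: filterS Fn => x; move=> /= xn; apply: BU.
case: (dtopP x) xn => [v ->|g t t01 ->|w' nd' ->].
- by move=> /cutf_vp1 /hn.
- move=> /(cutf_ed1 _ _ t01)[/hn ? /hn ?].
  by rewrite val_ed; constructor 1.
- move=> /cutf_op1[m hm] /=; have [c0 _] := end_compP w0 fS; have [c' w'C] := end_compP w' fS.
  have [z' [_ mE w'z]] := end_nodeP YP m nd'; have [r wr] := end_rays_ex w'.
  have [a ca za] := tail_in_meet (w'C _ wr) (w'z _ wr).
  by apply: component_eq c' c0 ca _; apply: hn; apply: hm; rewrite mE.
Qed.

Let c0 : C !=set0. Proof. by case: cC. Qed.
Let c1 A e : dec Y A -> C e -> sep A e -> exists f, [/\ C f, f <> e & sep A f].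
Proof. by case: cC => _ + _; exact. Qed.
Let c2 e f : C e -> C f -> e <> f -> exists2 A, dec Y A &
  forall g, C g -> (sep A g <-> g = e \/ g = f).
Proof. by case: cC => _ _; exact. Qed.

(** Otherwise intersect [Z] with a set separating just [e] and [k] in [C]: as [k] lies in [Z] and
    [e] outside, the intersection separates [k] alone, against [c1]. *)
Let connC Z e k : dec Y Z -> (forall g, C g -> ~ sep Z g) -> C e -> C k ->
  Z (src k) -> Z (src e).
Proof.
move=> dZ nZ Ce Ck Zk; apply: contrapT => nZe.
have ek : e <> k by move=> E; apply: nZe; rewrite E.
have [A dA hA] := c2 Ce Ck ek.
have sB g : C g -> sep (Z `&` A) g -> Z (src g) /\ sep A g.
  move=> Cg; have := nZ _ Cg; rewrite /sep /setI /=; have [] := pselect (Z (src g)); tauto.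
have sBk : sep (Z `&` A) k.
  have := nZ _ Ck; have : sep A k by apply/hA => //; right.
  by rewrite /sep /setI /=; tauto.
have [f [Cf fk /(sB _ Cf)[Zf]]] := c1 (decI YP dZ dA) Ck sBk.
by move=> /(hA _ Cf)[fe|//]; apply: nZe; rewrite -fe.
Qed.

Let cutfC A x : dec Y A -> vertex_or_end x -> cutf A x = 0 -> cutf (~` A) x = 1.
Proof.
move=> dA; case: (dtopP x) => [v ->|g t t01 -> /(_ g t t01 erefl)//|w nd ->] _.
  rewrite /cutf cutf_vp => h; apply/cutf_vp1 => Av; move: h; rewrite ind1 // => /eqP.
  by rewrite oner_eq0.
rewrite /cutf cutf_op => h; have /(sideC YP dA nd) sA : ~ side Y A w; last exact/cutf_op1.
by move=> sA; move: h; rewrite ind1 // => /eqP; rewrite oner_eq0.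
Qed.

Let X_touch Z x : X x -> vertex_or_end x -> cutf Z x = 1 -> exists2 k, C k & touch Z k.
Proof.
case: (dtopP x) => [v ->|g t t01 -> _ /(_ g t t01 erefl)//|w nd ->].
  by move=> /X_vp[g Cg [vg|vg]] _ /cutf_vp1 Zv; exists g => //; [left|right]; rewrite -vg.
by move=> /X_op Xw _ /cutf_op1[n hn]; have [g Cg wg] := Xw n; exists g => //; exact: touch_sub wg.
Qed.

Let in_Z Z x e : dec Y Z -> (forall g, C g -> ~ sep Z g) -> C e -> X x -> vertex_or_end x ->
  cutf Z x = 1 -> Z (src e).
Proof.
move=> dZ nZ Ce Xx vx xZ; have [k Ck kZ] := X_touch Xx vx xZ.
apply: (connC dZ nZ Ce Ck); have /contrapT := nZ _ Ck; case: kZ => kZ; tauto.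
Qed.

Let cutf_const Z x y : dec Y Z -> (forall g, C g -> ~ sep Z g) -> X x -> X y ->
  vertex_or_end x -> vertex_or_end y -> cutf Z x = cutf Z y.
Proof.
have [e Ce] := c0; move=> dZ nZ; have nZ' g : C g -> ~ sep (~` Z) g by rewrite sepC; exact: nZ.
have half x' y' : X x' -> X y' -> vertex_or_end x' -> vertex_or_end y' ->
    cutf Z x' = 0 -> cutf Z y' = 1 -> False.
  move=> Xx Xy vx vy /(cutfC dZ vx) Zx Zy.
  exact: (in_Z (decC dZ) nZ' Ce Xx vx Zx) (in_Z dZ nZ Ce Xy vy Zy).
move=> Xx Xy vx vy; case: (cutf01 Y Z vx) (cutf01 Y Z vy) => Ex [] Ey; rewrite /cutf Ex Ey //.
  by case: (half _ _ Xx Xy vx vy Ex Ey).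
by case: (half _ _ Xy Xx vy vx Ey Ex).
Qed.

Let cutf_symd A B x : dec Y A -> dec Y B -> vertex_or_end x ->
  cutf (symd A B) x = 1 <-> cutf A x <> cutf B x.
Proof.
have n10 : (1 : R) <> 0 by apply/eqP; rewrite oner_eq0.
have n01 := nesym n10.
move=> dA dB; case: (dtopP x) => [v ->|g t t01 -> /(_ g t t01 erefl)//|w nd ->] _.
  rewrite cutf_vp1 /cutf !cutf_vp /symd /=.
  have [[Av ->]|[Av ->]] := indP (R := R) (A v); have [[Bv ->]|[Bv ->]] := indP (R := R) (B v);
    split=> //; tauto.
have sAC := sideC YP dA nd; have sBC := sideC YP dB nd.
have aux A' B' : dec Y A' -> dec Y B' -> (forall v, A' v -> B' v -> symd A B v) ->
    side Y A' w -> side Y B' w -> side Y (symd A B) w.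
  move=> _ _ sub sA sB; apply: side_sub (sideI YP nd sA sB) => v [Av Bv]; exact: sub.
have auxn A' B' : (forall v, A' v -> B' v -> ~ symd A B v) ->
    side Y A' w -> side Y B' w -> ~ side Y (symd A B) w.
  move=> sub sA sB; apply/(sideC YP (dec_symd YP dA dB) nd).
  by apply: side_sub (sideI YP nd sA sB) => v [Av Bv]; exact: sub.
rewrite cutf_op1 /cutf !cutf_op.
have [[sA ->]|[nA ->]] := indP (R := R) (side Y A w);
have [[sB ->]|[nB ->]] := indP (R := R) (side Y B w); split=> // h.
- by case: (auxn A B _ sA sB h) => v; rewrite /symd /=; tauto.
- by apply: (aux A (~` B)) => //; [exact: decC|rewrite /symd /setC /=; tauto|apply/sBC].
- by apply: (aux (~` A) B) => //; [exact: decC|rewrite /symd /setC /=; tauto|apply/sAC].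
- have /sAC sA := nA; have /sBC sB := nB.
  by case: (auxn (~` A) (~` B) _ sA sB h) => v; rewrite /symd /setC /=; tauto.
Qed.


Let cutfI A B x : vertex_or_end x -> cutf A x = 1 -> cutf B x = 1 -> cutf (A `&` B) x = 1.
Proof.
case: (dtopP x) => [v ->|g t t01 -> /(_ g t t01 erefl)//|w nd ->] _.
  by move=> /cutf_vp1 ? /cutf_vp1 ?; apply/cutf_vp1.
by move=> /cutf_op1 ? /cutf_op1 ?; apply/cutf_op1; exact: (sideI YP).
Qed.

Let cutf_range A x : 0 <= cutf A x <= 1.
Proof.
case: (dtopP x) => [v ->|g t /andP[t0 t1] ->|w nd ->]; rewrite /cutf ?cutf_vp ?cutf_op.
- by have [[_ ->]|[_ ->]] := indP (R := R) (A v); rewrite lexx ler01.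
- rewrite cutf_ed; last by rewrite !ltW.
  have [[_ ->]|[_ ->]] := indP (R := R) (A (src g));
  by have [[_ ->]|[_ ->]] := indP (R := R) (A (tgt g)); apply/andP; split; lra.
- by have [[_ ->]|[_ ->]] := indP (R := R) (side Y A w); rewrite lexx ler01.
Qed.

Let cutf_ed_nsep A g t : ~ sep A g -> 0 <= t <= 1 -> cutf A (ed g t) = ind (A (src g)).
Proof.
move=> /contrapT AA t01; rewrite /cutf cutf_ed // -(ind_iff AA); ring.
Qed.

Let voe_vp v : vertex_or_end (vp v : dtop R G).
Proof. by move=> g t t01 /esym; exact: ed_vp. Qed.

Variable e : edge G.
Hypothesis Ce : C e.

(** Fixing the sides of [src e] and [tgt e] makes all functions [b g] grow in the same direction
    along the rest of the cycle. *)
Let exA g : exists A, C g -> g <> e -> [/\ dec Y A, ~ A (src e), A (tgt e) &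
  forall h, C h -> (sep A h <-> h = e \/ h = g)].
Proof.
have [[Cg ge]|n] := pselect (C g /\ g <> e); last by exists set0 => Cg ge; case: n.
have [A dA hA] := c2 Ce Cg (nesym ge); have : sep A e by apply/hA => //; left.
move=> sA; have [As|nAs] := pselect (A (src e)); last first.
  by exists A => _ _; split=> //; apply: contrapT => nAt; apply: sA.
exists (~` A) => _ _; split; [exact: decC|by move=> /(_ As)|by move=> At; apply: sA|].
by move=> h Ch; rewrite sepC; exact: hA.
Qed.

Let AA g := sval (cid (exA g)).
Let AAP g : C g -> g <> e -> [/\ dec Y (AA g), ~ AA g (src e), AA g (tgt e) &
  forall h, C h -> (sep (AA g) h <-> h = e \/ h = g)].
Proof. exact: (svalP (cid (exA g))). Qed.

Let b g := cutf (AA g).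

(* A decided set separating [x] from [y] can be corrected by the sets [AA g] so  *)
(* that it separates no edge of [C].                                             *)
Let b_inj_voe x y : X x -> X y -> vertex_or_end x -> vertex_or_end y ->
  (forall g, C g -> g <> e -> b g x = b g y) -> x = y.
Proof.
have n10 : (1 : R) <> 0 by apply/eqP; rewrite oner_eq0.
have n01 := nesym n10.
have key (p u v c : R) : u = 0 \/ u = 1 -> v = 0 \/ v = 1 -> c = 0 \/ c = 1 ->
    (p = 1 <-> u <> c) -> (p = 1 <-> v <> c) -> u = v.
  by clear - n10 n01; case=> ->; case=> ->; case=> -> h1 h2 //; exfalso; tauto.
move=> Xx Xy vx vy bxy; apply: contrapT => neq.
have [A dA Axy] := vertex_or_end_sep YP vx vy neq.
have /finite_seqP[ts tsE] := thin_finite_cross YP (fun n => cyclic_thin YP n cC) dA.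
have : forall g, C g -> sep A g -> g = e \/ g \in ts.
  by move=> g Cg sg; right; have : [set` ts] g by rewrite -tsE.
elim: ts A dA Axy {tsE} => [|k ts IH] A dA Axy Ats.
  apply: Axy; apply: cutf_const => // g Cg sg; have [ge|//] := Ats _ Cg sg; subst g.
  by have [f [Cf fe sf]] := c1 dA Ce sg; case: (Ats _ Cf sf).
have [[Ck [ke sk]]|nk] := pselect (C k /\ k <> e /\ sep A k); last first.
  apply: (IH A) => // g Cg sg; have [->|] := Ats _ Cg sg; first by left.
  have [->|ge] := pselect (g = e); first by left.
  by rewrite inE => /orP[/eqP gk|gts]; [case: nk; rewrite -gk|right].
have [dK _ _ hK] := AAP Ck ke.
apply: (IH (symd A (AA k))); first exact: (dec_symd YP).
  move=> Exy; apply: Axy; have {}Exy : cutf (symd A (AA k)) x = cutf (symd A (AA k)) y := Exy.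
  apply: (key (cutf (symd A (AA k)) y) _ _ (b k y)); try exact: cutf01.
    by rewrite -Exy -(bxy _ Ck ke); exact: cutf_symd.
  exact: cutf_symd.
move=> g Cg; rewrite sep_symd => sg; have [->|ge] := pselect (g = e); first by left.
right; have := Ats _ Cg; rewrite inE; have := hK _ Cg; have [gk|gk] := eqVneq g k.
  by subst g; tauto.
move=> h1 h2; have : sep A g by apply: contrapT => nA; apply: sg; move/eqP: gk; tauto.
by move=> /h2[].
Qed.

(** Consider the part of one of the two sets outside the other. It contains [x] or [y] but not
    [src e], so it separates some edge of [C]; only [g] and [h] are possible, and by [c1] it
    separates both. Doing this for both differences puts [src g] on both sides of [AA h]. *)
Let b_cross x y g h : X x -> X y -> vertex_or_end x -> vertex_or_end y ->
  C g -> g <> e -> C h -> h <> e ->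
  b g x = 0 -> b g y = 1 -> b h x = 1 -> b h y = 0 -> False.
Proof.
move=> Xx Xy vx vy Cg ge Ch he gx gy hx hy.
have [dg gs gt hg] := AAP Cg ge; have [dh hs ht hh] := AAP Ch he.
have gh : g <> h.
  by move=> E; move: gx hx; rewrite E => -> /eqP; rewrite eq_sym oner_eq0.
have half p q x' : C p -> C q -> p <> q -> p <> e -> q <> e -> X x' -> vertex_or_end x' ->
    b p x' = 1 -> b q x' = 0 -> ~ AA q (src p) /\ AA p (src q).
  move=> Cp Cq pq pe qe Xx' vx' p1 q0.
  have [dp ps pt hp] := AAP Cp pe; have [dq qs qt hq] := AAP Cq qe.
  pose Z := AA p `&` ~` AA q; have dZ : dec Y Z by apply: (decI YP) => //; exact: decC.
  have Z1 : cutf Z x' = 1 by apply: cutfI => //; exact: cutfC.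
  have np : ~ sep (AA q) p by rewrite hq //; tauto.
  have nq : ~ sep (AA p) q by rewrite hp //; case=> // /esym.
  have sp : sep (AA p) p by rewrite hp //; right.
  have sq : sep (AA q) q by rewrite hq //; right.
  have Zp : sep Z p <-> ~ AA q (src p).
    by move: np sp; rewrite /sep /Z /setI /setC /=; clear; have [] := pselect (AA q (src p)); tauto.
  have Zq : sep Z q <-> AA p (src q).
    by move: nq sq; rewrite /sep /Z /setI /setC /=; clear; have [] := pselect (AA p (src q));
      have [] := pselect (AA q (src q)); tauto.
  have Zk k : C k -> sep Z k -> k = p \/ k = q.
    move=> Ck; have [->|ke] := pselect (k = e).
      by move=> []; split=> -[]; [move=> /ps|move=> _ /(_ qt)].
    move=> sZ; apply: contrapT => n.
    have /contrapT ap : ~ sep (AA p) k by rewrite hp //; clear - ke n; tauto.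
    have /contrapT aq : ~ sep (AA q) k by rewrite hq //; clear - ke n; tauto.
    by apply: sZ; rewrite /Z /setI /setC /=; clear - ap aq; tauto.
  have [|nsp] := pselect (sep Z p).
    move=> sZp; split; first exact/Zp.
    by have [f [Cf fp sf]] := c1 dZ Cp sZp; have [//|fq] := Zk _ Cf sf; apply/Zq; rewrite -fq.
  have [sZq|nsq] := pselect (sep Z q).
    by have [f [Cf fq sf]] := c1 dZ Cq sZq; have [fp|//] := Zk _ Cf sf; case: nsp; rewrite -fp.
  have nZ k : C k -> ~ sep Z k by move=> Ck sk; have [kp|kq] := Zk _ Ck sk; subst k.
  by have [] := in_Z dZ nZ Ce Xx' vx' Z1.
have [n1 _] := half g h y Cg Ch gh ge he Xy vy gy hy.
by have [_ n2] := half h g x Ch Cg (nesym gh) he ge Xx vx hx gx.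
Qed.

Let X' : set (dtop R G) := [set x | X x /\ forall t, 0 < t < 1 -> x <> ed e t].

Let le x y := forall g, C g -> g <> e -> b g x <= b g y.
Let cmp x y := le x y \/ le y x.

Let X'_voe x : X x -> vertex_or_end x -> X' x.
Proof. by move=> Xx vx; split=> // t t01; exact: vx. Qed.

Let X'P x : X' x -> vertex_or_end x \/ exists g t, [/\ C g, g <> e, 0 < t < 1 & x = ed g t].
Proof.
move=> [Xx ne]; have [|/existsNP[g /existsNP[t /not_implyP[t01 /contrapT xE]]]] :=
  pselect (vertex_or_end x); first by left.
right; exists g, t; split=> //; first by apply/(X_ed _ t01); rewrite -xE.
by move=> ge; apply: (ne t) => //; rewrite -ge.
Qed.

Let X_src g : C g -> X (vp (src g)). Proof. by move=> Cg; apply/X_vp; exists g => //; left. Qed.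
Let X_tgt g : C g -> X (vp (tgt g)). Proof. by move=> Cg; apply/X_vp; exists g => //; right. Qed.

Let b_off g h t : C g -> g <> e -> C h -> h <> e -> h <> g -> 0 <= t <= 1 ->
  b g (ed h t) = b g (vp (src h)) /\ b g (ed h t) = b g (vp (tgt h)).
Proof.
move=> Cg ge Ch he hg t01; have [_ _ _ hA] := AAP Cg ge.
have ns : ~ sep (AA g) h by rewrite hA //; case.
rewrite /b cutf_ed_nsep // /cutf !cutf_vp; split=> //; apply: ind_iff; exact: contrapT ns.
Qed.

Let b_on g : C g -> g <> e ->
  (b g (vp (src g)) = 0 /\ b g (vp (tgt g)) = 1 /\ forall t, 0 <= t <= 1 -> b g (ed g t) = t) \/
  (b g (vp (src g)) = 1 /\ b g (vp (tgt g)) = 0 /\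
    forall t, 0 <= t <= 1 -> b g (ed g t) = 1 - t).
Proof.
move=> Cg ge; have [_ _ _ hA] := AAP Cg ge.
have : sep (AA g) g by rewrite hA //; right.
rewrite /b /cutf !cutf_vp /sep.
have [[As Es]|[As Es]] := indP (R := R) (AA g (src g));
have [[At Et]|[At Et]] := indP (R := R) (AA g (tgt g)); try tauto; move=> _; [right|left];
  by rewrite Es Et; do 2!split=> //; move=> t t01; rewrite cutf_ed // Es Et; ring.
Qed.

Let b_range g x : 0 <= b g x <= 1. Proof. exact: cutf_range. Qed.

Let cmp_voe x y : X x -> X y -> vertex_or_end x -> vertex_or_end y -> cmp x y.
Proof.
move=> Xx Xy vx vy; apply: contrapT => /not_orP[].
move=> /existsNP[g /not_implyP[Cg /not_implyP[ge /negP]]]; rewrite -ltNge => gl.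
move=> /existsNP[h /not_implyP[Ch /not_implyP[he /negP]]]; rewrite -ltNge => hl.
have b01 := (fun k z (vz : vertex_or_end z) => cutf01 (R := R) Y (AA k) vz).
apply: (@b_cross y x g h) => //; move: gl hl; rewrite /b /cutf;
  case: (b01 g _ vx) => ->; case: (b01 g _ vy) => ->; rewrite ?ltxx ?ltr01 ?ltr10 //;
  case: (b01 h _ vx) => ->; case: (b01 h _ vy) => ->; by rewrite ?ltxx ?ltr01 ?ltr10.
Qed.

(** The endvertices of [g] agree with [ed g t] in every coordinate other than [b g]. If [y] lies
    between them, only [b g] remains to be compared. *)
Let cmp_edge y g t : C g -> g <> e -> 0 <= t <= 1 ->
  (forall x, X x -> vertex_or_end x -> cmp y x) -> cmp y (ed g t).
Proof.
move=> Cg ge t01 hy.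
have [lo [hi [Xl vl Xh vh [bl bh ble bhe]]]] : exists lo hi, [/\ X lo, vertex_or_end lo, X hi,
    vertex_or_end hi & [/\ b g lo = 0, b g hi = 1,
      (forall k, C k -> k <> e -> g <> k -> b k (ed g t) = b k lo) &
      (forall k, C k -> k <> e -> g <> k -> b k (ed g t) = b k hi)]].
  have Xs := X_src Cg; have Xt := X_tgt Cg.
  case: (b_on Cg ge) => -[E0 [E1 _]]; [exists (vp (src g)), (vp (tgt g))|
    exists (vp (tgt g)), (vp (src g))]; split=> //; try exact: voe_vp;
    split=> // k Ck ke gk; by have [] := b_off Ck ke Cg ge gk t01.
have /andP[g0 g1] := b_range g (ed g t).
have lx : le lo (ed g t).
  move=> k Ck ke; have [<-|gk] := pselect (g = k); first by rewrite bl.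
  by rewrite ble.
have xh : le (ed g t) hi.
  move=> k Ck ke; have [<-|gk] := pselect (g = k); first by rewrite bh.
  by rewrite bhe.
have [yl|ly] := hy _ Xl vl; first by left=> k Ck ke; exact: le_trans (yl _ Ck ke) (lx _ Ck ke).
have [yh|hy'] := hy _ Xh vh; last first.
  by right=> k Ck ke; exact: le_trans (xh _ Ck ke) (hy' _ Ck ke).
have E k : C k -> k <> e -> g <> k -> b k y = b k (ed g t).
  move=> Ck ke gk; apply/le_anti; rewrite {1}bhe // yh //= ble //; exact: ly.
have [yx|xy] := leP (b g y) (b g (ed g t)); [left|right] => k Ck ke;
  (have [<-|gk] := pselect (g = k); last by rewrite E); rewrite // ltW //.
Qed.

Let cmp_X' x y : X' x -> X' y -> cmp x y.
Proof.
have sym (u v : dtop R G) : cmp u v -> cmp v u by case; [right|left].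
have voe (u v : dtop R G) : X u -> vertex_or_end u -> X' v -> cmp u v.
  move=> Xu vu X'v; have [Xv _] := X'v.
  have [vv|[g [t [Cg ge /andP[t0 t1] ->]]]] := X'P X'v; first exact: cmp_voe.
  by apply: cmp_edge; rewrite ?ltW // => z Xz vz; exact: cmp_voe.
move=> X'x X'y; have [Xy _] := X'y.
have [vy|[g [t [Cg ge /andP[t0 t1] ->]]]] := X'P X'y; first by apply: sym; exact: voe.
by apply: cmp_edge; rewrite ?ltW // => z Xz vz; apply: sym; exact: voe.
Qed.

Let b_mid g y : C g -> g <> e -> X' y -> 0 < b g y < 1 -> exists2 s, 0 < s < 1 & y = ed g s.
Proof.
move=> Cg ge X'y by01; have [Xy _] := X'y.
have no (c : R) : c = 0 \/ c = 1 -> 0 < c < 1 -> False.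
  by case=> ->; rewrite ltxx ?andbF.
have [vy|[h [s [Ch he s01 yE]]]] := X'P X'y; first by case: (no _ (cutf01 Y (AA g) vy)).
have [hg|hg] := pselect (h = g); first by exists s; rewrite -?hg.
have /andP[s0 s1] := s01; have W : 0 <= s <= 1 by rewrite !ltW.
have [E _] := b_off Cg ge Ch he hg W.
exfalso; apply: (no (b g y)) => //; rewrite yE E; apply: cutf01; exact: voe_vp.
Qed.

Let b_inj x y : X' x -> X' y -> (forall g, C g -> g <> e -> b g x = b g y) -> x = y.
Proof.
have edgeX (u v : dtop R G) g t : C g -> g <> e -> 0 < t < 1 -> u = ed g t -> X' v ->
    (forall g, C g -> g <> e -> b g u = b g v) -> u = v.
  move=> Cg ge t01 uE X'v uv; have Eg := uv _ Cg ge; have /andP[t0 t1] := t01.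
  have W : 0 <= t <= 1 by rewrite !ltW.
  have bu : 0 < b g u < 1.
    by rewrite uE; case: (b_on Cg ge) => -[_ [_ ->]] //; rewrite ?subr_gt0 ?gtrDl ?oppr_lt0 t1 t0.
  have [|s /andP[s0 s1] vE] := b_mid Cg ge X'v; first by rewrite -Eg.
  have W' : 0 <= s <= 1 by rewrite !ltW.
  rewrite uE vE; congr ed; move: Eg; rewrite uE vE.
  by case: (b_on Cg ge) => -[_ [_ h]]; rewrite !h // => /addrI/oppr_inj.
move=> X'x X'y xy; have [Xx _] := X'x; have [Xy _] := X'y.
have [vx|[g [t [Cg ge t01 xE]]]] := X'P X'x; last exact: edgeX xE X'y xy.
have [vy|[g [t [Cg ge t01 yE]]]] := X'P X'y; first exact: b_inj_voe.
by apply/esym; apply: edgeX yE X'x _ => // k Ck ke; rewrite xy.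
Qed.


(** By thinness only finitely many edges of [C] have both endvertices outside [Y n], and every edge
    is of this kind for some [n]. *)
Let countC : exists f : edge G -> nat, {in C &, injective f}.
Proof.
suff /countable_injP[f fi] : countable C by exists f.
have /choice[es esP] : forall n, exists es : set (edge G), finite_set es /\
    forall g, C g -> ~ Y n (src g) -> ~ Y n (tgt g) -> es g.
  move=> n; have [es [S [fes _ _ h]]] := cyclic_thin YP n cC; exists es; split=> // g Cg ns nt.
  by have [//|[x _ [/comp_sub|/comp_sub]]] := h _ Cg.
apply: (@sub_countable _ _ _ (\bigcup_n es n)).
  apply: subset_card_le => g Cg; have [|n hn] := @layer_fin _ _ YP [set src g; tgt g].
    by rewrite finite_setU; split; exact: finite_set1.
  by exists n => //; apply: (esP n).2 => //; apply: hn; [left|right].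
by apply: bigcup_countable => // n _; apply: finite_set_countable; exact: (esP n).1.
Qed.

Let num := sval (cid countC).
Let num_inj g h : C g -> C h -> num g = num h -> g = h.
Proof. by move=> Cg Ch; apply: (svalP (cid countC)); rewrite inE. Qed.

Let ac i : dtop R G -> R :=
  if pselect (exists g, [/\ C g, g <> e & num g = i]) is left H then b (sval (cid H))
  else fun=> 0.

Let acE i : (exists g, [/\ C g, g <> e & ac i = b g]) \/ ac i = fun=> 0.
Proof.
rewrite /ac; case: pselect => [H|n]; last by right.
by left; exists (sval (cid H)); have [Cg ge _] := svalP (cid H).
Qed.

Let ac_num g : C g -> g <> e -> ac (num g) = b g.
Proof.
move=> Cg ge; rewrite /ac; case: pselect => [H|n]; last by case: n; exists g.
by case: (cid H) => h [Ch he hg] /=; rewrite (num_inj Ch Cg hg).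
Qed.

Let ac_cont i : continuous (ac i).
Proof.
have [[g [Cg ge ->]]|->] := acE i; last exact: cst_continuous.
by apply: (cutf_continuous YP); case: (AAP Cg ge).
Qed.

Let ac01 i x : 0 <= ac i x <= 1.
Proof. by have [[g [_ _ ->]]|->] := acE i; [exact: b_range|rewrite lexx ler01]. Qed.

Let psi := wsum ac.
Let W := psi (vp (tgt e)).

Let psi_cont : continuous psi. Proof. exact: wsum_continuous ac_cont ac01. Qed.

(** By the orientation of the sets [AA g], every [b g] has the value [t] at [ed e t]. *)
Let psi_ed t : 0 <= t <= 1 -> psi (ed e t) = t * W.
Proof.
move=> t01; have /andP[t0 _] := t01; apply: (wsum_scale ac01) => // i.
have [[g [Cg ge ->]]|->] := acE i; last by rewrite mulr0.
have [_ ns tt _] := AAP Cg ge.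
by rewrite /b /cutf cutf_ed // cutf_vp ind0 // ind1 // mulr0 add0r.
Qed.

Let psi_le x : psi x <= W.
Proof.
apply: (wsum_mono ac01) => i; have [[g [Cg ge ->]]|->] := acE i => //.
have [_ ns tt _] := AAP Cg ge; have /andP[_ h] := b_range g x.
by apply: le_trans h _; rewrite /b /cutf cutf_vp ind1.
Qed.

Let psi_ge0 x : 0 <= psi x. Proof. exact: (wsum_ge0 ac01). Qed.

(** Distinct points of [X'] are comparable and differ in some coordinate, which enters the sum with
    positive weight. *)
Let psi_inj x y : X' x -> X' y -> psi x = psi y -> x = y.
Proof.
have lt (u v : dtop R G) : le u v -> (exists2 g, C g /\ g <> e & b g u <> b g v) -> psi u < psi v.
  move=> uv [g [Cg ge] guv]; apply: (wsum_lt ac01 (k := num g)).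
    by move=> i; have [[h [Ch he ->]]|->] := acE i => //; exact: uv.
  by rewrite ac_num // lt_neqAle uv // andbT; exact/eqP.
move=> X'x X'y E; apply: contrapT => neq.
have [g [Cg ge] gxy] : exists2 g, C g /\ g <> e & b g x <> b g y.
  apply: contrapT => n; apply: neq; apply: b_inj => // g Cg ge; apply: contrapT => ne.
  by apply: n; exists g.
have [xy|yx] := cmp_X' X'x X'y.
  by have := lt x y xy (ex_intro2 _ _ g (conj Cg ge) gxy); rewrite E ltxx.
by have := lt y x yx (ex_intro2 _ _ g (conj Cg ge) (nesym gxy)); rewrite E ltxx.
Qed.

Let X'_end g t : C g -> g <> e -> 0 <= t <= 1 -> X' (ed g t).
Proof.
move=> Cg ge t01; split; first exact: X_edge.
move=> s s01; have It : `[0, 1]%classic t by rewrite /= in_itv.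
have [->|->|] := edge_mapP g It.
- by rewrite ed0; exact/nesym/ed_vp.
- by rewrite ed1; exact/nesym/ed_vp.
move=> [u ut _]; have u01 : 0 < t < 1 by rewrite -ut; exact: (valP u).
by move=> /(ed_inj u01 s01)[].
Qed.

Let X'_src g : C g -> X' (vp (src g)).
Proof. by move=> Cg; apply: X'_voe; [exact: X_src|exact: voe_vp]. Qed.
Let X'_tgt g : C g -> X' (vp (tgt g)).
Proof. by move=> Cg; apply: X'_voe; [exact: X_tgt|exact: voe_vp]. Qed.

Let bump_X' x : X x -> bump e x <= 0 -> X' x.
Proof.
move=> Xx b0; split=> // t t01 xE; have : 0 < bump e x by apply/bump_gt0; exists t.
by rewrite ltNge b0.
Qed.

Let X'_bump x : X' x -> bump e x = 0.
Proof.
move=> [Xx ne]; apply/le_anti; rewrite bump_ge0 andbT leNgt; apply/negP => /bump_gt0[t t01].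
exact: ne.
Qed.

Let psi_src : psi (vp (src e)) = 0.
Proof. by rewrite -ed0 psi_ed ?lexx ?ler01 // mul0r. Qed.

(** If [s] were omitted, the points below and above it would form two disjoint compact sets. A
    decided set separating their vertices separates [e], hence another edge [f] of [C], and along
    [f] the value [s] is attained after all. *)
Let psi_surj s : 0 <= s <= W -> exists2 x, X' x & psi x = s.
Proof.
move=> /andP[s0 sW]; apply: contrapT => no.
have ne x : X' x -> psi x <> s by move=> X'x xs; apply: no; exists x.
have cmpc (F : dtop R G -> R) c : continuous F -> closed [set x | c <= F x].
  move=> cF; rewrite (_ : [set x | _] = ~` [set x | F x < c]).
    by apply: open_closedC; exact: open_lt_fun.
  by apply/seteqP; split=> x /=; rewrite leNgt => /negP.
pose K1 := X `&` ([set x | bump e x <= 0] `&` [set x | psi x <= s]).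
pose K2 := X `&` ([set x | bump e x <= 0] `&` [set x | s <= psi x]).
have cb := @bump_continuous R G e.
have [|||A [dA A1 A2]] := @compact_separation R G Y YP K1 K2.
- apply: compact_closedI => //; apply: closedI; exact: closed_le_fun.
- by apply: compact_closedI => //; apply: closedI; [exact: closed_le_fun|exact: cmpc].
- apply/seteqP; split=> // x [[Xx [bx xs]] [_ [_ sx]]].
  by apply: (ne x); [exact: bump_X'|apply/le_anti/andP].
have vK1 v : X' (vp v) -> psi (vp v) < s -> A v.
  move=> X'v vs; apply: A1; split; first by case: X'v.
  by split; rewrite /= ?X'_bump // ltW.
have vK2 v : X' (vp v) -> s < psi (vp v) -> ~ A v.
  move=> X'v vs; apply: A2; split; first by case: X'v.
  by split; rewrite /= ?X'_bump // ltW.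
have vcmp v : X' (vp v) -> psi (vp v) < s \/ s < psi (vp v).
  by move=> /ne/eqP; rewrite neq_lt => /orP.
have sA : sep A e.
  have As : A (src e).
    apply: vK1; first exact: X'_src.
    by have [//|] := vcmp _ (X'_src Ce); rewrite psi_src ltNge s0.
  have At : ~ A (tgt e).
    apply: vK2; first exact: X'_tgt.
    by have [|//] := vcmp _ (X'_tgt Ce); rewrite -/W ltNge sW.
  by move=> [/(_ As)].
have [f [Cf fe sf]] := c1 dA Ce sA.
have [|||t t01 ft] := @ivt_itv R (fun t => psi (ed f t)) 0 1 s.
- move=> t; apply: continuous_comp; [exact: ed_continuous|exact: psi_cont].
- exact: ler01.
- rewrite ed0 ed1.
  have [s1|s2] := vcmp _ (X'_src Cf); have [t1|t2] := vcmp _ (X'_tgt Cf);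
    [|by left|by right|]; exfalso; apply: sf.
    by have := vK1 _ (X'_src Cf) s1; have := vK1 _ (X'_tgt Cf) t1.
  by have := vK2 _ (X'_src Cf) s2; have := vK2 _ (X'_tgt Cf) t2.
by apply: ne ft; exact: X'_end.
Qed.


Let W_gt0 g : C g -> g <> e -> 0 < W.
Proof.
move=> Cg ge; have := psi_ge0 (vp (tgt e)); rewrite le_eqVlt -/W => /orP[/eqP W0|//].
have [_ ns tt _] := AAP Cg ge.
have E : vp (src e) = vp (tgt e) :> dtop R G.
  by apply: psi_inj; [exact: X'_src|exact: X'_tgt|rewrite psi_src].
by case: ns; apply/cutf_vp1; rewrite E; exact/cutf_vp1.
Qed.

(* The second circle coordinate: on [e] one has [psi / W = t], and the term      *)
(* [4 sqrt(t (1 - t))] reflects the upper half circle to the lower one.          *)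
Let arc x : R := 2 * Num.sqrt (psi x / W * (1 - psi x / W)) - 4 * Num.sqrt (bump e x).

Let arc_X' x : X' x -> arc x = 2 * Num.sqrt (psi x / W * (1 - psi x / W)).
Proof. by move=> X'x; rewrite /arc X'_bump // sqrtr0 mulr0 subr0. Qed.

Let X_split x : X x -> X' x \/ exists2 t, 0 < t < 1 & x = ed e t.
Proof.
move=> Xx; have [|n] := pselect (exists2 t, 0 < t < 1 & x = ed e t); first by right.
by left; split=> // t t01 xE; apply: n; exists t.
Qed.

Let cycle_of_arc g : C g -> g <> e -> topological_cycle R X.
Proof.
move=> Cg ge; have W0 := W_gt0 Cg ge.
have p01 x : 0 <= psi x / W <= 1.
  by rewrite divr_ge0 ?(ltW W0) //= ler_pdivrMr // mul1r.
have arc_e t : 0 < t < 1 -> psi (ed e t) / W = t /\ arc (ed e t) = - (2 * Num.sqrt (t * (1 - t))).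
  move=> /andP[t0 t1]; have W01 : 0 <= t <= 1 by rewrite !ltW.
  have E : psi (ed e t) / W = t by rewrite psi_ed // mulfK ?gt_eqF.
  split=> //; rewrite /arc E bump_ed //; ring.
apply: (@circle_homeo _ _ _ (fun x => 2 * (psi x / W) - 1) arc) => //.
- exact: affine_continuous.
- exact: arc_continuous (@bump_continuous R G e).
- move=> x /X_split[X'x|[t t01 ->]].
    rewrite arc_X' // exprMn sqr_sqrtr; first by ring.
    by have /andP[h0 h1] := p01 x; rewrite mulr_ge0 // subr_ge0.
  have [-> ->] := arc_e _ t01; have /andP[t0 t1] := t01.
  rewrite sqrrN exprMn sqr_sqrtr; first by ring.
  by rewrite mulr_ge0 ?subr_ge0 // ltW.
- have sep_arc x y : X' x -> (exists2 t, 0 < t < 1 & y = ed e t) -> arc x <> arc y.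
    move=> X'x [t t01 yE]; rewrite arc_X' // yE (arc_e _ t01).2 => E.
    have : 0 < Num.sqrt (t * (1 - t)) by rewrite sqrtr_gt0; case/andP: t01 => *; rewrite mulr_gt0 ?subr_gt0.
    move=> /(arcs_apart E); apply; exact: sqrtr_ge0.
  move=> x y Xx Xy E1 E2.
  have Exy : psi x / W = psi y / W.
    have h (r s : R) : 2 * r - 1 = 2 * s - 1 -> r = s by lra.
    exact: h.
  have [X'x|ex] := X_split Xx; have [X'y|ey] := X_split Xy.
  + by apply: psi_inj => //; apply: (mulIf _ Exy); rewrite invr_neq0 ?gt_eqF.
  + by case: (sep_arc x y X'x ey).
  + by case: (sep_arc y x X'y ex).
  + case: ex ey Exy => t t01 -> [s s01 ->].
    by rewrite (arc_e _ t01).1 (arc_e _ s01).1 => ->.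
- move=> u v uv; have [h0 h1 hv] := circle_half uv.
  have [v0|v0] := leP 0 v.
    have [|x X'x xE] := psi_surj (s := (1 + u) / 2 * W).
      by rewrite mulr_ge0 ?(ltW W0) //= ler_piMl // ltW.
    have pE : psi x / W = (1 + u) / 2 by rewrite xE mulfK ?gt_eqF.
    exists x; split; first by case: X'x.
      by rewrite pE; field.
    by rewrite arc_X' // pE hv ger0_norm.
  have t01 := circle_lower uv v0.
  exists (ed e ((1 + u) / 2)); have [-> ->] := arc_e _ t01; split; first exact/X_ed.
    by field.
  by rewrite hv ltr0_norm // opprK.
Qed.


Let cycle_of_loop : (forall g, C g -> g = e) -> topological_cycle R X.
Proof.
(* Otherwise the singleton of [src e] would be a decided set separating [e] alone. *)
move=> Ce1; have st : src e = tgt e.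
  apply: contrapT => ne; have [|f [/Ce1 fe]] := c1 (@dec1 _ _ YP (src e)) Ce; last by [].
  by move=> [/(_ erefl)/esym].
have le1P x : X x -> exists2 t, 0 <= t < 1 & x = ed e t.
  case: (dtopP x) => [v ->|g t t01 ->|w nd ->].
  - move=> /X_vp[g /Ce1 -> vE]; exists 0; first by rewrite lexx ltr01.
    by rewrite ed0; congr vp; case: vE => ->.
  - move=> /(X_ed _ t01) /Ce1 ->; exists t => //; by case/andP: t01 => t0 t1; rewrite ltW.
  - move=> /X_op Xw; exfalso; have [|n hn] := @layer_fin _ _ YP [set src e; tgt e].
      by rewrite finite_setU; split; exact: finite_set1.
    have [g /Ce1 -> ] := Xw n; have [z [Yz -> _]] := end_nodeP YP n nd.
    by case=> /comp_sub; apply: hn; [left|right].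
have [x0 x1] : loop_x (0 : R) = 1 /\ loop_x (1 : R) = 1 by rewrite /loop_x; split; ring.
have [y0 y1] : loop_y (0 : R) = 0 /\ loop_y (1 : R) = 0.
  by rewrite /loop_y !(subrr, mul0r, mulr0, sqrtr0).
apply: (@circle_homeo _ _ _ (fun x : dtop R G => chi e (@loop_x R) 1 (val x))
  (fun x : dtop R G => chi e (@loop_y R) 0 (val x))) => //.
- by apply: chi_continuous => //; exact: loop_x_continuous.
- by apply: chi_continuous => //; exact: loop_y_continuous.
- move=> x /le1P[t /andP[t0 t1] ->]; have t01 : 0 <= t <= 1 by rewrite t0 ltW.
  by rewrite !chi_ed //; exact: loop_circle.
- move=> x y /le1P[t /andP[t0 t1] ->] /le1P[s /andP[s0 s1] ->].
  have t01 : 0 <= t <= 1 by rewrite t0 ltW.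
  have s01 : 0 <= s <= 1 by rewrite s0 ltW.
  rewrite !chi_ed // => E1 E2; congr ed; apply: loop_inj => //; exact/andP.
- move=> u v /loop_surj[t [t01 tu tv]]; exists (ed e t); rewrite !chi_ed //.
  by split=> //; exact: X_edge.
Qed.

Let cycle_points_cycle : topological_cycle R X.
Proof.
have [[g Cg ge]|n] := pselect (exists2 g, C g & g <> e); first exact: cycle_of_arc ge.
by apply: cycle_of_loop => g Cg; apply: contrapT => ge; apply: n; exists g.
Qed.

Lemma cyclic_cycle_at : exists2 Z : set (dtop R G), topological_cycle R Z & edges_of Z = C.
Proof. by exists X; [exact: cycle_points_cycle|exact: edges_of_X]. Qed.

End CyclicCycle.

Lemma cyclic_cycle (R : realType) (G : graph) (Y : nat -> set (vertex G)) (C : set (edge G)) :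
  layering Y -> cyclic Y C ->
  exists2 X : set (dtop R G), topological_cycle R X & edges_of X = C.
Proof. by move=> YP cC; have [[e Ce] _ _] := cC; exact: (cyclic_cycle_at YP cC Ce). Qed.

Local Close Scope ring_scope.

Theorem theorem1p1 (R : realType) (G : graph) :
  exists M : matroid (edge G),
    circuits M =
      [set edges_of X | X in [set X : set (dtop R G) | topological_cycle R X]].
Proof.
have [Y YP] := @exists_layering G; exists (layer_matroid YP).
apply/seteqP; split=> [C /layer_circuitP cC|_ [X cX <-]].
  by have [X cX <-] := cyclic_cycle R YP cC; exists X.
by apply/layer_circuitP; exact: (cycle_cyclic YP).
Qed.
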